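(* Let $G$ be a graph on $n$ vertices whose complement has at most $5$ edges. Then $\mathrm{mlt}(G)=\mathrm{gcr}(G)\geq n-2$.
   Context: Let $G$ be a graph with vertex set $\{1,\dots,n\}$. The Gaussian graphical model of $G$ is the set of $n$-variate normal distributions $\mathcal{N}(0,\Sigma)$, $\Sigma$ positive definite, such that $(\Sigma^{-1})_{ij}=0$ whenever $i\neq j$ and $ij$ is not an edge of $G$. The maximum likelihood threshold $\mathrm{mlt}(G)$ is the minimum number $m$ such that, given $m$ i.i.d. samples from a distribution whose probability measure is mutually absolutely continuous with respect to Lebesgue measure, the maximum likelihood estimator of this model exists almost surely. A $d$-dimensional framework $(G,p)$ is a graph together with points $p(1),\dots,p(n)\in\mathbb{R}^d$; $p$ is generic if its coordinates satisfy no nonzero polynomial with rational coefficients. An equilibrium stress of $(G,p)$ is an assignment of real weights $\omega_{ij}$ to the edges such that $\sum_{j\sim i}\omega_{ij}(p(j)-p(i))=0$ for every vertex $i$. The generic completion rank is $\mathrm{gcr}(G)=d+1$, where $d$ is the smallest dimension such that no generic $d$-dimensional framework $(G,p)$ supports a non-zero equilibrium stress. *)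

(* Defs.v *)
From HB Require Import structures.
From mathcomp Require Import all_boot all_order all_algebra.
From mathcomp Require Import all_classical all_reals all_analysis.
(* The notations of mpoly clash with those of mathcomp-analysis. *)
From mathcomp Require mpoly.
Import (canonicals, coercions) mpoly.

Set Implicit Arguments.
Unset Strict Implicit.
Unset Printing Implicit Defensive.

Import Order.TTheory GRing.Theory Num.Theory.
Import numFieldNormedType.Exports.

Local Open Scope classical_set_scope.
Local Open Scope ring_scope.

Definition is_minimum (P : nat -> Prop) (k : nat) : Prop :=
  P k /\ forall j, P j -> (k <= j)%N.

(* A graph on 'I_n is an adjacency relation e : rel 'I_n; symmetry and
   irreflexivity are hypotheses of the theorem. *)
Definition complement_edges (n : nat) (e : rel 'I_n) : {set 'I_n * 'I_n} :=
  [set ij : 'I_n * 'I_n | (ij.1 < ij.2)%N && ~~ e ij.1 ij.2]%SET.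

(* n-dimensional Lebesgue measure, on the Borel sets of R^n: the measure
   transported from lebesgue_measure \x ... \x lebesgue_measure along
   (x, t) |-> x :: t. *)
Fixpoint lebesgue_tuple (R : realType) (n : nat) :
    set (n.-tuple (measurableTypeR R)) -> \bar R :=
  match n with
  | 0 => \d_[tuple]
  | k.+1 => pushforward (@lebesgue_measure R \x @lebesgue_tuple R k)%E
      (fun xt : measurableTypeR R * k.-tuple (measurableTypeR R) =>
         [tuple of xt.1 :: xt.2])
  end.

Section Gaussian.
Context {R : realType} {n : nat}.

Definition posdef (S : 'M[R]_n) : Prop :=
  S^T = S /\ forall v : 'cV[R]_n, v != 0 -> 0 < (v^T *m S *m v) 0 0.

(* A member N(0, Sigma) of the model is represented by its covariance Sigma. *)
Definition gaussian_model (e : rel 'I_n) : set 'M[R]_n :=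
  [set Sigma | posdef Sigma /\
     forall i j, i != j -> ~~ e i j -> invmx Sigma i j = 0].

(* \det ((2 * pi) *: Sigma) is (2 * pi) ^+ n * \det Sigma. *)
Definition gaussian_density (Sigma : 'M[R]_n) (x : n.-tuple R) : R :=
  let v : 'cV[R]_n := \col_i tnth x i in
  (Num.sqrt (\det ((2 * pi) *: Sigma)))^-1 *
    expR (- (v^T *m invmx Sigma *m v) 0 0 / 2).

Definition likelihood (m : nat) (x : 'I_m -> n.-tuple R) (Sigma : 'M[R]_n) : R :=
  \prod_(k < m) gaussian_density Sigma (x k).

Definition mle_exists (e : rel 'I_n) (m : nat) (x : 'I_m -> n.-tuple R) : Prop :=
  exists2 Sigma, gaussian_model e Sigma &
    forall Sigma', gaussian_model e Sigma' ->
      likelihood x Sigma' <= likelihood x Sigma.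

Definition iid_samples d (T : measurableType d) (P : probability T R) (m : nat)
    (X : 'I_m -> {RV P >-> n.-tuple (measurableTypeR R)})
    (mu : probability (n.-tuple (measurableTypeR R)) R) : Prop :=
  (forall k A, measurable A -> distribution P (X k) A = mu A) /\
  forall (J : {set 'I_m}) (A : 'I_m -> set (n.-tuple (measurableTypeR R))),
    (forall k, measurable (A k)) ->
    P (\bigcap_(k in [set` J]) (X k @^-1` A k)) =
    (\prod_(k in J) P (X k @^-1` A k))%E.

Definition mle_exists_as (e : rel 'I_n) (m : nat) : Prop :=
  forall mu : probability (n.-tuple (measurableTypeR R)) R,
    mu `<< @lebesgue_tuple R n -> @lebesgue_tuple R n `<< mu ->
  forall d (T : measurableType d) (P : probability T R)
    (X : 'I_m -> {RV P >-> n.-tuple (measurableTypeR R)}),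
    iid_samples X mu ->
    {ae P, forall w, mle_exists e (fun k => X k w)}.

End Gaussian.

(* Sample sizes are positive: for m = 0 the likelihood is an empty product, so
   every Sigma would be a maximizer. *)
Definition is_mlt (R : realType) (n : nat) (e : rel 'I_n) (m : nat) : Prop :=
  is_minimum (fun k => (0 < k)%N /\ mle_exists_as (R := R) e k) m.

Section Rigidity.
Context {R : realType} {n d : nat}.

(* Row i of p is the point p(i). *)
Definition generic (p : 'M[R]_(n, d)) : Prop :=
  forall q : mpoly.mpoly (n * d) rat, q != 0 ->
    mpoly.mmap (@ratr R) (fun k => mxvec p 0 k) q != 0.

(* An assignment of weights to the edges is encoded by a symmetric matrix that
   vanishes outside the edges. *)
Definition edge_weights (e : rel 'I_n) (w : 'M[R]_n) : Prop :=
  w^T = w /\ forall i j, ~~ e i j -> w i j = 0.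

Definition equilibrium_stress (e : rel 'I_n) (p : 'M[R]_(n, d)) (w : 'M[R]_n) :
    Prop :=
  edge_weights e w /\
  forall i, \sum_(j | e i j) w i j *: (row j p - row i p) = 0.

End Rigidity.

Definition generically_stress_free (R : realType) (n : nat) (e : rel 'I_n)
    (d : nat) : Prop :=
  ~ exists p : 'M[R]_(n, d),
      generic p /\ exists2 w, equilibrium_stress e p w & w != 0.

Definition is_gcr (R : realType) (n : nat) (e : rel 'I_n) (r : nat) : Prop :=
  exists2 d, is_minimum (generically_stress_free R e) d & r = d.+1.

(* Main.v *)
(* Up to the choice of the mean, a sample of size m is an n x m matrix X, and a
   stress is a symmetric K vanishing on the non-edges with K X = 0; rescaling
   the rows of X so that its first column becomes constant turns these into the
   equilibrium stresses of (m-1)-dimensional frameworks.  The likelihood has a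
   maximum if no nonzero stress exists (maximise det K over a compact slice of
   the cone of positive semidefinite K), and it has none if a nonzero stress
   B B^T exists, because det (K + B B^T) > det K while the quadratic term is
   unchanged.  Absence of stresses is a polynomial condition on X, so it holds
   almost surely, and for generic frameworks, as soon as it holds for one X.
   It remains to find r such that some X with r columns has no stress, while for
   every m < r the matrices X with m columns having a stress B B^T contain an
   open set.  Writing K = A S A^T with A an n x N matrix spanning the left
   kernel of X, the non-edges become conditions a_i S a_j^T = 0 on a form S in
   N variables.  One has r = n for the complete graph; r = n - 1 if there are at
   most two non-edges or they form a star; r = n - 2 otherwise, where N = 3
   leaves a stress because S has 6 coefficients and there are at most 5
   conditions.  To make it positive semidefinite on an open set, take an
   orthogonal representation A of the non-edges at which the conditions are
   independent and solve for S near the identity; a vertex on at least N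
   non-edges may first be deleted.  The remaining complements have maximal degree
   at most 2 and map to a pentagon, or to a triangle and a path, except
   those containing a 4-cycle: there S is degenerate, and one starts
   from diag(1, 1, 0). *)

Require Import Defs.
From HB Require Import structures.
From mathcomp Require Import all_boot all_order all_algebra.
From mathcomp Require Import all_classical all_reals all_analysis.
From mathcomp Require Import measurable_realfun ring lra zify.
From mathcomp Require mpoly.
Import (canonicals, coercions) mpoly.

Set Implicit Arguments.
Unset Strict Implicit.
Unset Printing Implicit Defensive.

Import Order.TTheory GRing.Theory Num.Theory.
Import numFieldNormedType.Exports.

Local Open Scope classical_set_scope.
Local Open Scope ring_scope.

(** * Product measures on tuples *)

Section SigmaFinite.
Context d (T : measurableType d) (R : realType).

(** Sigma-finiteness known as a proposition is turned into structure, as required for iterating the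
    product construction. *)
Lemma sigma_finite_measure_of (mu : {measure set T -> \bar R}) :
  sigma_finite setT mu ->
  {nu : {sigma_finite_measure set T -> \bar R} | mu = nu :> (set T -> \bar R)}.
Proof.
move=> sf.
pose H1 := isSFinite.Build _ _ _ (Measure.sort mu)
  (sfinite_measure_sigma_finite sf).
pose H2 := isSigmaFinite.Build _ _ _ (Measure.sort mu) sf.
by exists (HB.pack_for (SigmaFiniteMeasure.type T R) (Measure.sort mu) H1 H2).
Qed.

End SigmaFinite.

Section TupleMeasure.
Context d (T : measurableType d) (R : realType).

(** The recursion of [lebesgue_tuple] over an arbitrary base measure. It serves twice: for the
    coordinates of one vector and for the vectors of a sample. *)
Fixpoint tuple_measure (mu : set T -> \bar R) (m : nat) :
    set (m.-tuple T) -> \bar R :=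
  match m with
  | 0 => \d_[tuple]
  | k.+1 => pushforward (mu \x @tuple_measure mu k)%E
      (fun xt : T * k.-tuple T => [tuple of xt.1 :: xt.2])
  end.
Arguments tuple_measure mu m : clear implicits.

Lemma measurable_tuple_cons m :
  measurable_fun [set: T * m.-tuple T]
    (fun xt : T * m.-tuple T => [tuple of xt.1 :: xt.2]).
Proof. exact: measurable_cons. Qed.

Lemma measurable_tuple_uncons m :
  measurable_fun [set: m.+1.-tuple T]
    (fun t : m.+1.-tuple T => (thead t, [tuple of behead t])).
Proof.
apply: measurable_fun_pair; last exact: measurable_behead.
exact: measurable_tnth.
Qed.

(** Each stage forms the product with a bundled sigma-finite measure, so the induction returns one.
    Products of two increasing exhausting sequences, pulled back to tuples, exhaust the tuples by
    sets of finite measure. *)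
Lemma tuple_measure_sigma_finite (mu : {sigma_finite_measure set T -> \bar R}) m :
  {nu : {sigma_finite_measure set (m.-tuple T) -> \bar R} |
    tuple_measure mu m = nu}.
Proof.
elim: m => [|m [nu nuE]].
  by exists (\d_[tuple] : {sigma_finite_measure set (0.-tuple T) -> \bar R}).
pose f := fun xt : T * m.-tuple T => [tuple of xt.1 :: xt.2].
pose g := fun t : m.+1.-tuple T => (thead t, [tuple of behead t]).
pose p : {measure set (m.+1.-tuple T) -> \bar R} :=
  @measure_function_pushforward__canonical__measure_function_Measure
    _ _ _ _ _ (mu \x nu)%E f (@measurable_tuple_cons m).
have [] := @sigma_finite_measure_of _ _ _ p; last first.
  by move=> q qE; exists q; rewrite -qE /= nuE.
have /sigma_finiteP[F [FT ndF Foo]] := sigma_finiteT mu.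
have /sigma_finiteP[G [GT ndG Goo]] := sigma_finiteT nu.
have gmeas k : measurable (g @^-1` (F k `*` G k)).
  rewrite -[X in measurable X]setTI; apply: measurable_tuple_uncons => //.
  by apply: measurableX; [have [] := Foo k|have [] := Goo k].
exists (fun k => g @^-1` (F k `*` G k)).
  apply/seteqP; split => // t _.
  have : [set: T] (g t).1 by [].
  have : [set: m.-tuple T] (g t).2 by [].
  rewrite FT GT => -[j _ Gj] [i _ Fi]; exists (maxn i j) => //; split.
  - by move: Fi; exact/subsetPset/ndF/leq_maxl.
  - by move: Gj; exact/subsetPset/ndG/leq_maxr.
move=> k; split=> //.
(* Splitting a tuple undoes consing, so the pushforward gives the pulled-back rectangle its product
   measure. *)
rewrite /p /= /pushforward -comp_preimage (_ : g \o f = id) ?preimage_id//.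
  have [mF Fk] := Foo k; have [mG Gk] := Goo k.
  by rewrite product_measure1E// lte_mul_pinfty// ge0_fin_numE.
apply/funext => -[x t]; rewrite /g /f /=; congr pair.
by apply/val_inj.
Qed.

Section Instances.
Variables (mu : {sigma_finite_measure set T -> \bar R}) (m : nat).

Let tuple_measure0 : tuple_measure mu m set0 = 0%E.
Proof. by have [nu ->] := tuple_measure_sigma_finite mu m; exact: measure0. Qed.

Let tuple_measure_ge0 A : (0 <= tuple_measure mu m A)%E.
Proof. by have [nu ->] := tuple_measure_sigma_finite mu m; exact: measure_ge0. Qed.

Let tuple_measure_semi_sigma_additive : semi_sigma_additive (tuple_measure mu m).
Proof.
have [nu ->] := tuple_measure_sigma_finite mu m.
exact: measure_semi_sigma_additive.
Qed.

HB.instance Definition _ := isMeasure.Build _ _ _ (tuple_measure mu m)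
  tuple_measure0 tuple_measure_ge0 tuple_measure_semi_sigma_additive.

Let tuple_measure_sigma_finiteT : sigma_finite setT (tuple_measure mu m).
Proof.
by have [nu ->] := tuple_measure_sigma_finite mu m; exact: sigma_finiteT.
Qed.

HB.instance Definition _ := Measure_isSigmaFinite.Build _ _ _
  (tuple_measure mu m) tuple_measure_sigma_finiteT.

End Instances.

(** Fubini for null sets: the measure of [A] is the integral of the measures of its slices, and a
    nonnegative integral vanishes exactly when the integrand vanishes almost everywhere. *)
Lemma tuple_measure_null (mu : {sigma_finite_measure set T -> \bar R}) m
    (A : set (m.+1.-tuple T)) : measurable A ->
  tuple_measure mu m.+1 A = 0%E <->
  exists N, [/\ measurable N, mu N = 0%E & forall x, ~ N x ->
    tuple_measure mu m [set t : m.-tuple T | A [tuple of x :: t]] = 0%E].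
Proof.
move=> mA; pose f := fun xt : T * m.-tuple T => [tuple of xt.1 :: xt.2].
have mB : measurable (f @^-1` A).
  by rewrite -[X in measurable X]setTI; exact: measurable_tuple_cons.
have sE x : xsection (f @^-1` A) x = [set t : m.-tuple T | A [tuple of x :: t]].
  by apply/seteqP; split => t; rewrite /xsection /= ?inE.
have := measurable_fun_xsection (tuple_measure mu m) mB.
set h := (h in measurable_fun _ h) => mh.
have hE x : h x = tuple_measure mu m [set t : m.-tuple T | A [tuple of x :: t]].
  by rewrite /h /= sE.
have -> : tuple_measure mu m.+1 A = (\int[mu]_(x in setT) `|h x|)%E.
  by apply: eq_integral => x _; rewrite gee0_abs.
apply: (iff_trans (ae_eq_integral_abs mu measurableT mh)); split.
  move=> [N [mN N0 sub]]; exists N; split => // x xN; rewrite -hE.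
  by apply: contrapT => hx; apply: xN; apply: sub => /= /(_ Logic.I).
move=> [N [mN N0 sub]]; exists N; split => // x /= hx.
by apply: contrapT => xN; apply: hx => _; rewrite hE sub.
Qed.

Lemma measurable_tuple_slice m (A : set (m.+1.-tuple T)) x :
  measurable A -> measurable [set t : m.-tuple T | A [tuple of x :: t]].
Proof.
move=> mA; rewrite -[X in measurable X]setTI.
suff : measurable_fun setT (fun t : m.-tuple T => [tuple of x :: t]) by exact.
exact: measurable_cons.
Qed.

Definition box m (A : 'I_m -> set T) : set (m.-tuple T) :=
  [set t | forall i, A i (tnth t i)].

Lemma measurable_box m (A : 'I_m -> set T) :
  (forall i, measurable (A i)) -> measurable (box A).
Proof.
move=> mA.
have -> : box A = \bigcap_(i in [set` index_enum 'I_m]) ((@tnth m T)^~ i @^-1` A i).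
  apply/seteqP; split => t /= H i; first by move=> _; exact: H.
  by apply: H; rewrite /= mem_index_enum.
rewrite bigcap_seq; apply: big_rec => // i B _ mB.
apply: measurableI => //; rewrite -[X in measurable X]setTI.
exact: measurable_tnth.
Qed.

Lemma tuple_measure_box (mu : {sigma_finite_measure set T -> \bar R}) m
    (A : 'I_m -> set T) : (forall i, measurable (A i)) ->
  tuple_measure mu m (box A) = (\prod_(i < m) mu (A i))%E.
Proof.
elim: m A => [|m IH] A mA.
  rewrite big_ord0 /= diracE mem_set//= => -[].
  by case.
rewrite big_ord_recl -IH//= -product_measure1E//; last exact: measurable_box.
congr product_measure1; apply/seteqP; split => -[x t] /=.
  move=> H; split; first by have := H ord0; rewrite tnth0.
  by move=> i; have := H (lift ord0 i); rewrite tnthS.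
move=> [Ax At] i; case: (unliftP ord0 i) => [j ->|->]; last by rewrite tnth0.
by rewrite tnthS; exact: At.
Qed.

Lemma tuple_measure_dominates (mu nu : {sigma_finite_measure set T -> \bar R}) m :
  (forall A, measurable A -> nu A = 0%E -> mu A = 0%E) ->
  forall A, measurable A -> tuple_measure nu m A = 0%E ->
    tuple_measure mu m A = 0%E.
Proof.
move=> dom; elim: m => [//|m IH] A mA /(tuple_measure_null _ mA) [N [mN N0 sub]].
apply/(tuple_measure_null _ mA); exists N; split => //; first exact: dom.
by move=> x /sub; apply: IH; exact: measurable_tuple_slice.
Qed.

End TupleMeasure.

Arguments tuple_measure {d T R} mu m _.

(** * Polynomial functions *)

Section PolyFun.
Context {R : realType}.

(** Polynomial functions in the generators [G] with coefficients built from [C]. Null sets and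
    continuity use [C = setT]; generic points need integer coefficients, hence the parameter. *)
Inductive polyfun {T : Type} (C : set R) (G : set (T -> R)) : (T -> R) -> Prop :=
| polyfun_cst c : C c -> polyfun C G (fun=> c)
| polyfun_gen g : G g -> polyfun C G g
| polyfunD f g : polyfun C G f -> polyfun C G g ->
    polyfun C G (fun x => f x + g x)
| polyfunM f g : polyfun C G f -> polyfun C G g ->
    polyfun C G (fun x => f x * g x).

Lemma polyfun_sub T (C C' : set R) (G G' : set (T -> R)) f :
  C `<=` C' -> (forall g, G g -> polyfun C' G' g) ->
  polyfun C G f -> polyfun C' G' f.
Proof.
move=> CC' GG'; elim => [c /CC'|g /GG' //|f1 f2 _ IH1 _ IH2|f1 f2 _ IH1 _ IH2].
- exact: polyfun_cst.
- exact: polyfunD.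
- exact: polyfunM.
Qed.

Lemma polyfun_comp T U (C : set R) (G : set (T -> R)) (H : set (U -> R))
    (h : U -> T) f :
  (forall g, G g -> polyfun C H (g \o h)) ->
  polyfun C G f -> polyfun C H (f \o h).
Proof.
move=> GH; elim => [c Cc|g /GH //|f1 f2 _ IH1 _ IH2|f1 f2 _ IH1 _ IH2].
- exact: polyfun_cst.
- exact: polyfunD.
- exact: polyfunM.
Qed.

Lemma polyfun_sum T (C : set R) (G : set (T -> R)) I (r : seq I) (P : pred I)
    (F : I -> T -> R) : C 0 ->
  (forall i, P i -> polyfun C G (F i)) ->
  polyfun C G (fun x => \sum_(i <- r | P i) F i x).
Proof.
move=> C0 PF; elim: r => [|i r IH].
  rewrite (_ : (fun _ => _) = (fun=> 0)); first exact: polyfun_cst.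
  by apply/funext => x; rewrite big_nil.
have [Pi|nPi] := boolP (P i).
  rewrite (_ : (fun _ => _) =
    (fun x => F i x + \sum_(i <- r | P i) F i x)); last first.
    by apply/funext => x; rewrite big_cons Pi.
  by apply: polyfunD => //; exact: PF.
rewrite (_ : (fun _ => _) = (fun x => \sum_(i <- r | P i) F i x))//.
by apply/funext => x; rewrite big_cons (negbTE nPi).
Qed.

Lemma polyfun_prod T (C : set R) (G : set (T -> R)) I (r : seq I) (P : pred I)
    (F : I -> T -> R) : C 1 ->
  (forall i, P i -> polyfun C G (F i)) ->
  polyfun C G (fun x => \prod_(i <- r | P i) F i x).
Proof.
move=> C1 PF; elim: r => [|i r IH].
  rewrite (_ : (fun _ => _) = (fun=> 1)); first exact: polyfun_cst.
  by apply/funext => x; rewrite big_nil.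
have [Pi|nPi] := boolP (P i).
  rewrite (_ : (fun _ => _) =
    (fun x => F i x * \prod_(i <- r | P i) F i x)); last first.
    by apply/funext => x; rewrite big_cons Pi.
  by apply: polyfunM => //; exact: PF.
rewrite (_ : (fun _ => _) = (fun x => \prod_(i <- r | P i) F i x))//.
by apply/funext => x; rewrite big_cons (negbTE nPi).
Qed.

Lemma measurable_polyfun d (T : measurableType d) (C : set R)
    (G : set (T -> R)) f :
  (forall g, G g -> measurable_fun setT g) -> polyfun C G f ->
  measurable_fun setT f.
Proof.
move=> mG; elim => [c _|g /mG //|f1 f2 _ m1 _ m2|f1 f2 _ m1 _ m2].
- exact: measurable_cst.
- exact: measurable_funD.
- exact: measurable_funM.
Qed.

Definition tuple_gens T (G : set (T -> R)) m : set (m.-tuple T -> R) :=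
  [set h | exists g k, G g /\ h = (fun t => g (tnth t k))].
Arguments tuple_gens {T} G m _.

Definition zariski_null d (T : measurableType d) (mu : set T -> \bar R)
    (G : set (T -> R)) :=
  forall f, polyfun setT G f -> (exists x, f x != 0) ->
    mu [set x | f x = 0] = 0%E.

Lemma measurable_tuple_gens d (T : measurableType d) (G : set (T -> R)) m :
  (forall g, G g -> measurable_fun setT g) ->
  forall h, tuple_gens G m h -> measurable_fun setT h.
Proof.
move=> mG h [g [k [Gg ->]]].
by apply: (measurableT_comp (mG _ Gg)); exact: measurable_tnth.
Qed.

Lemma measurable_zero_set d (T : measurableType d) (G : set (T -> R)) f :
  (forall g, G g -> measurable_fun setT g) -> polyfun setT G f ->
  measurable [set x | f x = 0].
Proof.
move=> mG pf; have mf := measurable_polyfun mG pf.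
by rewrite -[X in measurable X]setTI; have := mf measurableT [set 0] (measurable_set1 _).
Qed.

(** Induction with Fubini. Fix a tail [t0] at which [f] is not identically zero in the head. Outside
    the null zero set of this polynomial in the head, the slice of [f] is a nonzero polynomial in
    the tail, and its zero set is null by induction. *)
Lemma zariski_null_tuple d (T : measurableType d)
    (mu : {sigma_finite_measure set T -> \bar R}) (G : set (T -> R)) m :
  (forall g, G g -> measurable_fun setT g) -> zariski_null mu G ->
  zariski_null (tuple_measure mu m) (tuple_gens G m).
Proof.
move=> mG nullG; elim: m => [|m IH] f pf [t0 ft0].
  rewrite (_ : [set x | _] = set0) ?measure0//.
  by apply/seteqP; split => // t /= ft; case/eqP: ft0; rewrite (tuple0 t0) -(tuple0 t).
have mA := measurable_zero_set (measurable_tuple_gens mG) pf.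
case/tupleP: t0 ft0 => x0 t0 ft0.
have px : polyfun setT G (fun x => f [tuple of x :: t0]).
  apply: polyfun_comp pf => _ [g [k [Gg ->]]] /=.
  case: (unliftP ord0 k) => [j ->|->].
    rewrite (_ : _ \o _ = (fun=> g (tnth t0 j))); first exact: polyfun_cst.
    by apply/funext => x /=; rewrite tnthS.
  by rewrite (_ : _ \o _ = g); [exact: polyfun_gen|exact/funext].
apply/(tuple_measure_null _ mA); exists [set x | f [tuple of x :: t0] = 0].
split; [exact: measurable_zero_set px|by apply: nullG => //; exists x0|].
move=> x /= /eqP fx; apply: IH; last by exists t0.
apply: polyfun_comp pf => _ [g [k [Gg ->]]] /=.
case: (unliftP ord0 k) => [j ->|->].
  rewrite (_ : _ \o _ = (fun t => g (tnth t j))).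
    by apply: polyfun_gen; exists g, j.
  by apply/funext => t /=; rewrite tnthS.
by rewrite (_ : _ \o _ = (fun=> g x)); [exact: polyfun_cst|exact/funext].
Qed.

(** Over one real variable a polynomial function is an evaluation of some [{poly R}], so a nonzero
    one has finitely many roots. *)
Lemma zariski_null_lebesgue :
  zariski_null (@lebesgue_measure R) [set (id : measurableTypeR R -> R)].
Proof.
move=> f pf [x0 fx0].
have [p pE] : exists p : {poly R}, f = (fun x => p.[x]).
  elim: pf {fx0} => [c _|g ->|f1 f2 _ [p ->] _ [q ->]|f1 f2 _ [p ->] _ [q ->]].
  - by exists c%:P; apply/funext => x; rewrite hornerC.
  - by exists 'X; apply/funext => x; rewrite hornerX.
  - by exists (p + q); apply/funext => x; rewrite hornerD.
  - by exists (p * q); apply/funext => x; rewrite hornerM.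
have p0 : p != 0 by apply: contra_neq fx0 => p0; rewrite pE p0 horner0.
apply: countable_lebesgue_measure0; apply: finite_set_countable.
apply: contrapT => /(infinite_set_fset (size p)) [B BA].
apply/negP; rewrite -ltnNge; apply: max_poly_roots => //.
  by apply/allP => x xB; apply/eqP; have := BA x xB; rewrite pE.
exact: finmap.fset_uniq.
Qed.

End PolyFun.
Arguments tuple_gens {R T} G m _.

Section PolyMatrix.
Context {R : realType} {T : Type}.
Variables (C : set R) (G : set (T -> R)).
Hypotheses (C0 : C 0) (C1 : C 1) (CN1 : C (-1)).

Lemma polyfunN f : polyfun C G f -> polyfun C G (fun x => - f x).
Proof.
move=> pf; rewrite (_ : (fun _ => _) = (fun x => -1 * f x)).
  by apply: polyfunM => //; exact: polyfun_cst.
by apply/funext => x; rewrite mulN1r.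
Qed.

Definition polymx p q (F : T -> 'M[R]_(p, q)) :=
  forall i j, polyfun C G (fun x => F x i j).

Lemma polymx_mul p q r (F : T -> 'M[R]_(p, q)) (H : T -> 'M[R]_(q, r)) :
  polymx F -> polymx H -> polymx (fun x => F x *m H x).
Proof.
move=> pF pH i j.
rewrite (_ : (fun _ => _) = (fun x => \sum_k F x i k * H x k j)).
  by apply: polyfun_sum => // k _; apply: polyfunM; [exact: pF|exact: pH].
by apply/funext => x; rewrite mxE.
Qed.

Lemma polymx_add p q (F H : T -> 'M[R]_(p, q)) :
  polymx F -> polymx H -> polymx (fun x => F x + H x).
Proof.
move=> pF pH i j; rewrite (_ : (fun _ => _) = (fun x => F x i j + H x i j)).
  by apply: polyfunD; [exact: pF|exact: pH].
by apply/funext => x; rewrite mxE.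
Qed.

Lemma polymx_opp p q (F : T -> 'M[R]_(p, q)) :
  polymx F -> polymx (fun x => - F x).
Proof.
move=> pF i j; rewrite (_ : (fun _ => _) = (fun x => - F x i j)).
  exact: polyfunN.
by apply/funext => x; rewrite mxE.
Qed.

Lemma polymx_tr p q (F : T -> 'M[R]_(p, q)) :
  polymx F -> polymx (fun x => (F x)^T).
Proof.
move=> pF i j; rewrite (_ : (fun _ => _) = (fun x => F x j i)); first exact: pF.
by apply/funext => x; rewrite mxE.
Qed.

Lemma polymx_scale p q (f : T -> R) (F : T -> 'M[R]_(p, q)) :
  polyfun C G f -> polymx F -> polymx (fun x => f x *: F x).
Proof.
move=> pf pF i j; rewrite (_ : (fun _ => _) = (fun x => f x * F x i j)).
  exact: polyfunM.
by apply/funext => x; rewrite mxE.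
Qed.

Lemma polymx_const p q (A : 'M[R]_(p, q)) :
  (forall i j, C (A i j)) -> polymx (fun=> A).
Proof. by move=> CA i j; exact: polyfun_cst. Qed.

Lemma polyfun_det p (F : T -> 'M[R]_p) :
  polymx F -> polyfun C G (fun x => \det (F x)).
Proof.
move=> pF; apply: polyfun_sum => // s _; apply: polyfunM.
  by apply: polyfun_cst; case: (perm.odd_perm s).
by apply: polyfun_prod => // i _; exact: pF.
Qed.

(** Adjugates stand in for inverses below, so that solutions of linear systems stay polynomial in
    the data. *)
Lemma polymx_adj p (F : T -> 'M[R]_p) :
  polymx F -> polymx (fun x => \adj (F x)).
Proof.
move=> pF i j.
rewrite (_ : (fun _ => _) = (fun x => (-1) ^+ (j + i) * \det (row' j (col' i (F x))))).
  apply: polyfunM.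
    by apply: polyfun_cst; rewrite -signr_odd; case: (odd _).
  apply: polyfun_det => k l.
  rewrite (_ : (fun _ => _) = (fun x => F x (lift j k) (lift i l))); first exact: pF.
  by apply/funext => x; rewrite !mxE.
by apply/funext => x; rewrite mxE.
Qed.

End PolyMatrix.

Lemma continuous_polyfun {R : realType} {T : topologicalType} (C : set R)
    (G : set (T -> R)) (f : T -> R) :
  (forall g, G g -> continuous g) -> polyfun C G f -> continuous f.
Proof.
move=> cG; elim => [c _|g /cG //|f1 f2 _ c1 _ c2|f1 f2 _ c1 _ c2] x.
- exact: cvg_cst.
- by apply: cvgD; [exact: c1|exact: c2].
- by apply: cvgM; [exact: c1|exact: c2].
Qed.

Definition entries {R : realType} {p q : nat} : set ('M[R]_(p, q) -> R) :=
  [set g | exists i j, g = (fun A : 'M[R]_(p, q) => A i j)].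

Lemma continuous_entries (R : realType) p q (g : 'M[R]_(p, q) -> R) :
  entries g -> continuous g.
Proof. by move=> [i [j ->]]; exact: coord_continuous. Qed.

(** * Independent samples *)

Lemma lebesgue_tupleE (R : realType) n :
  @lebesgue_tuple R n = tuple_measure (@lebesgue_measure R) n.
Proof. by elim: n => [//|n /= ->]. Qed.

Lemma tuple_measure_setT d (T : measurableType d) (R : realType)
    (mu : probability T R) m : tuple_measure mu m setT = 1%E.
Proof.
have -> : [set: m.-tuple T] = box (fun=> setT) by apply/seteqP; split.
by rewrite tuple_measure_box// big1// => i _; exact: probability_setT.
Qed.

(** A copy of [tuple_measure] over a probability, made to carry the probability instance. *)
Definition tuple_probability d (T : measurableType d) (R : realType)
  (mu : probability T R) m : set (m.-tuple T) -> \bar R := tuple_measure mu m.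
Arguments tuple_probability {d T R} mu m _.

HB.instance Definition _ d (T : measurableType d) (R : realType)
    (mu : probability T R) m := Measure.on (tuple_probability mu m).
HB.instance Definition _ d (T : measurableType d) (R : realType)
    (mu : probability T R) m :=
  Measure_isProbability.Build _ _ _ (tuple_probability mu m)
    (tuple_measure_setT mu m).

Lemma measurable_tupleE d (T : measurableType d) m :
  @measurable _ (m.-tuple T) =
  <<s [set B | exists2 A : 'I_m -> set T, (forall i, measurable (A i)) & B = box A] >>.
Proof.
apply/seteqP; split.
  apply: smallest_sub; first exact: smallest_sigma_algebra.
  move=> B; rewrite -bigcup_seq => -[i _ [A mA <-]].
  apply: sub_sigma_algebra.
  exists (fun j => if j == i then A else setT); first by move=> j; case: ifP.
  rewrite setTI; apply/seteqP; split => t /=.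
    by move=> At j; case: eqP => // ->.
  by move=> /(_ i); rewrite eqxx.
apply: smallest_sub; first exact: sigma_algebra_measurable.
by move=> _ [A mA ->]; exact: measurable_box.
Qed.

Section JointLaw.
Context d (T : measurableType d) d' (U : measurableType d') (R : realType).
Variables (P : probability T R) (m : nat) (X : 'I_m -> {RV P >-> U}).
Variable mu : probability U R.

Definition joint (w : T) : m.-tuple U := [tuple X k w | k < m].

Lemma measurable_joint : measurable_fun setT joint.
Proof.
apply/measurable_fun_tnthP => i.
rewrite (_ : _ \o _ = X i); first exact: measurable_funPT.
by apply/funext => w; rewrite /= tnth_mktuple.
Qed.

(** The two measures agree on boxes, which are stable under intersection and generate the measurable
    sets of tuples. *)
Lemma joint_law :
  (forall A : 'I_m -> set U, (forall k, measurable (A k)) ->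
    P (\bigcap_(k in [set: 'I_m]) (X k @^-1` A k)) = (\prod_(k < m) mu (A k))%E) ->
  forall A, measurable A -> P (joint @^-1` A) = tuple_measure mu m A.
Proof.
move=> H A mA.
pose Q : {measure set (m.-tuple U) -> \bar R} :=
  @measure_function_pushforward__canonical__measure_function_Measure
    _ _ _ _ _ P joint measurable_joint.
suff : Q A = tuple_measure mu m A by [].
apply: (measure_unique
  [set B | exists2 A : 'I_m -> set U, (forall i, measurable (A i)) & B = box A]
  (fun=> setT)) => //.
- exact: measurable_tupleE.
- move=> _ _ [B mB ->] [C mC ->]; exists (fun i => B i `&` C i).
    by move=> i; exact: measurableI.
  apply/seteqP; split => t /=.
    by move=> [Bt Ct] i; split; [exact: Bt|exact: Ct].
  by move=> BCt; split=> i; have [] := BCt i.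
- by move=> _; exists (fun=> setT) => //; apply/seteqP; split.
- by apply/seteqP; split => // t _; exists 0%N.
- move=> _ [B mB ->]; apply: etrans (esym (tuple_measure_box mu mB)).
  rewrite -H//; congr (P _).
  apply/seteqP; split => w /=.
    by move=> Bw k _; have := Bw k; rewrite tnth_mktuple.
  by move=> Bw k; rewrite tnth_mktuple; exact: Bw.
- by move=> _; rewrite /Q /= /pushforward preimage_setT probability_setT ltry.
Qed.

End JointLaw.

Section Samples.
Context {R : realType} {n m : nat}.

Definition sample_gens : set (m.-tuple (n.-tuple (measurableTypeR R)) -> R) :=
  tuple_gens (tuple_gens [set (id : measurableTypeR R -> R)] n) m.

Lemma measurable_coord_gens g :
  tuple_gens [set (id : measurableTypeR R -> R)] n g -> measurable_fun setT g.
Proof. by apply: measurable_tuple_gens => _ ->. Qed.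

Lemma measurable_sample_gens g : sample_gens g -> measurable_fun setT g.
Proof. by apply: measurable_tuple_gens; exact: measurable_coord_gens. Qed.

(** Proper algebraic sets are null for Lebesgue measure on vectors, hence for [mu] by domination,
    hence for the product of copies of [mu], which is the joint law. *)
Lemma iid_polyfun_ae (mu : probability (n.-tuple (measurableTypeR R)) R) d
    (T : measurableType d) (P : probability T R)
    (X : 'I_m -> {RV P >-> n.-tuple (measurableTypeR R)}) f :
  mu `<< @lebesgue_tuple R n -> iid_samples X mu ->
  polyfun setT sample_gens f -> (exists x, f x != 0) ->
  {ae P, forall w, f (joint X w) != 0}.
Proof.
move=> dom [dist indep] pf fx.
have mA := measurable_zero_set measurable_sample_gens pf.
exists (joint X @^-1` [set x | f x = 0]); split.
- by rewrite -[X in measurable X]setTI; exact: measurable_joint.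
- rewrite (joint_law (mu := mu))//; last first.
    move=> A mB; have := indep finset.setT A mB.
    rewrite (_ : [set` _] = setT); last first.
      by apply/seteqP; split => // i _ /=; rewrite inE.
    move=> ->; apply: eq_big => [i|i _]; first by rewrite inE.
    by have := dist i _ (mB i).
  apply: (zariski_null_tuple measurable_coord_gens) => //.
  move=> h ph hx.
  have mh := measurable_zero_set measurable_coord_gens ph.
  rewrite lebesgue_tupleE in dom.
  move/null_content_dominatesP : dom; apply => //.
  apply: (zariski_null_tuple _ (@zariski_null_lebesgue R)) => //.
  by move=> _ ->.
- by move=> w /= /negP; rewrite negbK => /eqP.
Qed.

End Samples.

(** The normal density is positive everywhere, so a set on which its integral vanishes is Lebesgue
    null. *)
Lemma lebesgue_dominates_normal (R : realType) :
  @lebesgue_measure R `<< normal_prob 0 1.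
Proof.
apply/null_content_dominatesP => A mA.
have pdf_gt0 x : (0 < normal_pdf 0 1 x :> R).
  rewrite normal_pdfE ?oner_eq0// mulr_gt0 ?expR_gt0//.
  by rewrite normal_peak_gt0 ?oner_eq0.
rewrite /normal_prob => int0.
have mf : measurable_fun A (fun x : measurableTypeR R => (normal_pdf 0 1 x)%:E).
  apply: measurable_funTS; apply/measurable_EFinP.
  exact: measurable_normal_pdf.
have /(ae_eq_integral_abs _ mA mf) [N [mN N0 sub]] :
    (\int[@lebesgue_measure R]_(x in A) `|(normal_pdf 0 1 x)%:E| = 0)%E.
  rewrite -[RHS]int0; apply: eq_integral => x _.
  by rewrite gee0_abs// lee_fin ltW.
apply/eqP; rewrite -measure_le0 -[leRHS]N0 le_measure ?inE//.
move=> x Ax; apply: sub => /= /(_ Ax) /eqP.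
by rewrite eqe gt_eqF.
Qed.

(** * Samples that charge every cube *)

Section PositiveSamples.
Context {R : realType} (n m : nat).

(** Independent standard normal coordinates charge the open cube around [x0], so a property failing
    throughout that cube cannot hold almost surely. This refutes almost sure existence of the
    estimator, and also shows that nonzero sets of polynomials are dense. *)
Lemma iid_samples_near (x0 : m.-tuple (n.-tuple R)) (eps : R) : 0 < eps ->
  exists mu : probability (n.-tuple (measurableTypeR R)) R,
  [/\ mu `<< @lebesgue_tuple R n, @lebesgue_tuple R n `<< mu &
    exists d (T : measurableType d) (P : probability T R)
      (X : 'I_m -> {RV P >-> n.-tuple (measurableTypeR R)}),
      iid_samples X mu /\
      forall Q : m.-tuple (n.-tuple R) -> Prop,
        (forall x, (forall k i, `|tnth (tnth x k) i - tnth (tnth x0 k) i| < eps) ->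
          ~ Q x) ->
        ~ {ae P, forall w, Q (joint X w)}].
Proof.
move=> eps_gt0.
pose nu : probability (measurableTypeR R) R := normal_prob 0 1.
pose mu : probability (n.-tuple (measurableTypeR R)) R := tuple_probability nu n.
have dom1 : nu `<< @lebesgue_measure R by exact: normal_prob_dominates.
have dom2 : @lebesgue_measure R `<< nu by exact: lebesgue_dominates_normal.
exists mu; split.
- rewrite lebesgue_tupleE; apply/null_content_dominatesP.
  by apply: tuple_measure_dominates; exact/null_content_dominatesP.
- rewrite lebesgue_tupleE; apply/null_content_dominatesP.
  by apply: tuple_measure_dominates; exact/null_content_dominatesP.
pose P : probability (m.-tuple (n.-tuple (measurableTypeR R))) R :=
  tuple_probability mu m.
(* The samples are the coordinate projections of the product space. *)
pose X k : {RV P >-> n.-tuple (measurableTypeR R)} :=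
  HB.pack_for {RV P >-> n.-tuple (measurableTypeR R)}
    (fun t : m.-tuple (n.-tuple (measurableTypeR R)) => tnth t k)
    (isMeasurableFun.Build _ _ _ _ _ (measurable_tnth k)).
have PE (A : 'I_m -> set (n.-tuple (measurableTypeR R))) :
    (forall k, measurable (A k)) -> P (box A) = (\prod_(k < m) mu (A k))%E.
  exact: tuple_measure_box.
have XE k (A : set (n.-tuple (measurableTypeR R))) :
    measurable A -> P (X k @^-1` A) = mu A.
  move=> mA.
  rewrite (_ : _ @^-1` _ = box (fun j => if j == k then A else setT)); last first.
    apply/seteqP; split => t /=; last by move/(_ k); rewrite eqxx.
    by move=> At j; case: eqP => // ->.
  rewrite PE; last by move=> j; case: ifP.
  rewrite (bigD1 k)//= eqxx big1 ?mule1// => j /negbTE ->.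
  exact: probability_setT.
exists _, _, P, X; split.
  split=> [k A|J A mA]; first exact: XE.
  rewrite (_ : \bigcap_(k in _) _ = box (fun k => if k \in J then A k else setT)).
    rewrite PE; last by move=> j; case: ifP.
    rewrite (bigID (mem J))/= [X in (_ * X)%E]big1 ?mule1; last first.
      by move=> j /negbTE ->; exact: probability_setT.
    by apply: eq_bigr => k kJ; rewrite kJ XE.
  apply/seteqP; split => t /=.
    by move=> H k; case: ifP => // kJ; exact: H.
  by move=> H k kJ; have := H k; rewrite kJ.
move=> Q nQ [N [mN PN0 sub]].
pose I k i : set (measurableTypeR R) :=
  `]tnth (tnth x0 k) i - eps, tnth (tnth x0 k) i + eps[%classic.
have mI k i : measurable (I k i) by exact: measurable_itv.
have nuI k i : (nu (I k i) != 0)%E.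
  apply/eqP => nu0; have := (null_content_dominatesP _ _).1 dom2 _ (mI k i) nu0.
  rewrite /I lebesgue_measure_itv /= lte_fin ltrD2l gtrN//.
  rewrite -EFinB => /eqP; rewrite eqe subr_eq0.
  by rewrite (inj_eq (addrI _)) gt_eqF// gtrN.
have bigprod_neq0 p (F : 'I_p -> \bar R) : (forall i, F i != 0)%E ->
    (\prod_(i < p) F i != 0)%E.
  move=> F0; elim/big_ind : _ => [|x y|i _]; [exact: oner_neq0|exact: mule_neq0|exact: F0].
have muB k : (mu (box (I k)) != 0)%E.
  rewrite [mu _](tuple_measure_box nu (mI k)).
  by apply: bigprod_neq0 => i; exact: nuI.
have PB : (P (box (fun k => box (I k))) != 0)%E.
  rewrite PE => [|k]; first exact: bigprod_neq0.
  exact: measurable_box.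
move/eqP : PB; apply; apply/eqP; rewrite -measure_le0 -[leRHS]PN0.
rewrite le_measure ?inE//.
  by apply: measurable_box => k; exact: measurable_box.
move=> t /= tI; apply: sub => /= Qt; apply: nQ Qt => k i.
have := tI k i; rewrite /I /= in_itv /= /joint tnth_mktuple /=.
by rewrite ltr_distl.
Qed.

End PositiveSamples.

(** * Generic points *)

Section Generic.
Context {R : realType}.

(** Uniqueness of base [B] digits: the lowest one is read off modulo [B], then the rest is divided
    by [B]. *)
Lemma radix_inj (B n : nat) (a b : 'I_n -> nat) :
  (forall i, a i < B)%N -> (forall i, b i < B)%N ->
  (\sum_(i < n) a i * B ^ i = \sum_(i < n) b i * B ^ i)%N -> a =1 b.
Proof.
elim: n a b => [a b _ _ _ []//|n IH a b aB bB].
rewrite !big_ord_recl /= !expn0 !muln1.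
have shift (c : 'I_n.+1 -> nat) : (\sum_(i < n) c (lift ord0 i) * B ^ bump 0 i =
    (\sum_(i < n) c (lift ord0 i) * B ^ i) * B)%N.
  by rewrite big_distrl; apply: eq_bigr => i _; rewrite /= expnSr mulnA.
rewrite !shift => eq_ab.
have B0 : (0 < B)%N by apply: leq_ltn_trans (aB ord0).
have ab0 : a ord0 = b ord0.
  have := congr1 (modn^~ B) eq_ab.
  by rewrite ![(_ + _ * B)%N]addnC !modnMDl !modn_small.
have tl : (fun i => a (lift ord0 i)) =1 (fun i => b (lift ord0 i)).
  apply: IH => [i|i|]; [exact: aB|exact: bB|].
  by move: eq_ab; rewrite ab0 => /addnI /eqP; rewrite eqn_pmul2r// => /eqP.
by move=> i; case: (unliftP ord0 i) => [j ->|->//]; exact: tl.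
Qed.

(* Kronecker substitution [x_i = t ^ (B ^ i)] with [B] larger than every
   exponent turns [q] into a nonzero univariate polynomial. *)
Lemma mmap_neq0 N (q : mpoly.mpoly N rat) : q != 0 ->
  exists x : N.-tuple R, mpoly.mmap (@ratr R) (tnth x) q != 0.
Proof.
move=> q0; pose B := (\sum_(m <- mpoly.msupp q) \sum_(i < N) m i).+1.
have mB m i : m \in mpoly.msupp q -> (m i < B)%N.
  move=> mq; rewrite ltnS (big_rem m)//= (bigD1 i)//=.
  by rewrite -addnA leq_addr.
pose w (m : mpoly.multinom N) := (\sum_(i < N) m i * B ^ i)%N.
have w_inj : {in mpoly.msupp q &, injective w}.
  move=> m1 m2 m1q m2q /radix_inj E; apply/mpoly.mnmP.
  by apply: E => i; exact: mB.
pose P : {poly R} := \sum_(m <- mpoly.msupp q) ratr (mpoly.mcoeff m q) *: 'X^(w m).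
have P0 : P != 0.
  have [m mq] : exists m, m \in mpoly.msupp q.
    case E : (mpoly.msupp q) => [|m s]; last by exists m; rewrite mem_head.
    by move/eqP : E; rewrite mpoly.msupp_eq0 (negbTE q0).
  apply: contraTneq mq => P0; rewrite -mpoly.mcoeff_eq0.
  have := congr1 (fun p : {poly R} => p`_(w m)) P0; rewrite coef0 coef_sum.
  have [mq|] := boolP (m \in mpoly.msupp q); last first.
    by rewrite -mpoly.mcoeff_eq0.
  rewrite (big_rem m)//= coefZ coefXn eqxx mulr1 big_seq big1 ?addr0.
    by move/eqP; rewrite fmorph_eq0.
  move=> m'; rewrite mem_rem_uniq ?mpoly.msupp_uniq// inE => /andP[mm' m'q].
  rewrite coefZ coefXn; case: eqP => [/w_inj E|]; last by rewrite mulr0.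
  by rewrite E ?eqxx in mm'.
have [t Pt] : exists t : R, P.[t] != 0.
  have /negP : ~~ all (root P) [seq i%:R | i <- iota 0 (size P)].
    apply/negP => /(max_poly_roots P0).
    rewrite size_map size_iota ltnn => E; suff : false by []; apply: E.
    rewrite map_inj_uniq ?iota_uniq//.
    by move=> i j /eqP; rewrite eqr_nat => /eqP.
  move/negP/allPn => [t _ Pt]; exists t; exact: Pt.
exists [tuple t ^+ (B ^ i) | i < N].
rewrite (_ : mpoly.mmap _ _ _ = P.[t])// /mpoly.mmap horner_sum.
apply: eq_bigr => m _; rewrite hornerZ hornerXn; congr (_ * _).
rewrite /mpoly.mmap1 /w expr_sum.
by apply: eq_bigr => i _; rewrite tnth_mktuple -exprM mulnC.
Qed.

Lemma polyfun_mmap N (q : mpoly.mpoly N rat) :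
  polyfun setT (tuple_gens [set (id : measurableTypeR R -> R)] N)
    (fun x => mpoly.mmap (@ratr R) (tnth x) q).
Proof.
apply: polyfun_sum => // m _; apply: polyfunM; first exact: polyfun_cst.
apply: polyfun_prod => // i _.
have -> : (fun x : N.-tuple R => tnth x i ^+ m i) =
    (fun x => \prod_(j < m i) tnth x i).
  by apply/funext => x; rewrite prodr_const card_ord.
by apply: polyfun_prod => // j _; apply: polyfun_gen; exists id, i.
Qed.

(** There are countably many nonzero rational polynomials, and each vanishes on a Lebesgue null set
    only. The union of these sets is null, whereas the whole space is not. *)
Lemma exists_generic n d : exists p : 'M[R]_(n, d), generic p.
Proof.
pose N := (n * d)%N.
(* The list of terms determines the polynomial and lives in a countable type, so [pickle] indexes
   the polynomials by natural numbers. *)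
pose code (q : mpoly.mpoly N rat) :=
  [seq (m, mpoly.mcoeff m q) | m <- mpoly.msupp q].
have code_inj : injective code.
  move=> q1 q2 E; apply/mpoly.mpolyP => m.
  have supp q : mpoly.msupp q = unzip1 (code q) by rewrite /unzip1 /code -map_comp map_id.
  have sE : mpoly.msupp q1 = mpoly.msupp q2 by rewrite !supp E.
  have [mq|mq] := boolP (m \in mpoly.msupp q1); last first.
    by rewrite !mpoly.memN_msupp_eq0// -sE.
  have : (m, mpoly.mcoeff m q1) \in code q2 by rewrite -E; exact: map_f.
  by move=> /mapP[m' _ [<- ->]].
pose L := tuple_measure (@lebesgue_measure R) N.
pose Z (k : nat) := [set x : N.-tuple (measurableTypeR R) | exists2 q, q != 0 &
  pickle (code q) = k /\ mpoly.mmap (@ratr R) (tnth x) q = 0].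
have ZP k : measurable (Z k) /\ L (Z k) = 0%E.
  have [[q q0 qk]|nq] := pselect (exists2 q, q != 0 & pickle (code q) = k).
    rewrite (_ : Z k = [set x | mpoly.mmap (@ratr R) (tnth x) q = 0]).
      split; first by apply: measurable_zero_set (polyfun_mmap q) => g;
        exact: measurable_coord_gens.
      apply: (zariski_null_tuple _ (@zariski_null_lebesgue R)).
      - by move=> _ ->.
      - exact: polyfun_mmap.
      - exact: mmap_neq0.
    apply/seteqP; split => x /=; last by move=> ?; exists q.
    by move=> [q' _ [q'k]]; rewrite (code_inj _ _ (pcan_inj pickleK (etrans qk (esym q'k)))).
  rewrite (_ : Z k = set0); first by split; rewrite ?measure0.
  by apply/seteqP; split => // x [q q0 [qk _]]; apply: nq; exists q.
have [x nx] : exists x, ~ (\bigcup_k Z k) x.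
  apply: contrapT => nex.
  have ZT : \bigcup_k Z k = setT.
    by apply/seteqP; split => // x _; apply: contrapT => nx; apply: nex; exists x.
  have LT : L setT = (\prod_(i < N) (@lebesgue_measure R) setT)%E.
    rewrite -tuple_measure_box//; congr (L _).
    by apply/seteqP; split.
  have : L.-negligible (\bigcup_k Z k).
    apply: negligible_bigcup => k; have [mZ Z0] := ZP k.
    by exists (Z k); split.
  rewrite ZT => /negligibleP => /(_ measurableT) L0.
  have {}L0 : L setT = 0%E by exact: L0.
  move/eqP : L0; rewrite LT; apply/negP.
   elim/big_ind : _ => [|y z|i _]; rewrite ?oner_neq0 //.
    exact: mule_neq0.
  apply/eqP => T0.
  (* The real line is not Lebesgue null, since it has normal probability 1. *)
  have := (null_content_dominatesP _ _).1 (normal_prob_dominates 0 1) _ measurableT T0.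
  by move=> /eqP; rewrite probability_setT; apply/negP; exact: oner_neq0.
exists (vec_mx (\row_k tnth x k)) => q q0.
apply/eqP => qx; apply: nx; exists (pickle (code q)) => //; exists q => //; split => //.
rewrite -[RHS]qx /mpoly.mmap; apply: eq_bigr => m _; congr (_ * _).
by apply: eq_bigr => i _; rewrite vec_mxK mxE.
Qed.

End Generic.

(** * Positive definite matrices *)

Section PosDef.
Context {R : realType}.

Definition quad n (K : 'M[R]_n) (v : 'cV[R]_n) : R := (v^T *m K *m v) 0 0.

Definition psd n (K : 'M[R]_n) : Prop := K^T = K /\ forall v, 0 <= quad K v.

Lemma posdef_psd n (K : 'M[R]_n) : posdef K -> psd K.
Proof.
move=> [sK pK]; split => // v; have [->|/pK/ltW//] := eqVneq v 0.
by rewrite /quad mulmx0 mxE.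
Qed.

Lemma quadD n (K L : 'M[R]_n) v : quad (K + L) v = quad K v + quad L v.
Proof. by rewrite /quad mulmxDr mulmxDl mxE. Qed.

Lemma quadZ n a (K : 'M[R]_n) v : quad (a *: K) v = a * quad K v.
Proof. by rewrite /quad -scalemxAr -scalemxAl mxE. Qed.

Lemma quad_congr n k (B : 'M[R]_(n, k)) (K : 'M[R]_k) v :
  quad (B *m K *m B^T) v = quad K (B^T *m v).
Proof. by rewrite /quad trmx_mul trmxK !mulmxA. Qed.

Lemma quad1 n (v : 'cV[R]_n) : quad 1%:M v = \sum_i v i 0 ^+ 2.
Proof.
rewrite /quad mulmx1 mxE; apply: eq_bigr => i _.
by rewrite mxE expr2.
Qed.

Lemma quad1_ge0 n (v : 'cV[R]_n) : 0 <= quad 1%:M v.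
Proof. by rewrite quad1 sumr_ge0// => i _; rewrite sqr_ge0. Qed.

Lemma quad1_eq0 n (v : 'cV[R]_n) : quad 1%:M v = 0 -> v = 0.
Proof.
rewrite quad1 => /eqP; rewrite psumr_eq0; last by move=> i _; rewrite sqr_ge0.
move=> /allP v0; apply/colP => i; rewrite mxE.
by have := v0 i (mem_index_enum _); rewrite sqrf_eq0 => /eqP.
Qed.

Lemma gram_quad n k (B : 'M[R]_(n, k)) v :
  quad (B *m B^T) v = quad 1%:M (B^T *m v).
Proof. by rewrite -quad_congr mulmx1. Qed.

Lemma gram_sym n k (B : 'M[R]_(n, k)) : (B *m B^T)^T = B *m B^T.
Proof. by rewrite trmx_mul trmxK. Qed.

Lemma posdef1 n : posdef (1%:M : 'M[R]_n).
Proof.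
split=> [|v v0]; first exact: trmx1.
rewrite -/(quad _ _) lt_neqAle quad1_ge0 andbT eq_sym.
by apply: contra v0 => /eqP/quad1_eq0 ->.
Qed.

Lemma posdefZ n a (K : 'M[R]_n) : 0 < a -> posdef K -> posdef (a *: K).
Proof.
move=> a0 [sK pK]; split=> [|v v0]; first by rewrite linearZ /= sK.
by rewrite -/(quad _ _) quadZ mulr_gt0// pK.
Qed.

Lemma posdefD n (K L : 'M[R]_n) : posdef K -> psd L -> posdef (K + L).
Proof.
move=> [sK pK] [sL pL]; split=> [|v v0]; first by rewrite linearD /= sK sL.
by rewrite -/(quad _ _) quadD ltr_pwDl// pK.
Qed.

Lemma gram_psd n k (B : 'M[R]_(n, k)) : psd (B *m B^T).
Proof. by split=> [|v]; rewrite ?gram_sym// gram_quad quad1_ge0. Qed.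

Lemma posdef_congr n (B K : 'M[R]_n) : B \in unitmx -> posdef K ->
  posdef (B *m K *m B^T).
Proof.
move=> uB [sK pK]; split=> [|v v0]; first by rewrite !trmx_mul trmxK sK mulmxA.
rewrite -/(quad _ _) quad_congr; apply: pK; apply: contra_neq v0 => Bv.
by rewrite -[v](mulKmx (_ : B^T \in unitmx)) ?unitmx_tr// Bv mulmx0.
Qed.

Lemma posdef_unit n (K : 'M[R]_n) : posdef K -> K \in unitmx.
Proof.
move=> [sK pK]; rewrite -row_free_unit -kermx_eq0; apply/rowV0P => u /sub_kermxP uK.
apply/eqP; apply: contraT => u0.
have := pK u^T; rewrite trmxK uK mul0mx mxE ltxx; apply.
by apply: contra u0 => /eqP/(congr1 trmx); rewrite trmxK linear0 => ->.
Qed.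

Lemma posdef_inv n (K : 'M[R]_n) : posdef K -> posdef (invmx K).
Proof.
move=> pK; have uK := posdef_unit pK; have [sK _] := pK.
have uK' : invmx K \in unitmx by rewrite unitmx_inv.
have := posdef_congr uK' pK.
by rewrite mulVmx// mul1mx trmx_inv sK.
Qed.

(** If [w = K v] were nonzero, moving from [v] a little in the direction [- w] would make the form
    negative. *)
Lemma psd_ker n (K : 'M[R]_n) v : psd K -> quad K v = 0 -> K *m v = 0.
Proof.
move=> [sK pK] Kv0; apply: contrapT => /eqP Kv.
pose w := K *m v.
have mxDE (A B : 'M[R]_1) : (A + B) 0 0 = A 0 0 + B 0 0 by rewrite mxE.
have mxNE (A : 'M[R]_1) : (- A) 0 0 = - A 0 0 by rewrite mxE.
have mxZE b (A : 'M[R]_1) : (b *: A) 0 0 = b * A 0 0 by rewrite mxE.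
have w_gt0 : 0 < quad 1%:M w by have [_] := posdef1 n; apply.
have quadt (t : R) : quad K (v - t *: w) =
    - t * (quad 1%:M w) *+ 2 + t ^+ 2 * quad K w.
  rewrite /quad (_ : (v - t *: w)^T = v^T - t *: w^T); last first.
    by apply/matrixP => i j; rewrite !mxE.
  rewrite !mulmxBl !mulmxBr.
  rewrite -!(scalemxAl, scalemxAr) !(mxDE, mxNE, mxZE).
  have -> : (v^T *m K *m v) 0 0 = 0 by exact: Kv0.
  have -> : v^T *m K *m w = w^T *m 1%:M *m w.
    by rewrite mulmx1 /w trmx_mul sK.
  have -> : w^T *m K *m v = w^T *m 1%:M *m w by rewrite mulmx1 -mulmxA.
  by ring.
have Kw := pK w.
(* The minimiser of the quadratic in [t], with 1 added to the denominator in case [quad K w] is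
   zero. *)
pose t := quad 1%:M w / (quad K w + 1).
have d_gt0 : 0 < quad K w + 1 by rewrite ltr_wpDl.
have := pK (v - t *: w); rewrite quadt.
have -> : - t * quad 1%:M w *+ 2 + t ^+ 2 * quad K w =
    - (t * (quad 1%:M w *+ 2 - t * quad K w)) by ring.
rewrite oppr_ge0 leNgt => /negP; apply; apply: mulr_gt0.
  by rewrite divr_gt0.
rewrite mulr2n -addrA ltr_wpDr// subr_ge0 /t mulrAC ler_pdivrMr//.
by rewrite mulrDr mulr1 lerDl ltW.
Qed.

Lemma psd_unit_posdef n (K : 'M[R]_n) : psd K -> K \in unitmx -> posdef K.
Proof.
move=> pK uK; split=> [|v v0]; first by case: pK.
rewrite -/(quad _ _) lt_neqAle (pK.2 v) andbT eq_sym.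
apply: contra v0 => /eqP/(psd_ker pK) Kv.
by rewrite -[v](mulKmx uK) Kv mulmx0.
Qed.

(** Block elimination: splitting off the first coordinate leaves the Schur complement [D'], to which
    the induction applies. *)
Lemma posdef_cholesky n (K : 'M[R]_n) : posdef K ->
  exists2 C : 'M[R]_n, C \in unitmx & K = C *m C^T.
Proof.
elim: n K => [|n IH] K pK.
  by exists 1%:M; rewrite ?unitmx1// thinmx0 [RHS]thinmx0.
rewrite -[n.+1]/(1 + n)%N in K pK *.
pose a := quad K (delta_mx 0 0).
pose b : 'cV[R]_n := dlsubmx K; pose D := drsubmx K.
have a_gt0 : 0 < a.
  apply: pK.2; apply/eqP => /matrixP /(_ 0 0); rewrite !mxE !eqxx => /eqP.
  by rewrite oner_eq0.
have KE : K = block_mx a%:M b^T b D.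
  rewrite -[LHS]submxK; congr block_mx; last first.
    by rewrite -[LHS]trmxK trmx_ursub pK.1.
  rewrite [LHS]mx11_scalar; congr (_%:M); rewrite /a /quad trmx_delta -rowE.
  rewrite -colE !mxE; congr (K _ _); exact/val_inj.
pose L := block_mx 1%:M 0 (a^-1 *: b) 1%:M : 'M[R]_(1 + n).
pose D' := D - a^-1 *: (b *m b^T).
have KLD : K = L *m block_mx a%:M 0 0 D' *m L^T.
  rewrite KE /L tr_block_mx !mulmx_block !trmx1 trmx0 linearZ /=.
  rewrite !(mulmx0, mul0mx, mulmx1, mul1mx, addr0, add0r).
  rewrite mul_scalar_mx mul_mx_scalar scalerA mulrV ?unitfE ?gt_eqF// !scale1r.
  have ab : a *: (a^-1 *: b) = b by rewrite scalerA divff ?gt_eqF// scale1r.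
  by congr block_mx; rewrite ab// -scalemxAr /D' addrC subrK.
have uL : L \in unitmx by rewrite unitmxE det_lblock !det1 mulr1 unitr1.
have pD' : posdef D'.
  split=> [|w w0].
    rewrite /D' linearB linearZ /= gram_sym; congr (_ - _).
    by rewrite /D trmx_drsub pK.1.
  have uLT : L^T \in unitmx by rewrite unitmx_tr.
  (* [D'] is the restriction of a form congruent to [K] to the vectors with first coordinate 0. *)
  have qE : quad (block_mx (a%:M : 'M[R]_1) 0 0 D') (col_mx 0 w) = quad D' w.
    rewrite /quad tr_col_mx mul_row_block mul_row_col.
    by rewrite !(mulmx0, mul0mx, addr0, add0r).
  rewrite -/(quad _ _) -qE -[col_mx _ w](mulKVmx uLT) -quad_congr -KLD.
  apply: pK.2.
  apply: contra_neq w0 => /(congr1 (mulmx L^T)); rewrite mulKVmx// mulmx0.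
  by rewrite -(col_mx0 R 1 n 1) => /eq_col_mx[].
have [C uC D'E] := IH _ pD'.
exists (L *m block_mx (Num.sqrt a)%:M 0 0 C).
  rewrite unitmx_mul uL unitmxE det_ublock det_scalar1 unitrM -unitmxE uC andbT.
  by rewrite unitfE gt_eqF// sqrtr_gt0.
rewrite {1}KLD trmx_mul !mulmxA; congr (_ *m _); rewrite -!mulmxA; congr (_ *m _).
rewrite tr_block_mx mulmx_block !trmx0 tr_scalar_mx -D'E -scalar_mxM.
by rewrite !(mulmx0, mul0mx, addr0, add0r) -expr2 sqr_sqrtr// ltW.
Qed.

Lemma posdef_det_gt0 n (K : 'M[R]_n) : posdef K -> 0 < \det K.
Proof.
move=> /posdef_cholesky[C uC ->]; rewrite det_mulmx det_tr -expr2.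
by rewrite lt_neqAle sqr_ge0 andbT eq_sym sqrf_eq0 -unitfE -unitmxE.
Qed.

(** The matrix bordering [K] by [b], [- b^T] and 1 is factored in two ways, eliminating the corner 1
    or eliminating [K]; comparing determinants gives the formula. *)
Lemma det_rank1_add n (K : 'M[R]_n) (b : 'cV[R]_n) : K \in unitmx ->
  \det (K + b *m b^T) = \det K * (1 + quad (invmx K) b).
Proof.
move=> uK; pose M := block_mx (1%:M : 'M[R]_1) (- b^T) b K.
have E1 : M = block_mx 1%:M 0 b 1%:M *m block_mx 1%:M (- b^T) 0 (K + b *m b^T).
  rewrite mulmx_block !(mulmx1, mul1mx, mulmx0, mul0mx, addr0).
  by rewrite mulmxN addrC addrK.
have E2 : M = block_mx (1%:M + b^T *m invmx K *m b) (- b^T *m invmx K) 0 1%:M *m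
    block_mx 1%:M 0 b K.
  rewrite mulmx_block !(mulmx1, mul1mx, mulmx0, mul0mx, addr0, add0r).
  by rewrite !mulNmx addrK -mulmxA mulVmx// mulmx1.
have := congr1 determinant E1; rewrite {1}E2 !det_mulmx.
rewrite !det_ublock !det_lblock !det1 !mul1r !mulr1 => <-.
by rewrite mulrC det_mx11 mxE mxE eqxx.
Qed.

(** The columns [b] of [B] are added one at a time. Each multiplies the determinant by
    [1 + quad (invmx K) b], which exceeds 1 unless [b] is zero. *)
Lemma det_gram_add n k (K : 'M[R]_n) (B : 'M[R]_(n, k)) : posdef K ->
  \det K <= \det (K + B *m B^T) ?= iff (B == 0).
Proof.
move=> pK.
suff [le1 lt1] : \det K <= \det (K + B *m B^T) /\
    (B != 0 -> \det K < \det (K + B *m B^T)).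
  split=> //; have [->|/lt1/lt_eqF//] := eqVneq B 0.
  by rewrite mul0mx addr0 eqxx.
elim: k K pK B => [|k IH] K pK B.
  by rewrite thinmx0 mul0mx addr0 eqxx.
rewrite -[k.+1]/(1 + k)%N in B *; rewrite -[B]hsubmxK.
set b := lsubmx B; set B' := rsubmx B.
rewrite tr_row_mx mul_row_col addrA.
have pKb : posdef (K + b *m b^T) by apply: posdefD => //; exact: gram_psd.
have [le2 lt2] := IH _ pKb B'.
have dK : 0 < \det K by exact: posdef_det_gt0.
have [_ pI] := posdef_inv pK.
have b_ge0 : 0 <= quad (invmx K) b by case: (posdef_psd (posdef_inv pK)).
have le3 : \det K <= \det (K + b *m b^T).
  by rewrite det_rank1_add ?posdef_unit// ler_peMr ?lerDl// ltW.
split; first exact: le_trans le3 le2.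
have [b0|b0] := eqVneq b 0; last first.
  move=> _; apply: lt_le_trans le2.
  by rewrite det_rank1_add ?posdef_unit// ltr_pMr// ltrDl; exact: pI.
have [B'0|B'0] := eqVneq B' 0; first by rewrite b0 B'0 row_mx0 eqxx.
by move=> _; apply: le_lt_trans le3 (lt2 B'0).
Qed.

End PosDef.

(** * Existence of the maximum likelihood estimator *)

Section MLE.
Context {R : realType} {n : nat}.
Variable e : rel 'I_n.

(** In terms of the precision matrix the model is linear: its members are the inverses of the
    positive definite elements of this space. *)
Definition model_space (K : 'M[R]_n) : Prop :=
  K^T = K /\ forall i j, i != j -> ~~ e i j -> K i j = 0.

Lemma model_spaceZ a K : model_space K -> model_space (a *: K).
Proof.
move=> [sK eK]; split=> [|i j ij eij]; first by rewrite linearZ /= sK.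
by rewrite mxE eK// mulr0.
Qed.

Lemma model_spaceD K L : model_space K -> model_space L -> model_space (K + L).
Proof.
move=> [sK eK] [sL eL]; split=> [|i j ij eij]; first by rewrite linearD /= sK sL.
by rewrite mxE eK// eL// addr0.
Qed.

Lemma model_space1 : model_space 1%:M.
Proof.
by split=> [|i j /negbTE ij _]; rewrite ?trmx1// mxE ij.
Qed.

Lemma gaussian_model_inv K : posdef K -> model_space K ->
  gaussian_model e (invmx K).
Proof.
move=> pK [_ eK]; split; first exact: posdef_inv.
by move=> i j ij eij; rewrite invmxK eK.
Qed.

Context {m : nat}.
Variable x : 'I_m -> n.-tuple R.

Let v k : 'cV[R]_n := \col_i tnth (x k) i.

(** The trace of [K] times the unnormalised sample covariance. *)
Definition energy (K : 'M[R]_n) : R := \sum_(k < m) quad K (v k).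

Lemma energyZ a K : energy (a *: K) = a * energy K.
Proof. by rewrite /energy mulr_sumr; apply: eq_bigr => k _; exact: quadZ. Qed.

Definition precision_likelihood (K : 'M[R]_n) : R :=
  (Num.sqrt (((2 * pi) ^+ n)^-1 * \det K)) ^+ m * expR (- energy K / 2).

Lemma likelihoodE S : posdef S -> likelihood x S = precision_likelihood (invmx S).
Proof.
move=> pS; rewrite /likelihood /gaussian_density /precision_likelihood big_split /=.
rewrite prodr_const card_ord; congr (_ ^+ _ * _).
  rewrite detZ det_inv -invfM sqrtrV// mulr_ge0//; last exact/ltW/posdef_det_gt0.
  by rewrite exprn_ge0// mulr_ge0// pi_ge0.
rewrite -expR_sum; congr expR; rewrite /energy -mulr_suml -sumrN.
by [].
Qed.

(** Adding [B *m B^T] to the precision matrix of a supposed maximiser stays in the model and keeps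
    the energy, but strictly increases the determinant. *)
Lemma mle_not_exists k (B : 'M[R]_(n, k)) : (0 < m)%N -> B != 0 ->
  (forall i j, i != j -> ~~ e i j -> (B *m B^T) i j = 0) ->
  (forall l, B^T *m v l = 0) -> ~ mle_exists e x.
Proof.
move=> m0 B0 eB Bv [S [pS eS] maxS].
pose K := invmx S; have pK : posdef K by exact: posdef_inv.
have mK : model_space K by split; [case: pK|exact: eS].
have pKB : posdef (K + B *m B^T) by apply: posdefD => //; exact: gram_psd.
have mKB : model_space (K + B *m B^T).
  by apply: model_spaceD => //; split; [exact: gram_sym|exact: eB].
have := maxS _ (gaussian_model_inv pKB mKB).
rewrite !likelihoodE//; last exact: posdef_inv.
rewrite invmxK -/K /precision_likelihood.
have -> : energy (K + B *m B^T) = energy K.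
  apply: eq_bigr => l _; rewrite quadD gram_quad Bv.
  by rewrite [X in _ + X]/quad mulmx0 mxE addr0.
rewrite ler_pM2r ?expR_gt0// leNgt => /negP; apply.
have [le_det eq_det] := det_gram_add B pK.
have lt_det : \det K < \det (K + B *m B^T).
  by rewrite lt_neqAle le_det andbT eq_det.
have kappa0 : 0 < ((2 * pi) ^+ n)^-1 :> R.
  by rewrite invr_gt0 exprn_gt0// mulr_gt0// pi_gt0.
(* Here [0 < m] makes the power strictly monotone. *)
rewrite ltrXn2r ?gtn_eqF ?sqrtr_ge0// ltr_sqrt ?ltr_pM2l//.
by rewrite mulr_gt0// posdef_det_gt0.
Qed.

End MLE.

Section MLEExistence.
Context {R : realType} {n : nat}.
Variable e : rel 'I_n.
Context {m : nat}.
Variable x : 'I_m -> n.-tuple R.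

Let v k : 'cV[R]_n := \col_i tnth (x k) i.

Lemma polymx_vec_mx C (C0 : C 0) :
  polymx C entries (vec_mx : 'rV[R]_(n * n) -> 'M[R]_n).
Proof.
move=> i j; rewrite (_ : (fun _ => _) =
    (fun u : 'rV[R]_(n * n) => u 0 (mxvec_index i j))).
  by apply: polyfun_gen; exists 0, (mxvec_index i j).
by apply/funext => u; rewrite mxE.
Qed.

Lemma polyfun_quad w :
  polyfun setT entries (fun u : 'rV[R]_(n * n) => quad (vec_mx u) w).
Proof.
have : polymx setT entries (fun u : 'rV[R]_(n * n) => w^T *m vec_mx u *m w).
  by apply: polymx_mul => //; [apply: polymx_mul => //; [exact: polymx_const|
    exact: polymx_vec_mx]|exact: polymx_const].
exact.
Qed.

Let cont_poly f := @continuous_polyfun R 'rV[R]_(n * n) setT entries f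
  (@continuous_entries R 1 (n * n)).

Let closed_eq0 (f : 'rV[R]_(n * n) -> R) :
  polyfun setT entries f -> closed [set u | f u = 0].
Proof.
move=> /cont_poly cf; apply: (@preimage_closed _ _ f [set y | y = 0]).
  by move=> u _; exact: cf.
exact: closed_eq.
Qed.

(** Matrices are flattened to row vectors, the form in which the extreme value theorem is
    applied. *)
Definition psd_cone : set 'rV[R]_(n * n) :=
  [set u | psd (vec_mx u) /\ model_space e (vec_mx u)].

Lemma closed_psd_cone : closed psd_cone.
Proof.
have -> : psd_cone =
  (\bigcap_(ij in [set: 'I_n * 'I_n])
    [set u | vec_mx u ij.2 ij.1 + - vec_mx u ij.1 ij.2 = 0]) `&`
  ((\bigcap_(w in [set: 'cV[R]_n]) [set u | 0 <= quad (vec_mx u) w]) `&`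
  (\bigcap_(ij in [set ij : 'I_n * 'I_n | ij.1 != ij.2 /\ ~~ e ij.1 ij.2])
     [set u | vec_mx u ij.1 ij.2 = 0])).
  apply/seteqP; split => u /=.
    move=> [[sK pK] [_ eK]]; split; [|split].
    - by move=> [i j] _ /=; rewrite -[in X in X + _]sK mxE addrN.
    - by move=> w _; exact: pK.
    - by move=> [i j] /= [ij eij]; exact: eK.
  move=> [sK [pK eK]].
  have sK' : (vec_mx u : 'M[R]_n)^T = vec_mx u.
    apply/matrixP => i j; rewrite mxE; apply/eqP; rewrite -subr_eq0; apply/eqP.
    exact: (sK (i, j)).
  split; split => //; first by move=> w; exact: pK.
  by move=> i j ij eij; exact: (eK (i, j)).
apply: closedI; last apply: closedI.
- apply: closed_bigI => -[i j] _; apply: closed_eq0.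
  by apply: polyfunD; [|apply: polyfunN => //]; exact: polymx_vec_mx.
- apply: closed_bigI => w _.
  apply: (@preimage_closed _ _ (fun u => quad (vec_mx u) w) [set y | 0 <= y]).
    by move=> u _; exact: cont_poly (polyfun_quad w) u.
  exact: closed_ge.
- by apply: closed_bigI => -[i j] _; apply: closed_eq0; exact: polymx_vec_mx.
Qed.

Let ecoord (u : 'rV[R]_(n * n)) := energy x (vec_mx u).

Let ecoord_poly : polyfun setT entries ecoord.
Proof. by apply: polyfun_sum => // k _; exact: polyfun_quad. Qed.

Let det_poly : polyfun setT entries (fun u : 'rV[R]_(n * n) => \det (vec_mx u)).
Proof. by apply: polyfun_det => //; exact: polymx_vec_mx. Qed.

Let psd_coneZ a u : 0 <= a -> psd_cone u -> psd_cone (a *: u).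
Proof.
move=> a0 [[sK pK] mK]; rewrite /psd_cone /= linearZ /=; split.
  by split=> [|w]; [rewrite linearZ /= sK|rewrite quadZ mulr_ge0].
exact: model_spaceZ.
Qed.

Let ecoordZ a u : ecoord (a *: u) = a * ecoord u.
Proof. by rewrite /ecoord linearZ /= energyZ. Qed.

Let psd_cone1 : psd_cone (mxvec 1%:M).
Proof.
rewrite /psd_cone /= mxvecK; split; last exact: model_space1.
exact/posdef_psd/posdef1.
Qed.

Hypothesis stress_free :
  forall K, model_space e K -> (forall k, K *m v k = 0) -> K = 0.

(** A positive semidefinite [K] of zero energy kills every sample vector by [psd_ker], so it is a
    stress and vanishes. *)
Let ecoord_gt0 u : psd_cone u -> u != 0 -> 0 < ecoord u.
Proof.
move=> [pK mK] u0; rewrite lt_neqAle; apply/andP; split; last first.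
  by apply: sumr_ge0 => k _; case: pK.
apply: contra u0 => /eqP/esym/eqP; rewrite psumr_eq0; last by case: pK.
move=> /allP q0; rewrite -(vec_mxK u); apply/eqP.
rewrite (stress_free mK) ?linear0// => k; apply: psd_ker => //.
by apply/eqP; exact: (q0 k (mem_index_enum k)).
Qed.

Hypotheses (n_gt0 : (0 < n)%N) (m_gt0 : (0 < m)%N).

Let mxvec1_neq0 : mxvec 1%:M != 0 :> 'rV[R]_(n * n).
Proof.
rewrite -(inj_eq (can_inj vec_mxK)) mxvecK linear0.
apply/eqP => /matrixP /(_ (Ordinal n_gt0) (Ordinal n_gt0)).
by rewrite !mxE eqxx => /eqP; rewrite oner_eq0.
Qed.

(** The energy is positive on the compact set of cone elements of norm 1, so it has a positive
    minimum there; homogeneity extends the bound to the cone. *)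
Lemma energy_bounded_below :
  exists2 delta, 0 < delta & forall u, psd_cone u -> delta * `|u| <= ecoord u.
Proof.
pose S := psd_cone `&` [set u | `|u| = 1].
have normS u : psd_cone u -> u != 0 -> S (`|u|^-1 *: u).
  move=> cu u0; split; first by apply: psd_coneZ => //; rewrite invr_ge0.
  by rewrite /= normrZ normfV normr_id mulVf// normr_eq0.
have cS : compact S.
  apply: bounded_closed_compact.
    exists 1; split => // M M1 u [_ /= ->]; exact: ltW.
  apply: closedI; first exact: closed_psd_cone.
  apply: (@preimage_closed _ _ (fun u : 'rV[R]_(n * n) => `|u|) [set y | y = 1]).
    by move=> u _; exact: norm_continuous.
  exact: closed_eq.
have S0 : S !=set0 by eexists; exact: normS psd_cone1 mxvec1_neq0.
have [c /set_mem [cc c1] minc] := EVT_min_rV S0 cS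
  (continuous_subspaceT (cont_poly ecoord_poly)).
exists (ecoord c).
  by apply: ecoord_gt0 => //; rewrite -normr_eq0 c1 oner_eq0.
move=> u cu; have [->|u0] := eqVneq u 0.
  by rewrite normr0 mulr0; apply: sumr_ge0 => k _; rewrite linear0 /quad mulmx0 mul0mx mxE.
have := minc _ (mem_set (normS u cu u0)).
by rewrite ecoordZ mulrC ler_pdivlMr ?normr_gt0.
Qed.

(** The lower bound on the energy makes the slice of energy 1 compact, so the determinant has a
    maximum on it. Scaling an arbitrary [L] onto the slice yields the factor [energy x L ^+ n]. *)
Lemma max_det_on_slice : exists K, [/\ posdef K, model_space e K, energy x K = 1 &
  forall L, posdef L -> model_space e L ->
    \det L <= energy x L ^+ n * \det K].
Proof.
have [delta d0 bound] := energy_bounded_below.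
pose S := psd_cone `&` [set u | ecoord u + -1 = 0].
have normS u : psd_cone u -> u != 0 -> S ((ecoord u)^-1 *: u).
  move=> cu u0; have eu := ecoord_gt0 cu u0; split.
    by apply: psd_coneZ => //; rewrite invr_ge0 ltW.
  by rewrite /= ecoordZ mulVf ?gt_eqF// addrN.
have cS : compact S.
  apply: bounded_closed_compact.
    exists delta^-1; split => [|M M1 u [cu /eqP]]; first exact: num_real.
    rewrite /= subr_eq0 => /eqP eu.
    apply: le_trans (ltW M1); rewrite -[leRHS]mul1r ler_pdivlMr// mulrC -eu.
    exact: bound.
  apply: closedI; first exact: closed_psd_cone.
  apply: closed_eq0; apply: polyfunD; first exact: ecoord_poly.
  exact: polyfun_cst.
have S0 : S !=set0 by eexists; exact: normS psd_cone1 mxvec1_neq0.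
have [c /set_mem [[pc mc] /eqP c1] maxc] := EVT_max_rV S0 cS
  (continuous_subspaceT (cont_poly det_poly)).
have cmp L : posdef L -> model_space e L ->
    \det L <= energy x L ^+ n * \det (vec_mx c).
  move=> pL mL; have L0 : mxvec L != 0.
    rewrite -(inj_eq (can_inj vec_mxK)) mxvecK linear0.
    apply/eqP => L0; have := mulmxV (posdef_unit pL); rewrite L0 mul0mx => E.
    by move: mxvec1_neq0; rewrite -E linear0 eqxx.
  have cL : psd_cone (mxvec L).
    by rewrite /psd_cone /= mxvecK; split => //; exact: posdef_psd.
  have eL : 0 < energy x L by have := ecoord_gt0 cL L0; rewrite /ecoord mxvecK.
  have := maxc _ (mem_set (normS _ cL L0)).
  rewrite /ecoord mxvecK linearZ /= mxvecK detZ exprVn mulrC.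
  by rewrite ler_pdivrMr ?exprn_gt0// mulrC.
exists (vec_mx c); split => //; last by apply/eqP; move: c1; rewrite /= subr_eq0.
(* The maximiser is nonsingular: otherwise comparison with the identity matrix would give 1 at most
   0. *)
apply: psd_unit_posdef => //.
rewrite unitmxE unitfE; apply/eqP => det0.
have := cmp _ (@posdef1 R n) (model_space1 e).
by rewrite det0 mulr0 det1 ler10.
Qed.

(** With [u = a / N] this is the N-th power of the inequality between [u] and [expR (u - 1)]. *)
Lemma expr_expRN_max (a : R) N : 0 < a -> 0 < N%:R :> R ->
  a ^+ N * expR (- a) <= N%:R ^+ N * expR (- N%:R).
Proof.
move=> a0 N0; pose u := a / N%:R.
have u0 : 0 <= u by rewrite divr_ge0// ltW.
have aE : a = N%:R * u by rewrite mulrCA divff ?gt_eqF// mulr1.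
have le_u : u <= expR (u - 1) by have := expR_ge1Dx (u - 1); rewrite addrC subrK.
have le_uN : u ^+ N <= expR (a - N%:R).
  apply: le_trans (_ : expR (u - 1) ^+ N <= _).
    by rewrite lerXn2r// nnegrE// expR_ge0.
  by rewrite -expRM_natl mulrBr mulr1 -aE.
rewrite [X in X ^+ _ * _]aE exprMn -mulrA ler_pM2l ?exprn_gt0//.
rewrite -ler_pdivlMr ?expR_gt0// -expRN opprK -expRD addrC.
exact: le_uN.
Qed.

Lemma mle_exists_stress_free : mle_exists e x.
Proof.
have [K [pK mK eK maxK]] := max_det_on_slice.
(* Along the ray of [K] the squared likelihood is proportional to [a ^+ (n * m) * expR (- a)], which
   is largest at [a = n * m]. *)
pose a : R := (n * m)%:R.
have a0 : 0 < a by rewrite ltr0n muln_gt0 n_gt0.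
have paK : posdef (a *: K) by exact: posdefZ.
have maK : model_space e (a *: K) by exact: model_spaceZ.
exists (invmx (a *: K)); first exact: gaussian_model_inv.
move=> S [pS eS]; pose L := invmx S.
have pL : posdef L by exact: posdef_inv.
have mL : model_space e L by split; [case: pL|exact: eS].
rewrite !likelihoodE//; last exact: posdef_inv.
rewrite invmxK -/L /precision_likelihood energyZ eK mulr1 detZ.
set kappa := (_ ^+ n)^-1.
have kappa0 : 0 < kappa by rewrite invr_gt0 exprn_gt0// mulr_gt0// pi_gt0.
set s := energy x L.
have dL := posdef_det_gt0 pL; have dK := posdef_det_gt0 pK.
have s0 : 0 < s.
  rewrite lt_neqAle; apply/andP; split; last first.
    by apply: sumr_ge0 => k _; case: (posdef_psd pL).
  apply/eqP => s0; have := maxK L pL mL.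
  by rewrite -/s -s0 expr0n gtn_eqF// mul0r leNgt dL.
(* Squaring removes the square root and the 1/2 in the exponent. *)
rewrite -(@ler_pXn2r _ 2) ?nnegrE//.
rewrite !exprMn -!exprM ![(m * 2)%N]mulnC !exprM !sqr_sqrtr; last 2 first.
- by apply: ltW; rewrite !mulr_gt0// exprn_gt0.
- by apply: ltW; rewrite mulr_gt0.
have half (b : R) : expR (- b / 2) ^+ 2 = expR (- b).
  by rewrite -expRM_natl mulrCA divff ?pnatr_eq0// mulr1.
rewrite !half.
(* The slice bound replaces the determinant of [L] by a multiple of that of [K]; what remains
   depends on the energy [s] alone. *)
apply: le_trans (_ : (kappa * (s ^+ n * \det K)) ^+ m * expR (- s) <= _).
  rewrite ler_pM2r ?expR_gt0//; apply: lerXn2r.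
  - by rewrite nnegrE ltW// mulr_gt0.
  - by rewrite nnegrE ltW// !mulr_gt0// exprn_gt0.
  - by rewrite ler_pM2l//; exact: maxK.
rewrite ![kappa * (_ * _)]mulrCA ![(_ * (kappa * _)) ^+ m]exprMn -!exprM.
rewrite -![_ * _ ^+ m * _]mulrA ![_ ^+ m * expR _]mulrC !mulrA.
rewrite ler_pM2r ?exprn_gt0 ?mulr_gt0//.
by apply: expr_expRN_max.
Qed.

End MLEExistence.

(** * Stresses on an open set of samples *)

Section Perturbation.
Context {R : realType} {n N c m : nat}.
Variables (W : seq 'I_n) (A0 : 'M[R]_(n, N)) (S0 : 'M[R]_N).
Variables (E : 'I_c -> 'I_n * 'I_n) (D : 'I_c -> 'M[R]_N).

Definition edge_form (A : 'M[R]_(n, N)) (S : 'M[R]_N) (x : 'I_n * 'I_n) : R :=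
  (A *m S *m A^T) x.1 x.2.

Lemma edge_formE A S x :
  edge_form A S x = \sum_k \sum_l A x.1 k * S k l * A x.2 l.
Proof.
rewrite /edge_form mxE exchange_big /=; apply: eq_bigr => l _.
by rewrite !mxE big_distrl.
Qed.

Hypotheses (sS0 : S0^T = S0) (sD : forall k, (D k)^T = D k).
Hypothesis A0W : forall i, i \in W -> row i A0 = 0.
Hypothesis orthE : forall k, edge_form A0 S0 (E k) = 0.
Hypothesis dualE : forall k l, edge_form A0 (D k) (E l) = (k == l)%:R.
Hypothesis dim : (size W + N + m <= n)%N.

Let Wmx : 'M[R]_(n, size W) := \matrix_(i, k) (i == tnth (in_tuple W) k)%:R.
Let off : 'M[R]_n := \matrix_(i, j) ((i == j) && (i \notin W))%:R.

(** The left kernel of [A0] extended by the unit columns of [W] has dimension at least [m] by [dim].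
    Independent vectors from it annihilate [A0] and vanish on [W], and their real Gram matrix is
    invertible. *)
Lemma annihilator_exists : exists X0 : 'M[R]_(n, m),
  [/\ X0^T *m A0 = 0, off *m X0 = X0 & X0^T *m X0 \in unitmx].
Proof.
pose M := kermx (row_mx A0 Wmx).
have rM : (m <= \rank M)%N.
  rewrite mxrank_ker; have := rank_leq_col (row_mx A0 Wmx).
  by move: dim; lia.
pose Y : 'M[R]_(m, n) := pid_mx m *m row_base M.
have fY : row_free Y.
  by rewrite /row_free mxrankMfree ?row_base_free// rank_pid_mx.
have YM : Y *m row_mx A0 Wmx = 0.
  apply/sub_kermxP; apply: submx_trans (submxMl _ _) _.
  by rewrite eq_row_base.
move: YM; rewrite mul_mx_row => /(congr1 (fun B => (lsubmx B, rsubmx B))).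
rewrite row_mxKl row_mxKr !linear0 => -[YA YW].
exists Y^T; split; first by rewrite trmxK.
  apply/matrixP => i k; rewrite mxE (bigD1 i)//= big1 ?addr0; last first.
    by move=> j /negbTE ji; rewrite !mxE eq_sym ji mul0r.
  rewrite !mxE eqxx /=; have [iW|_] := boolP (i \in W); last by rewrite mul1r.
  rewrite mul0r; have /tnthP[l il] : i \in in_tuple W by [].
  have := congr1 (fun B : 'M[R]_(m, size W) => B k l) YW; rewrite mxE (bigD1 i)//= big1.
    by rewrite !mxE il eqxx mulr1 addr0 => ->.
  by move=> j ji; rewrite !mxE -il (negbTE ji) mulr0.
rewrite trmxK -row_free_unit -kermx_eq0; apply/rowV0P => u /sub_kermxP uY.
have : quad 1%:M (u *m Y)^T = 0.
  by rewrite /quad mulmx1 trmxK trmx_mul mulmxA -(mulmxA u) uY mul0mx mxE.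
move=> /quad1_eq0 /(congr1 trmx); rewrite trmxK linear0 => uY0.
by apply: (row_free_inj fY); rewrite uY0 mul0mx.
Qed.

(** The columns of [A0] projected orthogonally, among vectors supported off [W], to the annihilator
    of [X]. Multiplying by the Gram determinant makes the result polynomial in [X]. *)
Let adjA (X : 'M[R]_(n, m)) : 'M[R]_(n, N) :=
  \det (X^T *m off *m X) *: A0
    - off *m X *m \adj (X^T *m off *m X) *m (X^T *m A0).

Let gramE (A : 'M[R]_(n, N)) : 'M[R]_c :=
  \matrix_(l, k) edge_form A (D k) (E l).

(** Cramer's rule, cleared of denominators: [S0] is corrected by a combination of the [D k] so that
    all edge conditions hold for [A]. *)
Let solveS (A : 'M[R]_(n, N)) : 'M[R]_N :=
  \det (gramE A) *: S0 -
  \sum_k (\adj (gramE A) *m \col_l edge_form A S0 (E l)) k 0 *: D k.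

Let solveS_sym A : (solveS A)^T = solveS A.
Proof.
rewrite /solveS linearB linearZ linear_sum /= sS0; congr (_ - _).
by apply: eq_bigr => k _; rewrite linearZ /= sD.
Qed.

Let solveS_orth A l : edge_form A (solveS A) (E l) = 0.
Proof.
have formB S S' x : edge_form A (S - S') x = edge_form A S x - edge_form A S' x.
  by rewrite /edge_form mulmxBr mulmxBl !mxE.
have formZ b S x : edge_form A (b *: S) x = b * edge_form A S x.
  by rewrite /edge_form -scalemxAr -scalemxAl mxE.
have formsum (F : 'I_c -> 'M[R]_N) x :
    edge_form A (\sum_k F k) x = \sum_k edge_form A (F k) x.
  by rewrite /edge_form mulmx_sumr mulmx_suml summxE.
rewrite /solveS formB formZ formsum.
have -> : \sum_k edge_form A
    ((\adj (gramE A) *m \col_l0 edge_form A S0 (E l0)) k 0 *: D k) (E l) =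
    (gramE A *m (\adj (gramE A) *m \col_l0 edge_form A S0 (E l0))) l 0.
  by rewrite [RHS]mxE; apply: eq_bigr => k _; rewrite formZ mulrC; congr (_ * _); rewrite mxE.
by rewrite mulmxA mul_mx_adj mul_scalar_mx !mxE subrr.
Qed.

(** Suitably normalised, [adjA] and [solveS] satisfy the linear conditions for every [X], depend
    continuously on [X], and return [A0] and [S0] at [X0]. *)
Lemma perturbation : exists X0 : 'M[R]_(n, m), forall eps : R, 0 < eps ->
  \forall X \near X0, exists A S,
  [/\ A^T *m X = 0, S^T = S, forall i, i \in W -> row i A = 0,
      forall k, edge_form A S (E k) = 0 &
      (forall i j, `|A i j - A0 i j| < eps) /\
      (forall i j, `|S i j - S0 i j| < eps)].
Proof.
have [X0 [XA offX uX]] := annihilator_exists; exists X0 => eps eps0.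
pose delta := \det (X0^T *m off *m X0).
have delta0 : delta != 0.
  by rewrite /delta -mulmxA offX -unitfE -unitmxE.
pose A X := delta^-1 *: adjA X.
have AX0 : A X0 = A0.
  by rewrite /A /adjA XA mulmx0 subr0 scalerA mulVf// scale1r.
have SX0 : solveS A0 = S0.
  have -> : solveS A0 = \det (gramE A0) *: S0.
    rewrite /solveS big1 ?subr0// => k _.
    rewrite (_ : \col__ _ = 0) ?mulmx0 ?mxE ?scale0r//.
    by apply/colP => l; rewrite !mxE.
  (* At [A0] the duality of the [D k] makes the system matrix the identity, and the right-hand side
     is zero. *)
  rewrite (_ : gramE A0 = 1%:M) ?det1 ?scale1r//.
  by apply/matrixP => l k; rewrite !mxE dualE eq_sym.
pose P q (F : 'M[R]_(n, m) -> 'M[R]_q) := polymx setT entries F.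
have pX : polymx setT entries (id : 'M[R]_(n, m) -> 'M[R]_(n, m)).
  by move=> i j; apply: polyfun_gen; exists i, j.
have pc p q (B : 'M[R]_(p, q)) : polymx setT (@entries R n m) (fun=> B).
  exact: polymx_const.
have pQ : polymx setT entries (fun X : 'M[R]_(n, m) => X^T *m off *m X).
  apply: polymx_mul => //; apply: polymx_mul => //.
  exact: (polymx_tr pX).
have pA : polymx setT entries A.
  apply: polymx_scale => //; first exact: polyfun_cst.
  apply: polymx_add => //; first by apply: polymx_scale; [exact: polyfun_det|exact: polymx_const].
  apply: polymx_opp => //; apply: polymx_mul => //; last first.
    by apply: polymx_mul => //; exact: (polymx_tr pX).
  apply: polymx_mul => //; last exact: polymx_adj.
  by apply: polymx_mul => //; exact: pc.
have pform S x : polyfun setT entries (fun X => edge_form (A X) S x).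
  have : polymx setT entries (fun X => A X *m S *m (A X)^T).
    apply: polymx_mul => //; last exact: polymx_tr.
    by apply: polymx_mul => //; exact: pc.
  exact.
have pG : polymx setT entries (fun X => gramE (A X)).
  move=> l k; rewrite (_ : (fun _ => _) = fun X => edge_form (A X) (D k) (E l))//.
  by apply/funext => X; rewrite mxE.
have pS : polymx setT entries (fun X => solveS (A X)).
  apply: polymx_add => //; first by apply: polymx_scale; [exact: polyfun_det|exact: polymx_const].
  apply: polymx_opp => // i j.
  rewrite (_ : (fun _ => _) = (fun X => \sum_k (\adj (gramE (A X)) *m
      \col_l edge_form (A X) S0 (E l)) k 0 * D k i j)); last first.
    by apply/funext => X; rewrite summxE; apply: eq_bigr => k _; rewrite mxE.
  apply: polyfun_sum => // k _; apply: polyfunM; last exact: polyfun_cst.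
  apply: polymx_mul => //; first exact: polymx_adj.
  move=> l z; rewrite (_ : (fun _ => _) = fun X => edge_form (A X) S0 (E l))//.
  by apply/funext => X; rewrite mxE.
have near_of p q (F : 'M[R]_(n, m) -> 'M[R]_(p, q)) : polymx setT entries F ->
    \forall X \near X0, forall i j, `|F X i j - F X0 i j| < eps.
  have FF : Filter (nbhs X0) := nbhs_filter X0.
  move=> pF; apply: (filter_forall FF) => i; apply: (filter_forall FF) => j.
  have cF : continuous (fun X => F X i j).
    by apply: continuous_polyfun (pF i j); exact: continuous_entries.
  have /cvgrPdist_lt /(_ _ eps0) := cF X0.
  by apply: filterS => X; rewrite distrC.
near=> X; exists (A X), (solveS (A X)); split.
- rewrite -[LHS]trmxK trmx_mul trmxK (_ : X^T *m A X = 0) ?trmx0//.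
  rewrite /A /adjA -scalemxAr mulmxBr -scalemxAr !mulmxA mul_mx_adj -!mulmxA.
  by rewrite mul_scalar_mx subrr scaler0.
- exact: solveS_sym.
- move=> i iW; rewrite /A /adjA linearZ /= linearB linearZ /= A0W// scaler0 sub0r.
  rewrite -!mulmxA row_mul (_ : row i off = 0) ?mul0mx ?oppr0 ?scaler0//.
  by apply/rowP => j; rewrite !mxE iW andbF.
- exact: solveS_orth.
- split; first by rewrite -AX0; near: X; exact: near_of.
  by rewrite -SX0 -AX0; near: X; exact: (near_of _ _ (fun X => solveS (A X))).
Unshelve. all: by end_near.
Qed.

End Perturbation.

(** * Robust stresses from orthogonal representations *)

Section Robust.
Context {R : realType} {n : nat}.
Variable e : rel 'I_n.

Definition gram_stress m (X : 'M[R]_(n, m)) : Prop :=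
  exists k (B : 'M[R]_(n, k)), [/\ B != 0, B^T *m X = 0 &
    forall i j, i != j -> ~~ e i j -> (B *m B^T) i j = 0].

Definition robust m : Prop :=
  exists X0 : 'M[R]_(n, m), exists2 eps : R, 0 < eps &
    forall X : 'M[R]_(n, m), (forall i j, `|X i j - X0 i j| < eps) -> gram_stress X.

Lemma robust_near m (X0 : 'M[R]_(n, m)) :
  (\forall X \near X0, gram_stress X) -> robust m.
Proof.
move=> /nbhs_ballP[eps /= eps0 sub]; exists X0, eps => // X near_X.
by apply: sub; split => // i j; rewrite /ball /= distrC.
Qed.

(** The entries of [S - 1%:M] are so small that its form stays below the squared norm of [v]. *)
Lemma near_identity_posdef N (S : 'M[R]_N) : S^T = S ->
  (forall i j, `|S i j - (1%:M : 'M[R]_N) i j| < N.+1%:R^-1) -> posdef S.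
Proof.
move=> sS near_S; split => // v v0.
have v2 : 0 < quad 1%:M v by have [_ ->] := @posdef1 R N.
pose M := S - 1%:M.
have ME i j : `|M i j| <= N.+1%:R^-1 by rewrite !mxE; apply/ltW; have := near_S i j; rewrite mxE.
have SE : quad S v = quad M v + quad 1%:M v by rewrite -quadD /M subrK.
rewrite -/(quad _ _) SE -ltrBlDr sub0r.
suff : `|quad M v| < quad 1%:M v by rewrite ltr_norml => /andP[].
have qE : quad M v = \sum_i \sum_j v i 0 * M i j * v j 0.
  rewrite /quad mxE exchange_big /=; apply: eq_bigr => j _.
  by rewrite mxE big_distrl /=; apply: eq_bigr => i _; rewrite mxE.
rewrite qE.
apply: (@le_lt_trans _ _ (N.+1%:R^-1 * (N%:R * quad 1%:M v))); last first.
  by rewrite mulrA gtr_pMl// mulrC ltr_pdivrMr ?ltr0n// mul1r ltr_nat.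
(* This sum dominates the products of coordinates termwise, by the inequality of arithmetic and
   geometric means. *)
have -> : N%:R * quad 1%:M v =
    \sum_(i < N) \sum_(j < N) (v i 0 ^+ 2 + v j 0 ^+ 2) / 2.
  rewrite (eq_bigr (fun i => N%:R * (v i 0 ^+ 2 / 2) + quad 1%:M v / 2)); last first.
    move=> i _; rewrite quad1 -mulr_suml big_split /= sumr_const card_ord.
    by rewrite mulrDl -[_ *+ N]mulr_natl mulrA.
  rewrite big_split /= sumr_const card_ord -mulr_sumr -mulr_suml -quad1 -mulr_natl.
  by field.
rewrite mulr_sumr; apply: le_trans (ler_norm_sum _ _ _) _; apply: ler_sum => i _.
rewrite mulr_sumr; apply: le_trans (ler_norm_sum _ _ _) _; apply: ler_sum => j _.
rewrite !normrM mulrAC mulrC; apply: ler_pM; [by []|exact: mulr_ge0|exact: ME|].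
rewrite -[v i 0 ^+ 2]real_normK ?num_real// -[v j 0 ^+ 2]real_normK ?num_real//.
by have := sqr_ge0 (`|v i 0| - `|v j 0|); nra.
Qed.

Definition avoids (W : seq 'I_n) (x : 'I_n * 'I_n) :=
  (x.1 \notin W) && (x.2 \notin W).

(* [A0] is an orthogonal representation (with respect to the form [S0]) of the
   edges [es] avoiding [W], and the forms [D x] show that the linear conditions
   these edges impose on a form are independent. *)
Record transversal N (es : seq ('I_n * 'I_n)) (W : seq 'I_n)
    (A0 : 'M[R]_(n, N)) (S0 : 'M[R]_N) (D : 'I_n * 'I_n -> 'M[R]_N) : Prop :=
  Transversal {
    trans_rows : forall i, (row i A0 == 0) = (i \in W);
    trans_sym : forall x, (D x)^T = D x;
    trans_orth : forall x, x \in es -> avoids W x -> edge_form A0 S0 x = 0;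
    trans_dual : forall x y, x \in es -> y \in es -> avoids W x -> avoids W y ->
      edge_form A0 (D x) y = (x == y)%:R }.

Definition covers_nonedges (es : seq ('I_n * 'I_n)) : Prop :=
  forall i j, i != j -> ~~ e i j -> (i, j) \in es \/ (j, i) \in es.

Lemma edge_form_swap N (A : 'M[R]_(n, N)) S i j : S^T = S ->
  edge_form A S (i, j) = edge_form A S (j, i).
Proof.
move=> sS; rewrite /edge_form /=.
by rewrite -[in RHS](trmxK (A *m S *m A^T)) [RHS]mxE !trmx_mul trmxK sS mulmxA.
Qed.

(** Non-edges avoiding [W] are handled by [perturbation]; at the others the form vanishes because
    the rows of [A] in [W] are zero. *)
Lemma transversal_near N es W A0 S0 D m : @transversal N es W A0 S0 D ->
  S0^T = S0 -> (size W + N + m <= n)%N -> covers_nonedges es ->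
  exists X0 : 'M[R]_(n, m), forall eps : R, 0 < eps ->
  \forall X \near X0, exists A S, [/\ A^T *m X = 0, S^T = S,
    forall i j, i != j -> ~~ e i j -> edge_form A S (i, j) = 0,
    forall i j, `|A i j - A0 i j| < eps & forall i j, `|S i j - S0 i j| < eps].
Proof.
move=> [rowsA sD orthA dualA] sS0 dim cov.
pose F := [set x in es | avoids W x]%SET.
have inF (k : 'I_#|F|) : enum_val k \in es /\ avoids W (enum_val k).
  by have := enum_valP k; rewrite inE => /andP[].
have [X0 pert] := @perturbation R n N #|F| m W A0 S0 enum_val (fun k => D (enum_val k))
  sS0 (fun k => sD _) (fun i iW => eqP (etrans (rowsA i) iW))
  (fun k => orthA _ (inF k).1 (inF k).2)
  (fun k l => etrans (dualA _ _ (inF k).1 (inF l).1 (inF k).2 (inF l).2)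
    (congr1 (fun b : bool => b%:R) (inj_eq enum_val_inj k l))) dim.
exists X0 => eps eps0; apply: filterS (pert eps eps0) => X [A [S [AX sS AW AE [nA nS]]]].
exists A, S; split => // i j ij eij.
have [x [xes xE]] : exists x, x \in es /\ (x = (i, j) \/ x = (j, i)).
  by have [?|?] := cov i j ij eij; [exists (i, j)|exists (j, i)]; split; auto.
suff : edge_form A S x = 0.
  by case: xE => ->//; rewrite edge_form_swap.
have [xW|] := boolP (avoids W x).
  have xF : x \in F by rewrite inE xes.
  by have := AE (enum_rank_in xF x); rewrite enum_rankK_in.
rewrite negb_and !negbK /edge_form => /orP[/AW Ax|/AW Ax].
  rewrite mxE big1// => k _; rewrite mxE big1 ?mul0r// => l _.
  by have := congr1 (fun v : 'rV[R]_N => v 0 l) Ax; rewrite !mxE => ->; rewrite mul0r.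
rewrite mxE big1// => k _.
by have := congr1 (fun v : 'rV[R]_N => v 0 k) Ax; rewrite !mxE => ->; rewrite mulr0.
Qed.

(** [T] counts one dimension for each deleted vertex plus the dimension of the representation, so
    the sample sizes up to [n - T] come within reach. *)
Definition config es T : Prop := exists N W A0 D,
  (size W + N)%N = T /\ @transversal N es W A0 1%:M D.

(** Near [X0] the form [S] stays positive definite; writing it as [C *m C^T] gives the stress with
    factor [A *m C]. *)
Lemma robust_of_config es T m : config es T -> covers_nonedges es ->
  (T + m <= n)%N -> (0 < m)%N -> robust m.
Proof.
move=> [N [W [A0 [D [<- tr]]]]] cov dim m0.
(* A vertex outside [W] has a nonzero row in [A0]; the choice of [eps0] keeps an entry of it
   nonzero, so the stress does not vanish. *)
have [i iW] : exists i, i \notin W.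
  apply: contrapT => nex.
  have : (#|'I_n| <= size W)%N.
    apply: leq_trans (card_size W); apply: subset_leq_card; apply/fintype.subsetP => i _.
    by apply: contrapT => /negP iW; apply: nex; exists i.
  by rewrite card_ord; lia.
have [j Aij] : exists j, A0 i j != 0.
  apply: contrapT => nex; case/negP: iW; rewrite -(trans_rows tr); apply/eqP/rowP => j.
  by rewrite !mxE; apply: contrapT => /eqP Aij; apply: nex; exists j.
have [X0 near0] := transversal_near tr (trmx1 _ _) dim cov.
apply: (@robust_near _ X0).
have eps0 : 0 < Num.min `|A0 i j| (N.+1%:R^-1).
  by rewrite lt_min normr_gt0 Aij invr_gt0 ltr0n.
apply: filterS (near0 _ eps0) => X [A [S [AX sS eS nA nS]]].
have pS : posdef S.
  by apply: near_identity_posdef => // k l; have := nS k l; rewrite lt_min => /andP[].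
have [C uC SE] := posdef_cholesky pS.
exists N, (A *m C); split.
- apply/eqP => AC0; have A0' : A = 0 by rewrite -[A](mulmxK uC) AC0 mul0mx.
  have := nA i j; rewrite A0' mxE sub0r normrN lt_min ltxx.
  by [].
- by rewrite trmx_mul -mulmxA AX mulmx0.
- move=> k l kl ekl; have := eS k l kl ekl.
  by rewrite /edge_form SE trmx_mul !mulmxA.
Qed.

(** Deleting [v] means setting its row to zero and adding it to [W], which costs one dimension. *)
Lemma config_remove es T v :
  config [seq x <- es | (x.1 != v) && (x.2 != v)] T -> config es T.+1.
Proof.
move=> [N [W [A0 [D [<- [rowsA sD orthA dualA]]]]]].
pose A1 : 'M[R]_(n, N) := \matrix_(i, j) if i == v then 0 else A0 i j.
have formE S x : avoids (v :: W) x -> edge_form A1 S x = edge_form A0 S x.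
  rewrite /avoids !inE !negb_or => /andP[/andP[xv1 _] /andP[xv2 _]].
  rewrite !edge_formE; apply: eq_bigr => k _; apply: eq_bigr => l _.
  by rewrite !mxE (negbTE xv1) (negbTE xv2).
have inF x : x \in es -> avoids (v :: W) x ->
    x \in [seq x <- es | (x.1 != v) && (x.2 != v)] /\ avoids W x.
  rewrite /avoids !inE !negb_or mem_filter => -> /andP[/andP[-> ->] /andP[-> ->]].
  by [].
exists N, (v :: W), A1, D; split => //; split => //.
- move=> i; rewrite inE; have [->|iv] := eqVneq i v.
    by apply/eqP/rowP => j; rewrite !mxE eqxx.
  rewrite /= -rowsA; congr (_ == _); apply/rowP => j.
  by rewrite !mxE (negbTE iv).
- by move=> x xes xW; rewrite formE//; have [] := inF x xes xW; exact: orthA.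
- move=> x y xes yes xW yW; rewrite formE//.
  by have [? ?] := inF x xes xW; have [? ?] := inF y yes yW; exact: dualA.
Qed.

(** Without conditions every vertex may be represented by the number 1. *)
Lemma config_nil : config [::] 1.
Proof.
exists 1%N, [::], (const_mx 1), (fun=> 0); split => //; split => //.
  move=> i; rewrite in_nil; apply/eqP => /matrixP /(_ 0 0).
  by rewrite !mxE => /eqP; rewrite oner_eq0.
by move=> x; rewrite trmx0.
Qed.

End Robust.

(** * Degenerate forms for complements containing a 4-cycle *)

Section FourCycle.
Context {R : realType}.

(** As the determinant vanishes, so does the Schur complement of the positive definite 2 by 2 block;
    the factor of that block then extends by one row. *)
Lemma psd_rank2_factor (S : 'M[R]_(2 + 1)) : S^T = S -> \det S = 0 ->
  posdef (ulsubmx S) ->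
  exists C : 'M[R]_(2 + 1, 2), (2 <= \rank C)%N /\ S = C *m C^T.
Proof.
move=> sS dS pS; have [C uC SE] := posdef_cholesky pS.
pose b : 'cV[R]_2 := ursubmx S; pose d : 'M[R]_1 := drsubmx S.
have SB : S = block_mx (ulsubmx S) b b^T d.
  by rewrite -[LHS]submxK; congr block_mx; rewrite /b trmx_ursub sS.
pose y := invmx C *m b.
have Cy : C *m y = b by rewrite mulKVmx.
exists (col_mx C y^T); split.
  rewrite -[X in (X <= _)%N](mxrank1 R).
  rewrite (_ : 1%:M = row_mx (invmx C) 0 *m col_mx C y^T) ?mxrankM_maxr//.
  by rewrite mul_row_col mulVmx// mul0mx addr0.
have LE : block_mx C 0 y^T 1%:M *m block_mx C^T y 0 (d - y^T *m y) = S.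
  rewrite mulmx_block [RHS]SB !(mul0mx, mulmx0, mul1mx, addr0) -SE Cy.
  congr block_mx; first by rewrite -trmx_mul Cy.
  by rewrite addrC subrK.
have : \det (d - y^T *m y) = 0.
  move: dS; rewrite -LE det_mulmx det_lblock det_ublock det1 det_tr mulr1.
  have dC : \det C != 0 by rewrite -unitfE -unitmxE.
  by move=> /eqP; rewrite !mulf_eq0 (negbTE dC) /= => /eqP.
rewrite det_mx11 mxE => dy.
rewrite tr_col_mx mul_col_row trmxK -SE Cy [LHS]SB; congr block_mx.
  by rewrite -trmx_mul Cy.
apply/matrixP => i j; rewrite !ord1; apply/eqP.
by rewrite -subr_eq0; move: dy; rewrite [X in _ + X]mxE => ->.
Qed.

Lemma formE p q N (B : 'M[R]_(p, N)) (S : 'M[R]_N) (C : 'M[R]_(q, N)) i j :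
  (B *m S *m C^T) i j = \sum_k \sum_l B i k * S k l * C j l.
Proof.
rewrite mxE exchange_big /=; apply: eq_bigr => l _.
by rewrite !mxE big_distrl.
Qed.

Lemma det2 (A : 'M[R]_2) : \det A = A 0 0 * A 1 1 - A 0 1 * A 1 0.
Proof.
rewrite (expand_det_row _ 0) !big_ord_recl big_ord0 addr0 /cofactor !det_mx11.
rewrite !mxE /= expr0 expr1 mul1r mulN1r mulrN.
by congr (_ * A _ _ - A _ _ * A _ _); exact/val_inj.
Qed.

Lemma rank_two (A : 'M[R]_(2, 3)) (k l : 'I_3) :
  A 0 k * A 1 l - A 0 l * A 1 k != 0 -> (2 <= \rank A)%N.
Proof.
move=> minor; pose h (i : 'I_2) := if i == 0 then k else l.
have uA : colsub h A \in unitmx.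
  by rewrite unitmxE unitfE det2 !mxE /h /=.
rewrite -[X in (X <= _)%N](mxrank_unit uA).
by rewrite -[A in colsub h A]mulmx1 -mulmx_colsub mxrankM_maxl.
Qed.

(* A form vanishing on a pair of planes of 3-space is degenerate: the two
   planes meet. *)
Lemma det_bipartite_form (P Q : 'M[R]_(2, 3)) (S : 'M[R]_3) :
  (2 <= \rank P)%N -> (2 <= \rank Q)%N -> P *m S *m Q^T = 0 -> \det S = 0.
Proof.
move=> rP rQ /mulmx0_rank_max; rewrite mxrank_tr => le3.
apply/eqP; apply: contraLR le3 => dS; rewrite -ltnNge.
have uS : S \in unitmx by rewrite unitmxE unitfE.
rewrite mxrankMfree ?row_free_unit//.
exact: leq_add rP rQ.
Qed.

Variables (n : nat) (e : rel 'I_n).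

(** Near the base form diag(1, 1, 0) positivity is not automatic. The four conditions of the cycle
    say that the planes spanned by the rows [p], [q] and [r], [s] are orthogonal for [S], so [S]
    stays singular, hence positive semidefinite of rank 2. *)
Lemma robust_of_four_cycle es (A0 : 'M[R]_(n, 2 + 1)) D m (p q r s : 'I_n) :
  transversal es [::] A0 (\matrix_(i, j) ((i == j) && (i < 2)%N)%:R) D ->
  covers_nonedges e es ->
  (forall j, A0 p j = (val j == 0)%:R) -> (forall j, A0 q j = (val j != 1)%:R) ->
  (forall j, A0 r j = (val j == 1)%:R) -> (forall j, A0 s j = (val j != 0)%:R) ->
  [&& p != r, p != s, q != r & q != s] ->
  [&& ~~ e p r, ~~ e p s, ~~ e q r & ~~ e q s] ->
  (3 + m <= n)%N -> robust (R := R) e m.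
Proof.
move=> tr cov Ap Aq Ar As /and4P[pr ps qr qs] /and4P[epr eps' eqr eqs] dim.
have [|X0 near0] := transversal_near tr _ dim cov.
  apply/matrixP => i j; rewrite !mxE [j == i]eq_sym.
  by case: eqP => // ->.
apply: (@robust_near _ _ _ _ X0).
(* Small enough to keep the minors of [P] and [Q] positive, and below the 1/3 that
   [near_identity_posdef] asks of a 2 by 2 block. *)
pose eps : R := 10^-1.
have eps0 : 0 < eps by rewrite invr_gt0.
apply: filterS (near0 _ eps0) => X [A [S [AX sS eS nA nS]]].
pose k0 : 'I_3 := @Ordinal 3 0 isT; pose k1 : 'I_3 := @Ordinal 3 1 isT.
pose k2 : 'I_3 := @Ordinal 3 2 isT.
have bnd (a b : R) : `|a - b| < eps -> b - 10^-1 < a < b + 10^-1.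
  by rewrite ltr_distl.
pose P := rowsub (fun i : 'I_2 => if i == 0 then p else q) A.
pose Q := rowsub (fun i : 'I_2 => if i == 0 then r else s) A.
have rP : (2 <= \rank P)%N.
  apply: (@rank_two _ k0 k2); rewrite !mxE /=.
  have := bnd _ _ (nA p k0); have := bnd _ _ (nA p k2).
  have := bnd _ _ (nA q k0); have := bnd _ _ (nA q k2).
  rewrite !Ap !Aq /= => /andP[? ?] /andP[? ?] /andP[? ?] /andP[? ?].
  by apply: lt0r_neq0; nra.
have rQ : (2 <= \rank Q)%N.
  apply: (@rank_two _ k1 k2); rewrite !mxE /=.
  have := bnd _ _ (nA r k1); have := bnd _ _ (nA r k2).
  have := bnd _ _ (nA s k1); have := bnd _ _ (nA s k2).
  rewrite !Ar !As /= => /andP[? ?] /andP[? ?] /andP[? ?] /andP[? ?].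
  by apply: lt0r_neq0; nra.
have dS : \det S = 0.
  apply: (@det_bipartite_form P Q) => //; apply/matrixP => i j; rewrite formE mxE.
  transitivity (edge_form A S (if i == 0 then p else q, if j == 0 then r else s)).
    rewrite edge_formE /=; apply: eq_bigr => k _; apply: eq_bigr => l _.
    by rewrite !mxE.
  by case: ifP => _; case: ifP => _; apply: eS.
have pS : posdef (ulsubmx S).
  apply: near_identity_posdef => [|i j]; first by rewrite trmx_ulsub sS.
  have := nS (lshift 1 i) (lshift 1 j); rewrite !mxE /= ltn_ord andbT.
  rewrite (inj_eq (@lshift_inj _ _)) => /lt_le_trans; apply.
  by rewrite lef_pV2 ?posrE// ler_nat.
have [C [rC SE]] := psd_rank2_factor sS dS pS.
exists 2%N, (A *m C); split.
- apply/eqP => /mulmx0_rank_max; rewrite leqNgt => /negP; apply.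
  (* Two matrices of rank at least 2 composed through 3-space cannot have product zero. *)
  rewrite -[X in (X < _)%N]/(1 + 2)%N.
  have rA : (2 <= \rank A)%N.
    by apply: leq_trans rP _; rewrite /P rowsubE mxrankM_maxr.
  by move: rA rC; lia.
- by rewrite trmx_mul -mulmxA AX mulmx0.
- move=> i j ij eij; have := eS i j ij eij.
  by rewrite /edge_form SE trmx_mul !mulmxA.
Qed.

End FourCycle.

(** * Orthogonal representations of small complements *)

Section Targets.

Definition sumz (N : nat) (F : nat -> int) : int :=
  foldr (fun k s => F k + s) 0 (iota 0 N).

Definition zform (N : nat) (v : seq int) (S : nat -> nat -> int) (w : seq int) : int :=
  sumz N (fun k => sumz N (fun l => v`_k * S k l * w`_l)).

(** A finite certificate for a transversal: integer vectors, the edges between them, a base form and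
    dual forms. Lists and integer functions let [vm_compute] check it. *)
Record target := Target {
  target_dim : nat;
  target_vecs : seq (seq int);
  target_edges : seq (nat * nat);
  target_base : nat -> nat -> int;
  target_duals : seq (nat -> nat -> int) }.

Definition target_vec t i := nth [::] (target_vecs t) i.
Definition target_dual t k := nth (fun _ _ => 0) (target_duals t) k.
Definition target_edge t k := nth (0%N, 0%N) (target_edges t) k.

Definition target_ok (t : target) : bool :=
  let N := target_dim t in let c := size (target_edges t) in
  [&& size (target_duals t) == c,
      all (fun v : seq int => has (fun k => v`_k != 0) (iota 0 N)) (target_vecs t),
      all (fun l => zform N (target_vec t (target_edge t l).1) (target_base t)
        (target_vec t (target_edge t l).2) == 0) (iota 0 c),
      all (fun k => all (fun l => zform N (target_vec t (target_edge t l).1)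
        (target_dual t k) (target_vec t (target_edge t l).2) == (k == l)%:Z)
        (iota 0 c)) (iota 0 c) &
      all (fun k => all (fun i => all (fun j =>
        (target_dual t k i j == target_dual t k j i) &&
        (target_base t i j == target_base t j i))
        (iota 0 N)) (iota 0 N)) (iota 0 c)].

(** Edges are compared without orientation; a pair that is no edge gets the out-of-range index
    [size te]. *)
Definition edge_index (te : seq (nat * nat)) (x : nat * nat) : nat :=
  find (fun y => (y == x) || (y == (x.2, x.1))) te.

Context {R : realType} {n : nat}.

Definition mx_of_int N (S : nat -> nat -> int) : 'M[R]_N :=
  \matrix_(i, j) (S i j)%:~R.

Definition target_mx t (f : 'I_n -> nat) : 'M[R]_(n, target_dim t) :=
  \matrix_(i, k) ((target_vec t (f i))`_k)%:~R.

Lemma sumzE N (F : nat -> int) : (sumz N F)%:~R = \sum_(k < N) (F k)%:~R :> R.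
Proof.
rewrite -(big_mkord xpredT (fun k => (F k)%:~R)) /index_iota subn0 /sumz.
elim: (iota 0 N) => [|k r IH]; first by rewrite big_nil.
by rewrite big_cons -IH /= rmorphD.
Qed.

Lemma edge_form_target t f S x :
  edge_form (target_mx t f) (mx_of_int (target_dim t) S) x =
  (zform (target_dim t) (target_vec t (f x.1)) S (target_vec t (f x.2)))%:~R.
Proof.
rewrite edge_formE /zform sumzE; apply: eq_bigr => k _.
by rewrite sumzE; apply: eq_bigr => l _; rewrite !mxE !rmorphM.
Qed.

Lemma mx_of_int_sym N S :
  all (fun i => all (fun j => S i j == S j i) (iota 0 N)) (iota 0 N) ->
  (mx_of_int N S)^T = mx_of_int N S.
Proof.
move=> /allP sS; apply/matrixP => i j; rewrite !mxE; congr _%:~R.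
have iN (k : 'I_N) : val k \in iota 0 N by rewrite mem_iota /=.
by have /allP /(_ _ (iN j)) /eqP := sS _ (iN i).
Qed.

(** A vertex map that is injective on edges pulls the vectors and forms back. Vertices may be
    identified: duality only involves pairs of edges. *)
Lemma transversal_of_target t (f : 'I_n -> nat) es :
  let te := target_edges t in
  let h := fun x => edge_index te (f x.1, f x.2) in
  target_ok t -> (forall i, f i < size (target_vecs t))%N ->
  {in es, forall x, h x < size te}%N -> {in es &, injective h} ->
  transversal es [::] (target_mx t f) (mx_of_int (target_dim t) (target_base t))
    (fun x => mx_of_int (target_dim t) (target_dual t (h x))).
Proof.
move=> te h /and5P[/eqP sz /allP nz /allP orth /allP dual /allP sym] fs hs h_inj.
have symS S : (mx_of_int (target_dim t) S)^T = mx_of_int (target_dim t) S ->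
    forall x, x \in es ->
    edge_form (target_mx t f) (mx_of_int (target_dim t) S) x =
    (zform (target_dim t) (target_vec t (target_edge t (h x)).1) S
      (target_vec t (target_edge t (h x)).2))%:~R.
  move=> sS x xes; have hx := hs x xes.
  have /(nth_find (0, 0)%N) : has
      (fun y => (y == (f x.1, f x.2)) || (y == (f x.2, f x.1))) te.
    by rewrite has_find; exact: hx.
  rewrite -/(edge_index te (f x.1, f x.2)) -/(h x) -/(target_edge t (h x)).
  move=> /orP[] /eqP ->; first by rewrite edge_form_target.
  by rewrite [x]surjective_pairing edge_form_swap// edge_form_target.
have hN x : x \in es -> h x \in iota 0 (size te).
  by move=> xes; rewrite mem_iota /=; exact: hs.
have sym_of k : k \in iota 0 (size te) ->
    (mx_of_int (target_dim t) (target_dual t k))^T =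
      mx_of_int (target_dim t) (target_dual t k) /\
    (mx_of_int (target_dim t) (target_base t))^T =
      mx_of_int (target_dim t) (target_base t).
  move=> /sym /allP sk; split; apply: mx_of_int_sym; apply/allP => i /sk /allP ik;
    by apply/allP => j /ik /andP[].
split.
- move=> i; rewrite in_nil; apply/negP => /eqP ri0.
  have /nz /hasP[k kN] := mem_nth [::] (fs i).
  move: kN; rewrite mem_iota /= add0n => kN; apply/negP; rewrite negbK.
  have := congr1 (fun v : 'rV[R]_(target_dim t) => v 0 (Ordinal kN)) ri0.
  by rewrite !mxE /= => /eqP; rewrite intr_eq0.
- move=> x; have [hx|hx] := ltnP (h x) (size te).
    by have [] := sym_of (h x); rewrite ?mem_iota.
  (* Out of range, the default dual is the zero form, which is symmetric. *)
  rewrite /target_dual nth_default ?sz//.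
  by apply/matrixP => i j; rewrite !mxE.
- move=> x xes _; have [_ sb] := sym_of _ (hN x xes).
  by rewrite symS//; have /eqP -> := orth _ (hN x xes).
- move=> x y xes yes _ _; have [sk _] := sym_of _ (hN x xes).
  rewrite symS//; have /allP /(_ _ (hN y yes)) /eqP -> := dual _ (hN x xes).
  have [->|xy] := eqVneq x y; first by rewrite eqxx.
  by case: eqP => // /(h_inj _ _ xes yes) E; rewrite E eqxx in xy.
Qed.

End Targets.

(** * Enumeration of graphs of maximum degree two *)

Definition incident (T : eqType) (v : T) (x : T * T) := (x.1 == v) || (x.2 == v).

Definition subcubic_simple (T : eqType) (es : seq (T * T)) : Prop :=
  [/\ uniq es, forall x, x \in es -> x.1 != x.2,
      forall x, x \in es -> (x.2, x.1) \notin es &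
      forall v, (count (incident v) es <= 2)%N].

Section Explore.
Local Open Scope nat_scope.
Variable P : seq (nat * nat) -> bool.

Definition edge_ok (x : nat * nat) (pe : seq (nat * nat)) : bool :=
  [&& x.1 < x.2, x \notin pe, count (incident x.1) pe < 2 &
      count (incident x.2) pe < 2].

(* The conditionals keep [vm_compute] from evaluating pruned branches. *)
Fixpoint explore (k nv : nat) (pe : seq (nat * nat)) : bool :=
  P pe && (if k is k'.+1 then
    all (fun a => let nv1 := maxn nv a.+1 in
      all (fun b => if edge_ok (a, b) pe then
          explore k' (maxn nv1 b.+1) ((a, b) :: pe) else true)
        (iota 0 nv1.+1)) (iota 0 nv.+1) else true).

Lemma exploreS k nv pe : explore k.+1 nv pe = P pe &&
  all (fun a => all (fun b => if edge_ok (a, b) pe then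
      explore k (maxn (maxn nv a.+1) b.+1) ((a, b) :: pe) else true)
    (iota 0 (maxn nv a.+1).+1)) (iota 0 nv.+1).
Proof. by []. Qed.

Definition pattern_edge (T : eqType) (vs : seq T) (x : T * T) :=
  (minn (index x.1 vs) (index x.2 vs), maxn (index x.1 vs) (index x.2 vs)).

Definition pattern (T : eqType) (vs : seq T) (es : seq (T * T)) :=
  [seq pattern_edge vs x | x <- es].

(** New vertices go to the end, so that the numbers already given persist. *)
Definition add_vertex (T : eqType) (vs : seq T) v :=
  if v \in vs then vs else rcons vs v.

Lemma index_add_vertex (T : eqType) (vs : seq T) v y :
  (y \in vs) || (y == v) -> index y (add_vertex vs v) = index y vs.
Proof.
rewrite /add_vertex; case: ifP => // vvs; rewrite -cats1 index_cat.
case: ifP => // yvs /= /eqP ->; rewrite eqxx addn0.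
by rewrite memNindex// vvs.
Qed.

Lemma size_add_vertex (T : eqType) (vs : seq T) v :
  size (add_vertex vs v) = maxn (size vs) (index v vs).+1.
Proof.
rewrite /add_vertex; case: ifP => vvs.
  by apply/esym/maxn_idPl; rewrite index_mem.
by rewrite size_rcons memNindex ?vvs//; apply/esym/maxn_idPr.
Qed.

Lemma mem_add_vertex (T : eqType) (vs : seq T) v y :
  (y \in add_vertex vs v) = (y \in vs) || (y == v).
Proof.
rewrite /add_vertex; case: ifP => [vvs|_].
  by case: eqP => [->|]; rewrite ?vvs ?orbF.
by rewrite mem_rcons inE orbC.
Qed.

(** Vertices are numbered in order of first appearance, so each end of a new edge is an old vertex
    or has the next free number. Hence the exhaustive search meets every graph, relabelled along
    [vs]. *)
Lemma explore_sound (T : eqType) (todo done : seq (T * T)) vs k :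
  subcubic_simple (catrev todo done) ->
  {in done, forall x, (x.1 \in vs) && (x.2 \in vs)} ->
  size todo <= k -> explore k (size vs) (pattern vs done) ->
  exists vs', {in catrev todo done, forall x, (x.1 \in vs') && (x.2 \in vs')} /\
    P (pattern vs' (catrev todo done)).
Proof.
elim: todo done vs k => [|x todo IH] done vs k simple dvs sk.
  by case: k {sk} => [|k] /= /andP[Pd _]; exists vs.
case: k sk => // k sk; rewrite exploreS => /andP[_ /allP ex].
pose vs1 := add_vertex vs x.1; pose vs2 := add_vertex vs1 x.2.
have sub1 y : y \in vs -> y \in vs1 by rewrite mem_add_vertex => ->.
have sub2 y : y \in vs1 -> y \in vs2 by move=> y1; rewrite mem_add_vertex y1.
have x1 : x.1 \in vs1 by rewrite mem_add_vertex eqxx orbT.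
have x2 : x.2 \in vs2 by rewrite mem_add_vertex eqxx orbT.
have i1 y : y \in vs -> index y vs1 = index y vs.
  by move=> yvs; rewrite index_add_vertex ?yvs.
have i2 y : y \in vs1 -> index y vs2 = index y vs1.
  by move=> yvs; rewrite index_add_vertex ?yvs.
have pdone : pattern vs2 done = pattern vs done.
  apply/eq_in_map => y /dvs /andP[y1 y2].
  by rewrite /pattern_edge !i2 ?i1// sub1.
have inj y z : y \in vs2 -> z \in vs2 -> (index y vs2 == index z vs2) = (y == z).
  by move=> y2 z2; apply/eqP/eqP => [/(congr1 (nth y vs2))|->//]; rewrite !nth_index.
have incE v y : v \in vs2 -> y.1 \in vs2 -> y.2 \in vs2 ->
    incident (index v vs2) (pattern_edge vs2 y) = incident v y.
  move=> v2 y1 y2; rewrite /incident /pattern_edge -!inj//=.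
  by case: leqP => // _; rewrite orbC.
have d2 y : y \in done -> y.1 \in vs2 /\ y.2 \in vs2.
  by move=> /dvs /andP[y1 y2]; rewrite !sub2// sub1.
have x12 := sub2 _ x1.
pose p := pattern_edge vs2 x.
have p_end (Q : nat -> Prop) : Q (index x.1 vs2) -> Q (index x.2 vs2) -> Q p.1 /\ Q p.2.
  by rewrite /p /pattern_edge /=; case: leqP.
(* Simplicity and the degree bound of the whole graph show that the search does not prune this
   edge. *)
have ok : edge_ok p (pattern vs2 done).
  have [L1 L2 L3 L4] := simple.
  have xL : x \in catrev (x :: todo) done by rewrite catrevE mem_cat mem_rev mem_head.
  have cnt v : v \in vs2 -> incident v x ->
      count (incident (index v vs2)) (pattern vs2 done) < 2.
    move=> v2 vx; rewrite /pattern count_map.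
    have -> : count (preim (pattern_edge vs2) (incident (index v vs2))) done =
        count (incident v) done.
      by apply: eq_in_count => y /d2[y1 y2] /=; rewrite incE.
    have := L4 v; rewrite catrevE count_cat count_rev /= vx add1n addSn => H.
    by apply: leq_trans H; rewrite ltnS leq_addl.
  have xd : x \notin done.
    have := L1; rewrite catrevE cat_uniq => /and3P[_ /hasPn H _].
    by apply/negP => /H; rewrite mem_rev mem_head.
  have xd' : (x.2, x.1) \notin done.
    by apply: contra (L3 x xL); rewrite catrevE mem_cat orbC => ->.
  have [c1 c2] := p_end (fun i => count (incident i) (pattern vs2 done) < 2)
    (cnt x.1 x12 (introT orP (or_introl (eqxx _))))
    (cnt x.2 x2 (introT orP (or_intror (eqxx _)))).
  rewrite /edge_ok c1 c2 !andbT; apply/andP; split.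
    have := L2 x xL; rewrite -inj// /p /pattern_edge /=.
    by lia.
  apply/mapP => -[y yd]; have [y1 y2] := d2 y yd.
  have xE : (x == y) || ((x.2, x.1) == y) -> False.
    by case/orP => /eqP E; [move: xd|move: xd']; rewrite E yd.
  rewrite /p /pattern_edge => -[e1 e2]; apply: xE.
  case: (x) (y) x12 x2 y1 y2 e1 e2 => [a b] [c d] /= a2 b2 c2' d2'.
  rewrite !xpair_eqE -!inj//.
  by case: leqP => _; case: leqP => _ -> ->; rewrite !eqxx ?orbT.
have e1 : index x.1 vs2 = index x.1 vs.
  by rewrite i2// index_add_vertex ?eqxx ?orbT.
have e2 : index x.2 vs2 = index x.2 vs1 by rewrite index_add_vertex ?eqxx ?orbT.
have s1 : size vs1 = maxn (size vs) (index x.1 vs2).+1.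
  by rewrite size_add_vertex e1.
have s2 : size vs2 = maxn (size vs1) (index x.2 vs2).+1.
  by rewrite size_add_vertex e2.
have le1 : index x.1 vs2 <= size vs by rewrite e1 index_size.
have le2 : index x.2 vs2 <= size vs1 by rewrite e2 index_size.
have old1 : index x.1 vs2 < size vs -> size vs1 = size vs by rewrite s1; lia.
apply: (IH (x :: done) vs2 k) => //.
  move=> y; rewrite inE => /orP[/eqP ->|/d2[-> ->]//].
  by rewrite x2 sub2.
(* The two numbers lie in the ranges over which [explore] loops. *)
have p1 : p.1 <= size vs by rewrite /p /pattern_edge /=; lia.
have p2 : p.2 <= maxn (size vs) p.1.+1 by rewrite /p /pattern_edge /=; lia.
have sp : maxn (maxn (size vs) p.1.+1) p.2.+1 = size vs2.
  by rewrite s2 s1 /p /pattern_edge /=; lia.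
have := ex p.1; rewrite mem_iota ltnS p1 => /(_ isT) /allP /(_ p.2).
rewrite mem_iota ltnS p2 => /(_ isT).
by rewrite -surjective_pairing -pdone ok sp.
Qed.

End Explore.

(** * Search for homomorphisms into the targets *)

Section Search.
Local Open Scope nat_scope.

(** An unmapped vertex is sent to 0 by default, which is why [hom_ok] requires the target to have a
    vertex. *)
Definition lookup (g : seq (nat * nat)) (v : nat) : nat :=
  (nth (0, 0) g (find (fun p => p.1 == v) g)).2.

Definition compatible (g : seq (nat * nat)) (v a : nat) : bool :=
  all (fun p => (p.1 != v) || (p.2 == a)) g.

(** Backtracking that uses every target edge at most once, in either orientation. Its output is
    certified afterwards by [hom_ok]. *)
Fixpoint hom_search (pe te : seq (nat * nat)) (g : seq (nat * nat)) {struct pe} :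
    option (seq (nat * nat)) :=
  if pe is x :: pe' then
    let try y a b :=
      if compatible g x.1 a && compatible g x.2 b
      then hom_search pe' (rem y te) ((x.1, a) :: (x.2, b) :: g) else None in
    (fix go (l : seq (nat * nat)) := if l is y :: l' then
      if try y y.1 y.2 is Some r then Some r
      else if try y y.2 y.1 is Some r then Some r else go l'
      else None) te
  else Some g.

Definition edge_indices te g pe :=
  [seq edge_index te (lookup g x.1, lookup g x.2) | x <- pe].

Definition hom_ok (t : target) g pe : bool :=
  [&& all (fun k => k < size (target_edges t)) (edge_indices (target_edges t) g pe),
      uniq (edge_indices (target_edges t) g pe),
      0 < size (target_vecs t) &
      all (fun p => p.2 < size (target_vecs t)) g].

Definition has_hom t pe : bool :=
  if hom_search pe (target_edges t) [::] is Some g then hom_ok t g pe else false.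

(** The first four target edges form the cycle. They must all be hit, by a map injective on the ends
    of edges, so that the graph itself contains a 4-cycle. *)
Definition has_four_cycle_hom t pe : bool :=
  if hom_search pe (target_edges t) [::] is Some g then
    [&& hom_ok t g pe,
        all (fun k => k \in edge_indices (target_edges t) g pe) (iota 0 4),
        all (fun x => x.1 != x.2) pe &
        let ends := flatten [seq [:: x.1; x.2] | x <- pe] in
        all (fun i => all (fun j => (lookup g i == lookup g j) ==> (i == j)) ends)
          ends]
  else false.

End Search.

Definition list_form (s : seq (seq int)) : nat -> nat -> int :=
  fun i j => (nth [::] s i)`_j.

Definition matching_target : target := Target 2
  [:: [:: 1; 0]; [:: 0; 1]; [:: 1; 1]; [:: 1; -1]]
  [:: (0, 1); (2, 3)]%N (fun i j => (i == j)%:Z)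
  [:: list_form [:: [:: 0; 1]; [:: 1; 0]]; list_form [:: [:: 1; 0]; [:: 0; 0]]].

Definition pentagon_target : target := Target 3
  [:: [:: -1; -1; -1]; [:: -1; 0; 1]; [:: 0; -1; 0]; [:: -1; 0; 0]; [:: 0; -1; 1]]
  [:: (0, 1); (1, 2); (2, 3); (3, 4); (4, 0)]%N (fun i j => (i == j)%:Z)
  [:: list_form [:: [:: 1; 0; 0]; [:: 0; 0; 0]; [:: 0; 0; 0]];
      list_form [:: [:: -1; 0; 0]; [:: 0; 0; -1]; [:: 0; -1; 0]];
      list_form [:: [:: 0; 1; 1]; [:: 1; 0; 1]; [:: 1; 1; 0]];
      list_form [:: [:: 0; 0; -1]; [:: 0; -1; 0]; [:: -1; 0; 0]];
      list_form [:: [:: 0; 0; 0]; [:: 0; 1; 0]; [:: 0; 0; 0]]].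

Definition triangle_target : target := Target 3
  [:: [:: 1; 0; 0]; [:: 0; 1; 0]; [:: 0; 0; 1]; [:: 1; -1; 0]; [:: 1; 1; 1];
      [:: 0; 1; -1]]
  [:: (0, 1); (1, 2); (2, 0); (3, 4); (4, 5)]%N (fun i j => (i == j)%:Z)
  [:: list_form [:: [:: -1; 1; 0]; [:: 1; -1; 0]; [:: 0; 0; 0]];
      list_form [:: [:: 1; 0; 0]; [:: 0; 0; 1]; [:: 0; 1; 0]];
      list_form [:: [:: 0; 0; 1]; [:: 0; 1; 0]; [:: 1; 0; 0]];
      list_form [:: [:: 1; 0; 0]; [:: 0; 0; 0]; [:: 0; 0; 0]];
      list_form [:: [:: 1; 0; 0]; [:: 0; 1; 0]; [:: 0; 0; 0]]].

Definition four_cycle_target : target := Target 3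
  [:: [:: 1; 0; 0]; [:: 0; 1; 0]; [:: 1; 0; 1]; [:: 0; 1; 1]; [:: 1; 1; 0];
      [:: 1; -1; 0]]
  [:: (0, 1); (1, 2); (2, 3); (3, 0); (4, 5)]%N
  (fun i j => ((i == j) && (i < 2)%N)%:Z)
  [:: list_form [:: [:: 0; 1; -1]; [:: 1; 0; -1]; [:: -1; -1; 1]];
      list_form [:: [:: 0; 0; 0]; [:: 0; 0; 1]; [:: 0; 1; -1]];
      list_form [:: [:: 0; 0; 0]; [:: 0; 0; 0]; [:: 0; 0; 1]];
      list_form [:: [:: 0; 0; 1]; [:: 0; 0; 0]; [:: 1; 0; -1]];
      list_form [:: [:: 1; 0; 0]; [:: 0; 0; 0]; [:: 0; 0; 0]]].

(** A graph of maximum degree 2 is a union of paths and cycles. With at most five edges, those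
    without triangle and 4-cycle wind around the pentagon, and the other two targets cover a
    triangle or a 4-cycle with what remains. *)
Definition pattern_ok (pe : seq (nat * nat)) : bool :=
  if has_hom pentagon_target pe then true else
  if has_hom triangle_target pe then true else
  has_four_cycle_hom four_cycle_target pe.

Lemma matching_target_ok : target_ok matching_target.
Proof. by vm_compute. Qed.

Lemma pentagon_target_ok : target_ok pentagon_target.
Proof. by vm_compute. Qed.

Lemma triangle_target_ok : target_ok triangle_target.
Proof. by vm_compute. Qed.

Lemma four_cycle_target_ok : target_ok four_cycle_target.
Proof. by vm_compute. Qed.

Lemma patterns_ok : explore pattern_ok 5 0 [::].
Proof. by vm_compute. Qed.

Section Configurations.
Context {R : realType} {n : nat}.
Implicit Types es : seq ('I_n * 'I_n).

Definition vertex_map (g : seq (nat * nat)) (vs : seq 'I_n) (i : 'I_n) : nat :=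
  lookup g (index i vs).

Lemma edge_index_swap te a b : edge_index te (a, b) = edge_index te (b, a).
Proof. by rewrite /edge_index; apply: eq_find => y; rewrite orbC. Qed.

Lemma edge_index_pattern te g vs (x : 'I_n * 'I_n) :
  edge_index te (lookup g (pattern_edge vs x).1, lookup g (pattern_edge vs x).2) =
  edge_index te (vertex_map g vs x.1, vertex_map g vs x.2).
Proof.
rewrite /pattern_edge /vertex_map /=.
by case: leqP => // _; rewrite edge_index_swap.
Qed.

Lemma edge_indices_pattern te g vs es :
  edge_indices te g (pattern vs es) =
  [seq edge_index te (vertex_map g vs x.1, vertex_map g vs x.2) | x <- es].
Proof.
by rewrite /edge_indices -map_comp; apply: eq_map => x; rewrite /= edge_index_pattern.
Qed.

Lemma transversal_of_hom t g vs es : target_ok t -> hom_ok t g (pattern vs es) ->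
  transversal (R := R) es [::] (target_mx t (vertex_map g vs))
    (mx_of_int (target_dim t) (target_base t))
    (fun x => mx_of_int (target_dim t) (target_dual t
      (edge_index (target_edges t) (vertex_map g vs x.1, vertex_map g vs x.2)))).
Proof.
move=> tok /and4P[]; rewrite edge_indices_pattern => /allP lt_te uniq_te t0 /allP g_lt.
apply: transversal_of_target => //.
- move=> i; rewrite /vertex_map /lookup.
  have [lt|ge] := ltnP (find (fun p => p.1 == index i vs) g) (size g).
    by apply: g_lt; exact: mem_nth.
  by rewrite nth_default.
- by move=> x xes; apply: lt_te; apply/mapP; exists x.
- move=> x y xes yes /= E.
  set h := fun x => edge_index _ _ in E uniq_te *.
  have := @nth_uniq _ 0%N [seq h x | x <- es] (index x es) (index y es).
  rewrite size_map !index_mem => /(_ xes yes uniq_te).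
  rewrite !(nth_map x) ?index_mem// !nth_index// /h E eqxx => /esym/eqP.
  by move=> /(congr1 (nth x es)); rewrite !nth_index.
Qed.

Lemma identity_form N : mx_of_int N (fun i j => (i == j)%:Z) = 1%:M :> 'M[R]_N.
Proof. by apply/matrixP => i j; rewrite !mxE -pmulrn. Qed.

Lemma config_of_hom t es vs : target_ok t ->
  target_base t = (fun i j => (i == j)%:Z) ->
  has_hom t (pattern vs es) -> config (R := R) es (target_dim t).
Proof.
rewrite /has_hom; case: (hom_search _ _ _) => // g tok tb /(transversal_of_hom tok).
rewrite tb identity_form => tr.
by eexists _, [::], _, _; split; last exact: tr.
Qed.

Variable e : rel 'I_n.

(** The exhaustive check supplies a target for the relabelled graph; only the 4-cycle needs its
    vertices recovered from the map. *)
Lemma robust_subcubic es m : subcubic_simple es -> (size es <= 5)%N ->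
  covers_nonedges e es -> (forall i j, (i, j) \in es -> ~~ e i j && ~~ e j i) ->
  (3 + m <= n)%N -> (0 < m)%N -> robust (R := R) e m.
Proof.
move=> simple le5 cov nones dim m0.
(* [catrev] reverses the list, hence [rev es]. *)
have := @explore_sound pattern_ok _ (rev es) [::] [::] 5.
rewrite catrevE cats0 revK size_rev => /(_ simple) H.
have {H} [//|//||vs [vsE]] := H; first exact: patterns_ok.
rewrite /pattern_ok.
case: ifP => [/(config_of_hom pentagon_target_ok erefl) cfg _|_].
  exact: robust_of_config cfg cov dim m0.
case: ifP => [/(config_of_hom triangle_target_ok erefl) cfg _|_].
  exact: robust_of_config cfg cov dim m0.
rewrite /has_four_cycle_hom; case: (hom_search _ _ _) => // g.
move=> /and4P[hom /allP hits _ /allP inj].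
have tr := transversal_of_hom four_cycle_target_ok hom.
set f := vertex_map g vs in tr.
have hit k : (k < 4)%N -> exists2 x, x \in es &
    (f x.1, f x.2) = target_edge four_cycle_target k \/
    (f x.2, f x.1) = target_edge four_cycle_target k.
  move=> k4; have := hits k; rewrite mem_iota => /(_ k4).
  rewrite edge_indices_pattern => /mapP[x xes kE]; exists x => //.
  have /(nth_find (0, 0)%N) : has (fun y => (y == (f x.1, f x.2)) ||
      (y == (f x.2, f x.1))) (target_edges four_cycle_target).
    rewrite has_find; change (edge_index (target_edges four_cycle_target) (f x.1, f x.2) < 5)%N.
    by rewrite -kE; lia.
  by rewrite -/(edge_index _ (f x.1, f x.2)) -kE => /orP[]/eqP; [left|right].
have finj (x y : 'I_n * 'I_n) a b : x \in es -> y \in es ->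
    a \in [:: x.1; x.2] -> b \in [:: y.1; y.2] -> f a = f b -> a = b.
  move=> xes yes ax By fab.
  have endP z c : z \in es -> c \in [:: z.1; z.2] ->
    index c vs \in flatten [seq [:: x.1; x.2] | x <- pattern vs es] /\ c \in vs.
    move=> zes cz; have /andP[z1 z2] := vsE z zes; split; last first.
      by move: cz; rewrite !inE => /orP[]/eqP ->.
    apply/flatten_mapP; exists (pattern_edge vs z); first exact: map_f.
    move: cz; rewrite !inE /pattern_edge /=.
    by case: leqP => _ /orP[]/eqP ->; rewrite eqxx ?orbT.
  have [ia avs] := endP x a xes ax; have [ib bvs] := endP y b yes By.
  have fabE : lookup g (index a vs) = lookup g (index b vs) := fab.
  have /allP /(_ _ ib) := inj _ ia; rewrite fabE eqxx /=.
  by move=> /eqP /(congr1 (nth a vs)); rewrite !nth_index.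
have ed x a b : x \in es -> a = x.1 /\ b = x.2 \/ a = x.2 /\ b = x.1 ->
    ~~ e a b.
  move=> xes; have := nones x.1 x.2; rewrite -surjective_pairing => /(_ xes).
  by move=> /andP[e1 e2] [] [-> ->].
have split_hit k u w : (k < 4)%N -> target_edge four_cycle_target k = (u, w) ->
    exists x a b, [/\ x \in es, f a = u, f b = w, a \in [:: x.1; x.2] & 
      b \in [:: x.1; x.2]] /\ ~~ e a b.
  move=> k4 tE; have [x xes []] := hit k k4; rewrite tE => -[fu fw].
    by exists x, x.1, x.2; split; [rewrite !inE !eqxx ?orbT|apply: (ed x); auto].
  by exists x, x.2, x.1; split; [rewrite !inE !eqxx ?orbT|apply: (ed x); auto].
have [x0 [p [r [[x0es fp fr px rx] epr]]]] := split_hit 0 0 1 isT erefl.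
have [x1 [r' [q [[x1es fr' fq r'x qx] erq]]]] := split_hit 1 1 2 isT erefl.
have [x2 [q' [s [[x2es fq' fs q'x sx] eqs]]]] := split_hit 2 2 3 isT erefl.
have [x3 [s' [p' [[x3es fs' fp' s'x p'x] esp]]]] := split_hit 3 3 0 isT erefl.
(* Edges hitting consecutive target edges share an end by injectivity, so the four preimages close
   up to a cycle through [p], [r], [q], [s]. *)
have r'r : r' = r by apply: (finj x1 x0) => //; rewrite fr'.
have q'q : q' = q by apply: (finj x2 x1) => //; rewrite fq'.
have s's : s' = s by apply: (finj x3 x2) => //; rewrite fs'.
have p'p : p' = p by apply: (finj x3 x0) => //; rewrite fp'.
subst r' q' s' p'.
have sym i j : ~~ e i j -> (i, j) \in es \/ (j, i) \in es -> ~~ e j i.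
  by move=> _ [/nones|/nones] /andP[].
have neq i j : f i != f j -> i != j by apply: contraNneq => ->.
apply: (@robust_of_four_cycle R n e es _ _ m p q r s) => //.
- rewrite (_ : \matrix_(i, j) _ = mx_of_int 3 (target_base four_cycle_target)).
    exact: tr.
  by apply/matrixP => i j; rewrite !mxE.
- by move=> j; rewrite mxE fp; case: j => -[|[|[|]]].
- by move=> j; rewrite mxE fq; case: j => -[|[|[|]]].
- by move=> j; rewrite mxE fr; case: j => -[|[|[|]]].
- by move=> j; rewrite mxE fs; case: j => -[|[|[|]]].
- by rewrite !neq// ?fp ?fq ?fr ?fs.
- have esym i j : i != j -> ~~ e i j -> ~~ e j i.
    by move=> ij eij; apply: sym (cov i j ij eij).
  rewrite epr eqs /= (esym _ _ _ erq) ?(esym _ _ _ esp)//.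
  + by rewrite neq// fs fp.
  + by rewrite neq// fr fq.
Qed.

End Configurations.

(** * Robust stresses for complements with at most five edges *)

Section RobustComplement.
Context {R : realType} {n : nat}.
Implicit Types es : seq ('I_n * 'I_n).

Lemma config_matching es x y : es =i [:: x; y] ->
  uniq [:: x.1; x.2; y.1; y.2] -> config (R := R) es 2.
Proof.
move=> esE; rewrite /= !inE !negb_or.
move=> /and4P[/and3P[x12 xy11 xy12] /andP[xy21 xy22] y12 _].
pose f i := if i == x.1 then 0%N else if i == x.2 then 1%N else
  if i == y.1 then 2%N else if i == y.2 then 3%N else 0%N.
have fx1 : f x.1 = 0%N by rewrite /f eqxx.
have fx2 : f x.2 = 1%N by rewrite /f eq_sym (negbTE x12) eqxx.
have fy1 : f y.1 = 2%N.
  by rewrite /f eq_sym (negbTE xy11) eq_sym (negbTE xy21) eqxx.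
have fy2 : f y.2 = 3%N.
  rewrite /f eq_sym (negbTE xy12) eq_sym (negbTE xy22).
  by rewrite eq_sym (negbTE y12) eqxx.
have hx : edge_index (target_edges matching_target) (f x.1, f x.2) = 0%N.
  by rewrite fx1 fx2.
have hy : edge_index (target_edges matching_target) (f y.1, f y.2) = 1%N.
  by rewrite fy1 fy2.
have tr := @transversal_of_target R n _ f es matching_target_ok.
eexists 2%N, [::], _, _; split=> //.
rewrite -identity_form; apply: tr.
- by move=> i; rewrite /f; do 4?case: ifP.
- by move=> z; rewrite esE !inE => /orP[]/eqP ->; rewrite ?hx ?hy.
- move=> z w; rewrite !esE !inE.
  by move=> /orP[]/eqP -> /orP[]/eqP ->; rewrite ?hx ?hy.
Qed.

(** At most two edges either share a vertex, whose deletion leaves no edge, or are disjoint and map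
    to the matching target. *)
Lemma config_two es : (0 < n)%N -> uniq es -> (forall x, x \in es -> x.1 != x.2) ->
  (size es <= 2)%N -> config (R := R) es 2.
Proof.
move=> n0 ues irr.
have by_removal v : all (incident v) es -> config (R := R) es 2.
  move=> /allP inc; apply: (@config_remove _ _ _ _ v).
  rewrite (_ : [seq x <- es | _] = [::]); first exact: config_nil.
  apply/eqP; rewrite -(negbK (_ == _)) -has_filter; apply/hasPn => x /inc.
  by rewrite /incident -negb_or negbK.
case: es ues irr by_removal => [|x [|y [|//]]] /=.
- by move=> _ _ /(_ (Ordinal n0) isT).
- by move=> _ _ /(_ x.1); rewrite /incident eqxx => /(_ isT).
rewrite inE andbT => xy irr by_removal _.
have x12 := irr x (mem_head _ _).
have y12 := irr y; rewrite !inE eqxx orbT in y12; have {}y12 := y12 isT.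
have [i1|n1] := boolP (incident x.1 y).
  by apply: (by_removal x.1); rewrite i1 /incident eqxx.
have [i2|n2] := boolP (incident x.2 y).
  by apply: (by_removal x.2); rewrite i2 /incident eqxx orbT.
apply: (@config_matching _ x y) => //=.
move: n1 n2; rewrite /incident !inE !negb_or !(eq_sym y.1) !(eq_sym y.2).
by move=> /andP[-> ->] /andP[-> ->]; rewrite x12 y12.
Qed.

Variable e : rel 'I_n.
Hypotheses (e_sym : symmetric e) (n_gt0 : (0 < n)%N).

Definition nonedges : seq ('I_n * 'I_n) := enum (complement_edges e).

Lemma mem_nonedges x : (x \in nonedges) = (x.1 < x.2)%N && ~~ e x.1 x.2.
Proof. by rewrite mem_enum inE. Qed.

Lemma nonedges_uniq : uniq nonedges.
Proof. exact: enum_uniq. Qed.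

Lemma size_nonedges : size nonedges = #|complement_edges e|.
Proof. by rewrite -cardE. Qed.

Lemma nonedges_neq x : x \in nonedges -> x.1 != x.2.
Proof. by rewrite mem_nonedges => /andP[lt _]; rewrite -val_eqE ltn_eqF. Qed.

Lemma covers_nonedges_nonedges : covers_nonedges e nonedges.
Proof.
move=> i j ij eij; rewrite !mem_nonedges /= [e j i]e_sym eij !andbT.
by case: (ltngtP i j) ij => //; [left|right|move/val_inj ->; rewrite eqxx].
Qed.

Lemma robust_complete m : nonedges = [::] -> (m < n)%N -> (0 < m)%N ->
  robust (R := R) e m.
Proof.
move=> ne lt m0; apply: (@robust_of_config _ _ _ nonedges 1) => //.
  by rewrite ne; exact: config_nil.
exact: covers_nonedges_nonedges.
Qed.

Lemma robust_star m v : all (incident v) nonedges -> (2 + m <= n)%N -> (0 < m)%N ->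
  robust (R := R) e m.
Proof.
move=> /allP inc dim m0; apply: (@robust_of_config _ _ _ nonedges 2) => //.
  apply: (@config_remove _ _ _ _ v).
  rewrite (_ : [seq x <- _ | _] = [::]); first exact: config_nil.
  apply/eqP; rewrite -(negbK (_ == _)) -has_filter; apply/hasPn => x /inc.
  by rewrite /incident -negb_or negbK.
exact: covers_nonedges_nonedges.
Qed.

Lemma robust_two m : (size nonedges <= 2)%N -> (2 + m <= n)%N -> (0 < m)%N ->
  robust (R := R) e m.
Proof.
move=> le2 dim m0; apply: (@robust_of_config _ _ _ nonedges 2) => //.
  by apply: config_two => //; [exact: nonedges_uniq|exact: nonedges_neq].
exact: covers_nonedges_nonedges.
Qed.

(** Deleting a vertex on at least three non-edges costs one dimension and leaves at most two edges;
    otherwise all degrees are at most 2. *)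
Lemma robust_five m : (size nonedges <= 5)%N -> (3 + m <= n)%N -> (0 < m)%N ->
  robust (R := R) e m.
Proof.
move=> le5 dim m0.
have [[v v3]|nv] := pselect (exists v, (3 <= count (incident v) nonedges)%N).
  apply: (@robust_of_config _ _ _ nonedges 3) => //; last exact: covers_nonedges_nonedges.
  apply: (@config_remove _ _ _ _ v); apply: config_two => //.
  - exact/filter_uniq/nonedges_uniq.
  - by move=> x; rewrite mem_filter => /andP[_ /nonedges_neq].
  rewrite size_filter (@eq_count _ _ (predC (incident v))).
    rewrite -(leq_add2l (count (incident v) nonedges)) count_predC.
    by apply: leq_trans le5 _; rewrite -[5%N]/(3 + 2)%N leq_add2r.
  by move=> x; rewrite /incident /= negb_or.
apply: (@robust_subcubic _ _ _ nonedges) => //.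
- split; [exact: nonedges_uniq|exact: nonedges_neq| |].
    move=> x; rewrite !mem_nonedges => /andP[lt _]; rewrite negb_and /=.
    by rewrite -leqNgt ltnW.
  by move=> v; rewrite leqNgt; apply/negP => v3; apply: nv; exists v.
- exact: covers_nonedges_nonedges.
- move=> i j; rewrite mem_nonedges /= => /andP[_ eij].
  by rewrite [e j i]e_sym eij.
Qed.

End RobustComplement.

(** * Samples without stresses *)

Section StressFree.
Context {R : realType} {n : nat}.
Variable e : rel 'I_n.

Definition stress_free m (X : 'M[R]_(n, m)) : Prop :=
  forall K, model_space e K -> K *m X = 0 -> K = 0.

(** Over the reals [B *m B^T] vanishes only for [B = 0]. *)
Lemma robust_not_stress_free m (X : 'M[R]_(n, m)) : gram_stress e X -> ~ stress_free X.
Proof.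
move=> [k [B [B0 BX eB]]] /(_ (B *m B^T)) H; case/eqP: B0.
have BB0 : B *m B^T = 0.
  by apply: H; [split; [exact: gram_sym|exact: eB]|rewrite -mulmxA BX mulmx0].
apply: trmx_inj; rewrite trmx0; apply/matrixP => i j.
have : quad 1%:M (B^T *m delta_mx j 0) = 0.
  by rewrite -gram_quad BB0 /quad mulmx0 mul0mx mxE.
by move=> /quad1_eq0; rewrite -colE => /matrixP /(_ i 0); rewrite !mxE.
Qed.

(** Take for [X0] a basis of the left kernel of [A]. A symmetric [K] killing it has rows in the span
    of the columns of [A], so it is [A *m S *m A^T] and its conditions pass to [S]. *)
Lemma stress_free_annihilator N m (A : 'M[R]_(n, N)) :
  row_free A^T -> n = (N + m)%N ->
  (forall S : 'M[R]_N, S^T = S ->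
    (forall i j, i != j -> ~~ e i j -> edge_form A S (i, j) = 0) -> S = 0) ->
  exists X0 : 'M[R]_(n, m), stress_free X0.
Proof.
move=> fA nE noS.
have rA : \rank A = N by rewrite -mxrank_tr; apply/eqP.
have rk : \rank (kermx A) = m by rewrite mxrank_ker rA; lia.
move: rk nE => <- nE; exists (row_base (kermx A))^T => K [sK eK] KX.
have AX : A^T *m (row_base (kermx A))^T = 0.
  rewrite -trmx_mul (_ : row_base (kermx A) *m A = 0) ?trmx0//.
  by apply/sub_kermxP; rewrite eq_row_base.
have KA : (K <= A^T)%MS.
  apply: submx_trans (_ : (kermx (row_base (kermx A))^T <= A^T)%MS).
    exact/sub_kermxP.
  have sub : (A^T <= kermx (row_base (kermx A))^T)%MS by exact/sub_kermxP.
  rewrite -(mxrank_leqif_sup sub) mxrank_ker !mxrank_tr rA.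
  by rewrite eq_row_base mxrank_ker rA; apply/eqP; lia.
have [Z KZ] := submxP KA.
(* A left inverse of [A] recovers [S] as [L *m K *m L^T]. *)
have [L LA] : exists L : 'M[R]_(N, n), L *m A = 1%:M.
  have [B AB] := row_freeP fA; exists B^T.
  by apply: trmx_inj; rewrite trmx_mul trmxK AB trmx1.
have KL : K = K *m L^T *m A^T.
  by rewrite [in RHS]KZ -!mulmxA (mulmxA A^T) -trmx_mul LA trmx1 mul1mx.
have KAS : K = A *m (L *m K *m L^T) *m A^T.
  have LK : K = A *m L *m K by rewrite -[LHS]sK [in LHS]KL !trmx_mul !trmxK sK mulmxA.
  by rewrite [LHS]LK [in LHS]KL !mulmxA.
have SS : (L *m K *m L^T)^T = L *m K *m L^T by rewrite !trmx_mul trmxK sK mulmxA.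
rewrite KAS (noS _ SS) ?mulmx0 ?mul0mx// => i j ij eij.
by rewrite /edge_form -KAS eK.
Qed.

Lemma stress_free_complete : exists X0 : 'M[R]_(n, n), stress_free X0.
Proof.
by exists 1%:M => K _; rewrite mulmx1.
Qed.

Lemma stress_free_one m i j : n = m.+1 -> i != j -> ~~ e i j ->
  exists X0 : 'M[R]_(n, m), stress_free X0.
Proof.
move=> nE ij eij; apply: (@stress_free_annihilator 1 m (const_mx 1)) => //.
  apply/row_freeP; exists (delta_mx i 0); apply/matrixP => a b.
  by rewrite !ord1 -colE !mxE.
move=> S _ /(_ i j ij eij); rewrite edge_formE !big_ord1 !mxE mul1r mulr1 => S0.
by apply/matrixP => a b; rewrite !ord1 S0 mxE.
Qed.

Definition two_coords (a b : 'I_n -> R) : 'M[R]_(n, 2) :=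
  \matrix_(i, k) if k == 0 then a i else b i.

Lemma edge_form_two a b (S : 'M[R]_2) i j : S^T = S ->
  edge_form (two_coords a b) S (i, j) =
  a i * a j * S 0 0 + (a i * b j + b i * a j) * S 0 1 + b i * b j * S 1 1.
Proof.
move=> sS; have S10 : S 1 0 = S 0 1 by rewrite -[in LHS]sS mxE.
rewrite edge_formE !big_ord_recl !big_ord0 !mxE /=.
have -> : lift ord0 ord0 = 1 :> 'I_2 by exact/val_inj.
by rewrite S10; ring.
Qed.

Lemma two_coords_free a b i j : a i * b j != a j * b i ->
  row_free (two_coords a b)^T.
Proof.
move=> ab; rewrite /row_free eqn_leq rank_leq_row /=.
pose P := rowsub (fun k : 'I_2 => if k == 0 then i else j) (two_coords a b).
have uP : P \in unitmx.
  by rewrite unitmxE unitfE det2 !mxE /= subr_eq0 [b i * _]mulrC.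
by rewrite mxrank_tr -[X in (X <= _)%N](mxrank_unit uP) /P rowsubE mxrankM_maxr.
Qed.

Lemma form2_eq0 (S : 'M[R]_2) : S^T = S ->
  S 0 0 = 0 -> S 0 1 = 0 -> S 1 1 = 0 -> S = 0.
Proof.
move=> sS S00 S01 S11.
have S10 : S 1 0 = 0 by rewrite -[in LHS]sS mxE.
apply/matrixP => i j; rewrite mxE.
have ord2 (k : 'I_2) : k = 0 \/ k = 1.
  by case: k => -[|[|//]] ?; [left|right]; exact/val_inj.
by case: (ord2 i) => ->; case: (ord2 j) => ->.
Qed.

Hypothesis e_sym : symmetric e.

(** The rows are (1, 0) at [v], (1, 1) at [u] and (0, 1) at [w]. The pair [v w] kills the mixed
    coefficient, [v u] the first one, and [x y], which avoids [v], the last. *)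
Lemma stress_free_path m v u w x y : n = m.+2 ->
  v != u -> v != w -> u != w -> ~~ e v u -> ~~ e v w ->
  x != y -> x != v -> y != v -> ~~ e x y ->
  exists X0 : 'M[R]_(n, m), stress_free X0.
Proof.
move=> nE vu vw uw evu evw xy xv yv exy.
pose a (i : 'I_n) : R := ((i == v) || (i == u))%:R.
pose b (i : 'I_n) : R := (i != v)%:R.
have av : a v = 1 by rewrite /a eqxx.
have bv : b v = 0 by rewrite /b eqxx.
have bne i : i != v -> b i = 1 by move=> iv; rewrite /b iv.
have au : a u = 1 by rewrite /a eqxx orbT.
have aw : a w = 0 by rewrite /a eq_sym (negbTE vw) eq_sym (negbTE uw).
have bw : b w = 1 by rewrite bne// eq_sym.
apply: (@stress_free_annihilator 2 m (two_coords a b)) => //.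
  by apply: (@two_coords_free _ _ v w); rewrite av bw aw bv !mulr1 mulr0 oner_eq0.
move=> S sS noS.
have S01 : S 0 1 = 0.
  have := noS v w vw evw; rewrite edge_form_two// av aw bv bw.
  by rewrite !(mulr0, mul0r, mul1r, addr0, add0r).
have S00 : S 0 0 = 0.
  have := noS v u vu evu; rewrite edge_form_two// av au bv S01.
  by rewrite !(mulr0, mul0r, mul1r, addr0, add0r).
apply: form2_eq0 => //; have := noS x y xy exy.
by rewrite edge_form_two// S01 S00 !bne// !(mulr0, mul0r, mul1r, addr0, add0r).
Qed.

(** Rows (1, 0) at [a], [c], [d] and (0, 1) elsewhere: the three pairs isolate the three
    coefficients of [S]. *)
Lemma stress_free_matching m a b c d f g : n = m.+2 ->
  uniq [:: a; b; c; d; f; g] -> ~~ e a b -> ~~ e c d -> ~~ e f g ->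
  exists X0 : 'M[R]_(n, m), stress_free X0.
Proof.
move=> nE /=; rewrite !inE !negb_or -!andbA.
case/and5P => ab ac ad af /and5P[ag bc bd bf /and5P[bg cd cf cg /and4P[df dg fg _]]].
move=> eab ecd efg.
pose U (i : 'I_n) := [|| i == a, i == c | i == d].
pose s (i : 'I_n) : R := (U i)%:R; pose t (i : 'I_n) : R := (~~ U i)%:R.
have Ua : U a by rewrite /U eqxx.
have Uc : U c by rewrite /U eqxx orbT.
have Ud : U d by rewrite /U eqxx !orbT.
have Ub : U b = false.
  by rewrite /U eq_sym (negbTE ab) (negbTE bc) (negbTE bd).
have Uf : U f = false.
  by rewrite /U eq_sym (negbTE af) eq_sym (negbTE cf) eq_sym (negbTE df).
have Ug : U g = false.
  by rewrite /U eq_sym (negbTE ag) eq_sym (negbTE cg) eq_sym (negbTE dg).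
apply: (@stress_free_annihilator 2 m (two_coords s t)) => //.
  by apply: (@two_coords_free _ _ a b); rewrite /s /t Ua Ub mulr1 mulr0 oner_eq0.
move=> S sS noS.
have noS' i j ij eij := etrans (esym (edge_form_two s t i j sS)) (noS i j ij eij).
apply: form2_eq0 => //.
- have := noS' c d cd ecd; rewrite /s /t Uc Ud.
  by rewrite !(mulr0, mul0r, mul1r, addr0, add0r).
- have := noS' a b ab eab; rewrite /s /t Ua Ub.
  by rewrite !(mulr0, mul0r, mul1r, addr0, add0r).
- have := noS' f g fg efg; rewrite /s /t Uf Ug.
  by rewrite !(mulr0, mul0r, mul1r, addr0, add0r).
Qed.

(** Either some vertex lies on two non-edges and a third one avoids it, or the non-edges are
    disjoint and three of them form a matching. *)
Lemma stress_free_nonstar m : n = m.+2 -> (3 <= size (nonedges e))%N ->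
  (forall v, ~~ all (incident v) (nonedges e)) ->
  exists X0 : 'M[R]_(n, m), stress_free X0.
Proof.
move=> nE c3 nostar.
have ne x : x \in nonedges e -> x.1 != x.2 /\ ~~ e x.1 x.2.
  move=> xe; split; first exact: nonedges_neq xe.
  by move: xe; rewrite mem_nonedges => /andP[].
have [[v v2]|nv] := pselect (exists v, (2 <= count (incident v) (nonedges e))%N).
  have /allPn[z ze] := nostar v; rewrite /incident negb_or => /andP[z1 z2].
  have [zne ez] := ne z ze.
  pose other (x : 'I_n * 'I_n) := if x.1 == v then x.2 else x.1.
  have otherP x : x \in seq.filter (incident v) (nonedges e) ->
      v != other x /\ ~~ e v (other x).
    rewrite mem_filter /incident /other => /andP[vx /ne[xne ex]].
    case: eqP vx => [<- _|_ /eqP <-]; first by [].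
    by rewrite e_sym eq_sym.
  have := filter_uniq (incident v) (nonedges_uniq e).
  have := v2; rewrite -size_filter.
  case E : (seq.filter _ _) => [|x [|y r]] //= _ /andP[]; rewrite inE negb_or => /andP[xy _] _.
  have xE : x \in seq.filter (incident v) (nonedges e) by rewrite E mem_head.
  have yE : y \in seq.filter (incident v) (nonedges e) by rewrite E inE mem_head orbT.
  have [vx evx] := otherP x xE; have [vy evy] := otherP y yE.
  apply: (@stress_free_path m v (other x) (other y) z.1 z.2) => //.
  apply: contra_neq xy.
  move: xE yE; rewrite (mem_filter _ x) (mem_filter _ y) !mem_nonedges /incident /other.
  case: x y {E vx evx vy evy} => [x1 x2] [y1 y2] /=.
  move=> /and3P[vx xlt _] /and3P[vy ylt _].
  move: xlt ylt.
  case: eqP vx => [-> _|_ /= /eqP ->]; case: eqP vy => [-> _|_ /= /eqP ->] //= xlt ylt E.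
  - by rewrite E.
  - by exfalso; move: xlt ylt; rewrite E; lia.
  - by exfalso; move: xlt ylt; rewrite E; lia.
  - by rewrite E.
have disj (p q : 'I_n * 'I_n) : p \in nonedges e -> q \in nonedges e ->
    p != q -> forall v, incident v p -> ~~ incident v q.
  move=> pE qE pq v vp; apply/negP => vq; apply: nv; exists v.
  have /permP -> := perm_to_rem pE; rewrite /= vp add1n ltnS -has_count.
  apply/hasP; exists q => //; move: qE.
  by rewrite mem_rem_uniq ?nonedges_uniq// inE eq_sym pq.
have := nonedges_uniq e; have := c3; move: ne disj.
case: (nonedges e) => [|x [|y [|z r]]] //= ne disj _ uxyz.
have xE : x \in [:: x, y, z & r] by rewrite !inE eqxx.
have yE : y \in [:: x, y, z & r] by rewrite !inE eqxx !orbT.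
have zE : z \in [:: x, y, z & r] by rewrite !inE eqxx !orbT.
have /and4P[] := uxyz; rewrite !inE !negb_or => /and3P[xy xz _] /andP[yz _] _ _.
have inc1 (p : 'I_n * 'I_n) : incident p.1 p by rewrite /incident eqxx.
have inc2 (p : 'I_n * 'I_n) : incident p.2 p by rewrite /incident eqxx orbT.
have disj4 (p q : 'I_n * 'I_n) (pE : p \in [:: x, y, z & r])
    (qE : q \in [:: x, y, z & r]) (pq : p != q) :
    [&& p.1 != q.1, p.1 != q.2, p.2 != q.1 & p.2 != q.2].
  have := disj p q pE qE pq _ (inc1 p); have := disj p q pE qE pq _ (inc2 p).
  rewrite /incident !negb_or !(eq_sym q.1) !(eq_sym q.2).
  by move=> /andP[-> ->] /andP[-> ->].
have [x12 ex] := ne x xE; have [y12 ey] := ne y yE; have [z12 ez] := ne z zE.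
apply: (@stress_free_matching m x.1 x.2 y.1 y.2 z.1 z.2) => //.
have /and4P[a1 a2 a3 a4] := disj4 x y xE yE xy.
have /and4P[b1 b2 b3 b4] := disj4 x z xE zE xz.
have /and4P[c1 c2 c4 c5] := disj4 y z yE zE yz.
rewrite /= !inE !negb_or x12 y12 z12 a1 a2 a3 a4 b1 b2 b3 b4 c1 c2 c4 c5.
by [].
Qed.

End StressFree.

(** * Stress-freeness as a polynomial condition *)

Section GramPolynomial.
Context {R : realType} {n : nat}.
Variable e : rel 'I_n.

(** The stresses of [X] are the kernel of this linear map, whose blocks collect the defining
    equations. *)
Definition stress_map m (X : 'M[R]_(n, m)) (K : 'M[R]_n) : 'M[R]_(n, m + (n + n)) :=
  row_mx (K *m X) (row_mx (K - K^T)
    (\matrix_(i, j) if (i != j) && ~~ e i j then K i j else 0)).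

Lemma stress_map_linear m (X : 'M[R]_(n, m)) : linear (stress_map X).
Proof.
move=> a K L; rewrite /stress_map mulmxDl -scalemxAl linearD linearZ /=.
rewrite !scale_row_mx !add_row_mx; congr row_mx; congr row_mx.
  by rewrite opprD addrACA scalerBr.
by apply/matrixP => i j; rewrite !mxE; case: ifP => // _; rewrite mulr0 addr0.
Qed.

Lemma stress_map_eq0 m (X : 'M[R]_(n, m)) K :
  stress_map X K = 0 <-> model_space e K /\ K *m X = 0.
Proof.
split=> [|[[sK eK] KX]]; last first.
  rewrite /stress_map KX sK subrr (_ : \matrix_(i, j) _ = 0) ?row_mx0//.
  by apply/matrixP => i j; rewrite !mxE; case: ifP => // /andP[ij eij]; exact: eK.
rewrite /stress_map -(row_mx0 R n m) -(row_mx0 R n n n) => /eq_row_mx[KX /eq_row_mx[KK eK]].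
split=> //; split=> [|i j ij eij]; first exact/esym/subr0_eq.
by have := congr1 (fun M : 'M[R]_n => M i j) eK; rewrite !mxE ij eij.
Qed.

Definition stress_matrix m (X : 'M[R]_(n, m)) := lin_mx (stress_map X).

(** Over the reals a linear map is injective exactly when its Gram determinant is nonzero, which
    packs all maximal minors into one polynomial. *)
Definition stress_gram m (X : 'M[R]_(n, m)) : R :=
  \det (stress_matrix X *m (stress_matrix X)^T).

Lemma stress_matrixE m (X : 'M[R]_(n, m)) u :
  u *m stress_matrix X = mxvec (stress_map X (vec_mx u)).
Proof.
have H := GRing.isLinear.Build _ _ _ _ (stress_map X) (@stress_map_linear m X).
pose f : {linear _ -> _} := HB.pack (stress_map X) H.
by rewrite -{1}(vec_mxK u); exact: (mul_vec_lin f).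
Qed.

Lemma stress_gramP m (X : 'M[R]_(n, m)) : stress_free e X <-> stress_gram X != 0.
Proof.
rewrite /stress_gram -unitfE -unitmxE -row_free_unit -kermx_eq0; split.
  move=> free; apply/rowV0P => u /sub_kermxP uP.
  have : quad 1%:M (u *m stress_matrix X)^T = 0.
    by rewrite /quad mulmx1 trmxK trmx_mul mulmxA -(mulmxA u) uP mul0mx mxE.
  move=> /quad1_eq0 /(congr1 trmx); rewrite trmxK linear0 stress_matrixE.
  move=> /(congr1 vec_mx); rewrite mxvecK linear0 => /stress_map_eq0 [mK KX].
  by rewrite -(vec_mxK u) (free _ mK KX) linear0.
move=> /rowV0P inj K mK KX.
rewrite -(mxvecK K) (inj (mxvec K)) ?linear0//; apply/sub_kermxP.
by rewrite mulmxA stress_matrixE mxvecK ((stress_map_eq0 X K).2 _) ?linear0 ?mul0mx.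
Qed.

Definition int_values : set R := [set c | exists z : int, c = z%:~R].

Lemma int_valuesP : [/\ int_values 0, int_values 1 & int_values (-1)].
Proof. by split; [exists 0|exists 1|exists (-1)]. Qed.

Lemma polymx_row_mx T (C : set R) (G : set (T -> R)) p q1 q2
    (F1 : T -> 'M[R]_(p, q1)) (F2 : T -> 'M[R]_(p, q2)) :
  polymx C G F1 -> polymx C G F2 -> polymx C G (fun x => row_mx (F1 x) (F2 x)).
Proof.
move=> p1 p2 i j; case: (split_ordP j) => k ->.
  rewrite (_ : (fun _ => _) = (fun x => F1 x i k)); first exact: p1.
  by apply/funext => x; rewrite row_mxEl.
rewrite (_ : (fun _ => _) = (fun x => F2 x i k)); first exact: p2.
by apply/funext => x; rewrite row_mxEr.
Qed.

(** The rows of [stress_matrix] are the images of the matrix units, so only integer coefficients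
    occur. *)
Lemma polyfun_stress_gram m : polyfun int_values entries (@stress_gram m).
Proof.
have [C0 C1 CN1] := int_valuesP.
have pX : polymx int_values entries (id : 'M[R]_(n, m) -> 'M[R]_(n, m)).
  by move=> i j; apply: polyfun_gen; exists i, j.
have pM : polymx int_values entries (@stress_matrix m).
  move=> i j; pose K : 'M[R]_n := vec_mx (delta_mx 0 i).
  have CK a b : int_values (K a b).
    by rewrite !mxE; eexists; exact: pmulrn.
  rewrite (_ : (fun _ => _) = (fun X : 'M[R]_(n, m) => mxvec (stress_map X K) 0 j)).
    case/mxvec_indexP: j => a b.
    rewrite (_ : (fun _ => _) = (fun X : 'M[R]_(n, m) => stress_map X K a b)); last first.
      by apply/funext => X; rewrite mxvecE.
    apply: polymx_row_mx; first by apply: polymx_mul => //; exact: polymx_const.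
    apply: polymx_row_mx; apply: polymx_const => k l; last first.
      by rewrite mxE; case: ifP.
    have -> : (K - K^T) k l = K k l - K l k.
      by rewrite [LHS]mxE [X in _ + X]mxE [X in - X]mxE.
    have [y ->] := CK k l; have [z ->] := CK l k.
    by exists (y - z); rewrite rmorphB.
  apply/funext => X; rewrite -stress_matrixE.
  by rewrite -rowE [RHS]mxE.
apply: polyfun_det => //; apply: polymx_mul => //; exact: (polymx_tr pM).
Qed.

End GramPolynomial.

(** * Transfer to random samples *)

Section Samples.
Context {R : realType} {n : nat}.

Definition sample_mx m (t : m.-tuple (n.-tuple R)) : 'M[R]_(n, m) :=
  \matrix_(i, k) tnth (tnth t k) i.

Definition tuple_of_mx m (X : 'M[R]_(n, m)) : m.-tuple (n.-tuple R) :=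
  [tuple [tuple X i k | i < n] | k < m].

Lemma tuple_of_mxK m (X : 'M[R]_(n, m)) : sample_mx (tuple_of_mx X) = X.
Proof. by apply/matrixP => i k; rewrite mxE !tnth_mktuple. Qed.

Lemma polyfun_sample m (f : 'M[R]_(n, m) -> R) :
  polyfun setT entries f -> polyfun setT sample_gens (f \o @sample_mx m).
Proof.
apply: polyfun_comp => _ [i [k ->]]; apply: polyfun_gen.
exists (fun t => tnth t i), k; split; first by exists id, i.
by apply/funext => t; rewrite /= mxE.
Qed.

Lemma iid_polyfun_mx_ae m (mu : probability (n.-tuple (measurableTypeR R)) R) d
    (T : measurableType d) (P : probability T R)
    (X : 'I_m -> {RV P >-> n.-tuple (measurableTypeR R)}) (f : 'M[R]_(n, m) -> R) :
  mu `<< @lebesgue_tuple R n -> iid_samples X mu ->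
  polyfun setT entries f -> (exists Y, f Y != 0) ->
  {ae P, forall w, f (sample_mx (joint X w)) != 0}.
Proof.
move=> dom iid pf [Y fY]; apply: (iid_polyfun_ae dom iid (polyfun_sample pf)).
by exists (tuple_of_mx Y); rewrite /= tuple_of_mxK.
Qed.

(** A random sample lies in the cube with positive probability, while [f] is almost surely nonzero
    on it. *)
Lemma polyfun_near_neq0 m (f : 'M[R]_(n, m) -> R) (X0 : 'M[R]_(n, m)) (eps : R) :
  0 < eps -> polyfun setT entries f -> (exists Y, f Y != 0) ->
  exists2 X : 'M[R]_(n, m), (forall i k, `|X i k - X0 i k| < eps) & f X != 0.
Proof.
move=> eps0 pf fY; apply: contrapT => none.
have [mu [dom _ [d [T [P [X [iid near]]]]]]] :=
  @iid_samples_near R n m (tuple_of_mx X0) eps eps0.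
apply: (near (fun t => f (sample_mx t) != 0) _ (iid_polyfun_mx_ae dom iid pf fY)).
move=> t near_t ft; apply: none; exists (sample_mx t); last exact: ft.
by move=> i k; have := near_t k i; rewrite mxE /tuple_of_mx !tnth_mktuple.
Qed.

(** The nonzero set of [f] is open and that of [g] is dense. *)
Lemma polyfun_neq0_pair m (f g : 'M[R]_(n, m) -> R) :
  polyfun setT entries f -> polyfun setT entries g ->
  (exists Y, f Y != 0) -> (exists Y, g Y != 0) ->
  exists X, f X != 0 /\ g X != 0.
Proof.
move=> pf pg [Y fY] gZ.
have cf : continuous f := continuous_polyfun (@continuous_entries R n m) pf.
have : \forall X \near Y, f X != 0.
  have cY : f @ Y --> f Y := cf Y.
  exact: cvgr_neq0 cY fY.
move=> /nbhs_ballP[eps /= eps0 sub].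
have [X near_X gX] := polyfun_near_neq0 Y eps0 pg gZ.
exists X; split => //; apply: sub; split => // i k.
by rewrite /ball /= distrC.
Qed.

Variable e : rel 'I_n.

(** One stress-free matrix makes [stress_gram] a nonzero polynomial, which is then nonzero somewhere
    in the cube where every matrix has a stress. *)
Lemma robust_no_stress_free m (X : 'M[R]_(n, m)) :
  robust (R := R) e m -> ~ stress_free e X.
Proof.
move=> [X0 [eps eps0 sub]] /stress_gramP freeX.
have [C0 C1 CN1] := @int_valuesP R.
have pf : polyfun setT entries (@stress_gram R n e m).
  by apply: polyfun_sub (polyfun_stress_gram e m) => // g; exact: polyfun_gen.
have [Y near_Y] := polyfun_near_neq0 X0 eps0 pf (ex_intro _ X freeX).
by move=> /stress_gramP; apply: robust_not_stress_free; exact: sub.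
Qed.

Lemma mle_exists_of_stress_free m (x : 'I_m -> n.-tuple R) (X : 'M[R]_(n, m)) :
  (0 < n)%N -> (0 < m)%N -> (forall i k, X i k = tnth (x k) i) ->
  stress_free e X -> mle_exists e x.
Proof.
move=> n0 m0 XE free; apply: mle_exists_stress_free => // K mK Kx.
apply: free => //; apply/matrixP => i k.
have := congr1 (fun v : 'cV[R]_n => v i 0) (Kx k).
rewrite [X in X = _ -> _]mxE [X in _ = X -> _]mxE => KxE.
rewrite [LHS]mxE [RHS]mxE -[RHS]KxE.
by apply: eq_bigr => j _; rewrite mxE XE.
Qed.

Lemma mle_exists_as_of_stress_free m (X0 : 'M[R]_(n, m)) :
  (0 < n)%N -> (0 < m)%N -> stress_free e X0 -> mle_exists_as (R := R) e m.
Proof.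
move=> n0 m0 /stress_gramP free0 mu dom _ d T P X iid.
have pf : polyfun setT entries (@stress_gram R n e m).
  by apply: polyfun_sub (polyfun_stress_gram e m) => // g; exact: polyfun_gen.
have := iid_polyfun_mx_ae dom iid pf (ex_intro _ X0 free0).
apply: filterS => w /stress_gramP.
by apply: mle_exists_of_stress_free => // i k; rewrite mxE tnth_mktuple.
Qed.

Lemma robust_mle_not_exists_as m : (0 < m)%N ->
  robust (R := R) e m -> ~ mle_exists_as (R := R) e m.
Proof.
move=> m0 [X0 [eps eps0 sub]] mle.
have [mu [dom1 dom2 [d [T [P [X [iid near]]]]]]] :=
  @iid_samples_near R n m (tuple_of_mx X0) eps eps0.
apply: (near (fun t => mle_exists e (tnth t))); last first.
  apply: filterS (mle mu dom1 dom2 d T P X iid) => w.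
  rewrite (_ : tnth (joint X w) = fun k => X k w)//.
  by apply/funext => k; rewrite tnth_mktuple.
move=> t near_t.
have [|k [B [B0 BX eB]]] := sub (sample_mx t).
  by move=> i k; have := near_t k i; rewrite mxE /tuple_of_mx !tnth_mktuple.
apply: (@mle_not_exists R n e m (tnth t) k B) => // l.
have := congr1 (fun M : 'M[R]_(k, m) => col l M) BX.
rewrite colE -mulmxA -colE linear0 => <-; congr (_ *m _).
by apply/colP => i; rewrite !mxE.
Qed.

Lemma polyfun_mmap_rep k d (f : 'M[R]_(k, d) -> R) :
  polyfun int_values entries f ->
  exists q : mpoly.mpoly (k * d) rat, forall p,
    f p = mpoly.mmap (@ratr R) (fun i => mxvec p 0 i) q.
Proof.
elim=> [c [z ->]|g [i [j ->]]|f1 f2 _ [q1 E1] _ [q2 E2]|f1 f2 _ [q1 E1] _ [q2 E2]].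
- exists (mpoly.mpolyC (k * d) z%:~R) => p.
  by rewrite mpoly.mmapC /= ratr_int.
- exists (mpoly.mpolyX rat (mpoly.mnm1 (mxvec_index i j))) => p.
  by rewrite mpoly.mmapX mpoly.mmap1U mxvecE.
- by exists (q1 + q2) => p; rewrite E1 E2 mpoly.mmapD.
- exists (q1 * q2) => p; rewrite E1 E2.
  by rewrite (mpoly.mmap_is_multiplicative _ _).1.
Qed.

(** * Transfer to generic frameworks *)

Section Frameworks.
Hypotheses (e_sym : symmetric e) (e_irr : irreflexive e).

Definition affine_mx d (p : 'M[R]_(n, d)) : 'M[R]_(n, 1 + d) :=
  row_mx (const_mx 1) p.

(** The weights are the off-diagonal entries of [K]. Its diagonal is fixed by zero row sums, which
    is the condition from the constant column; equilibrium is then [K *m p = 0]. *)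
Lemma equilibrium_stressP d (p : 'M[R]_(n, d)) :
  (exists2 w, equilibrium_stress e p w & w != 0) <-> ~ stress_free e (affine_mx p).
Proof.
have rowsE (K : 'M[R]_n) i : (forall i j, i != j -> ~~ e i j -> K i j = 0) ->
    K *m const_mx 1 = 0 :> 'cV[R]_n ->
    \sum_(j | e i j) K i j *: (row j p - row i p) = row i (K *m p).
  move=> eK K1.
  have Ki : \sum_j K i j = 0.
    have := congr1 (fun v : 'cV[R]_n => v i 0) K1.
    rewrite [X in X = _ -> _]mxE [X in _ = X -> _]mxE => KE; rewrite -[RHS]KE.
    by apply: eq_bigr => j _; rewrite mxE mulr1.
  transitivity (\sum_j K i j *: (row j p - row i p)).
    rewrite big_mkcond; apply: eq_bigr => j _; case: ifPn => // eij.
    have [->|ij] := eqVneq i j; first by rewrite subrr scaler0.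
    by rewrite eK// scale0r.
  under eq_bigr do rewrite scalerBr.
  rewrite big_split /= sumrN -scaler_suml Ki scale0r subr0 row_mul mulmx_sum_row.
  by apply: eq_bigr => j _; rewrite mxE.
split.
  move=> [w [[sw ew] eq_w] w0] free; case/eqP: w0.
  (* The stress matrix of [w], a weighted Laplacian up to sign. *)
  pose K : 'M[R]_n := \matrix_(i, j) if i == j then - \sum_k w i k else w i j.
  have wii i : w i i = 0 by apply: ew; rewrite e_irr.
  have mK : model_space e K.
    split=> [|i j ij eij]; last by rewrite mxE (negbTE ij) ew.
    apply/matrixP => i j; rewrite !mxE [j == i]eq_sym; case: eqP => [->//|_].
    by rewrite -[in RHS]sw mxE.
  have K1 : K *m const_mx 1 = 0 :> 'cV[R]_n.
    apply/colP => i; rewrite !mxE (bigD1 i)//= !mxE eqxx mulr1.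
    rewrite [X in - X](bigD1 i)//= wii add0r.
    rewrite [X in _ + X](eq_bigr (fun j => w i j)) ?addNr// => j ji.
    by rewrite !mxE eq_sym (negbTE ji) mulr1.
  have Kp : K *m p = 0.
    apply/row_matrixP => i; rewrite -rowsE//; last by case: mK.
    rewrite row0 -[RHS](eq_w i); apply: eq_bigr => j eij; congr (_ *: _).
    by rewrite mxE; case: eqP => // ij; rewrite ij e_irr in eij.
  have K0 : K = 0 by apply: free; rewrite // /affine_mx mul_mx_row K1 Kp row_mx0.
  apply/matrixP => i j; have [->|ij] := eqVneq i j; first by rewrite wii mxE.
  by have := congr1 (fun M : 'M[R]_n => M i j) K0; rewrite !mxE (negbTE ij).
move=> nfree; apply: contrapT => nw; apply: nfree => K [sK eK].
rewrite /affine_mx mul_mx_row -(row_mx0 R n 1 d) => /eq_row_mx[K1 Kp].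
pose w : 'M[R]_n := \matrix_(i, j) if i == j then 0 else K i j.
have w0 : w = 0.
  apply: contrapT => /eqP w0; apply: nw; exists w => //; split.
    split=> [|i j eij].
      apply/matrixP => i j; rewrite !mxE eq_sym; case: eqP => // _.
      by rewrite -[in RHS]sK mxE.
    by rewrite mxE; case: eqP => // /eqP ij; rewrite eK.
  move=> i; transitivity (\sum_(j | e i j) K i j *: (row j p - row i p)).
    apply: eq_bigr => j eij; congr (_ *: _).
    by rewrite mxE; case: eqP => // ij; rewrite ij e_irr in eij.
  by rewrite rowsE// Kp row0.
have off i j : i != j -> K i j = 0.
  move=> ij; have := congr1 (fun M : 'M[R]_n => M i j) w0.
  by rewrite !mxE (negbTE ij).
apply/matrixP => i j; rewrite mxE; have [<-|ij] := eqVneq i j; last exact: off.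
have := congr1 (fun v : 'cV[R]_n => v i 0) K1.
rewrite !mxE (bigD1 i)//= big1 ?mxE ?mulr1 ?addr0// => k ki.
by rewrite off ?mul0r// eq_sym.
Qed.

Lemma robust_not_generically_stress_free d :
  robust (R := R) e d.+1 -> ~ generically_stress_free R e d.
Proof.
move=> rob; have [p gp] := @exists_generic R n d.
move=> []; exists p; split => //; apply/equilibrium_stressP.
exact: robust_no_stress_free rob.
Qed.

(** Scaling [K] by [c] on both sides carries stresses of the scaled matrix to stresses of [X] and
    preserves the zero pattern. *)
Lemma stress_free_scale m (X : 'M[R]_(n, m)) (c : 'I_n -> R) :
  (forall i, c i != 0) -> stress_free e X ->
  stress_free e (\matrix_(i, j) (c i * X i j)).
Proof.
move=> c0 free K [sK eK] KX.
pose L : 'M[R]_n := \matrix_(i, j) (c i * K i j * c j).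
have L0 : L = 0.
  apply: free.
    split=> [|i j ij eij]; last by rewrite mxE eK// mulr0 mul0r.
    apply/matrixP => i j; rewrite !mxE.
    have -> : K j i = K i j by rewrite -[in LHS]sK mxE.
    by ring.
  apply/matrixP => i k; rewrite [LHS]mxE [RHS]mxE.
  have := congr1 (fun M : 'M[R]_(n, m) => c i * M i k) KX.
  rewrite [X in c i * X]mxE [X in _ = _ * X -> _]mxE mulr0 mulr_sumr => KE.
  by rewrite -[RHS]KE; apply: eq_bigr => j _; rewrite !mxE !mulrA.
apply/matrixP => i j; have := congr1 (fun M : 'M[R]_n => M i j) L0.
by rewrite !mxE => /eqP; rewrite !mulf_eq0 !(negbTE (c0 _)) orbF => /eqP.
Qed.

(** A stress-free matrix with nowhere zero first column can be scaled to have first column 1. So the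
    integer polynomial in [p] testing for stresses is not zero, and a generic [p] is no root of
    it. *)
Lemma stress_free_generically d (X0 : 'M[R]_(n, 1 + d)) :
  stress_free e X0 -> generically_stress_free R e d.
Proof.
move=> /stress_gramP free0 [p [gp /equilibrium_stressP]]; apply; apply/stress_gramP.
have [C0 C1 CN1] := @int_valuesP R.
have pZ : polyfun int_values entries (fun p : 'M[R]_(n, d) => stress_gram e (affine_mx p)).
  apply: polyfun_comp (polyfun_stress_gram e (1 + d)) => _ [i [j ->]] /=.
  apply: (@polymx_row_mx R _ int_values entries n 1 d (fun=> const_mx 1) id).
    by apply: polymx_const => k l; rewrite mxE.
  by move=> k l; apply: polyfun_gen; exists k, l.
have [q qE] := polyfun_mmap_rep pZ.
have [X [freeX col0]] : exists X : 'M[R]_(n, 1 + d),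
    stress_gram e X != 0 /\ \prod_i X i 0 != 0.
  apply: polyfun_neq0_pair.
  - by apply: polyfun_sub (polyfun_stress_gram e (1 + d)) => // g; exact: polyfun_gen.
  - by apply: polyfun_prod => // i _; apply: polyfun_gen; exists i, 0.
  - by exists X0.
  - by exists (const_mx 1); rewrite big1 ?oner_neq0// => i _; rewrite mxE.
have X0' i : X i 0 != 0.
  by move: col0 => /prodf_neq0 /(_ i isT).
rewrite qE; apply: gp; apply: contra_neq freeX => q0.
pose Y : 'M[R]_(n, 1 + d) := \matrix_(i, j) ((X i 0)^-1 * X i j).
have YE : Y = affine_mx (rsubmx Y).
  rewrite -[LHS]hsubmxK; congr row_mx; apply/matrixP => i j.
  rewrite !mxE ord1 (_ : lshift d 0 = 0) ?mulVf//; exact/val_inj.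
apply/eqP; apply: contraT => /stress_gramP freeX.
have : stress_free e Y by apply: stress_free_scale => // i; rewrite invr_eq0.
by rewrite YE => /stress_gramP; rewrite qE q0 mpoly.mmap0 eqxx.
Qed.

End Frameworks.

End Samples.

(** * The threshold *)

(** The value [r] is [n] for the complete graph, [n - 1] for at most two non-edges or a star, and
    [n - 2] otherwise. *)
Lemma threshold_dichotomy (R : realType) (n : nat) (e : rel 'I_n) :
  (0 < n)%N -> symmetric e -> (#|complement_edges e| <= 5)%N ->
  exists r, [/\ (0 < r)%N, (n - 2 <= r)%N,
    exists X0 : 'M[R]_(n, r), stress_free e X0 &
    forall k, (0 < k < r)%N -> robust (R := R) e k].
Proof.
move=> n0 e_sym; rewrite -size_nonedges => c5.
have [c0|/eqP c0] := eqVneq (size (nonedges e)) 0%N.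
  exists n; split => //; [exact: leq_subr|exact: stress_free_complete|].
  by move=> k /andP[k0 kn]; apply: robust_complete => //; exact: size0nil.
have [x xe] : exists x, x \in nonedges e.
  by case: (nonedges e) c0 => [//|x s _]; exists x; rewrite mem_head.
have xne := nonedges_neq xe.
have ex : ~~ e x.1 x.2 by move: xe; rewrite mem_nonedges => /andP[].
have three (i j k : 'I_n) : uniq [:: i; j; k] -> (3 <= n)%N.
  by move=> /card_uniqP /= <-; rewrite -[X in (_ <= X)%N]card_ord max_card.
have two : (2 <= n)%N.
  have : uniq [:: x.1; x.2] by rewrite /= inE xne.
  by move=> /card_uniqP /= <-; rewrite -[X in (_ <= X)%N]card_ord max_card.
have [[m nE] nE'] : (exists m, n = m.+1) /\ n = n.-1.+1.
  by split; [exists n.-1|]; lia.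
have [small|big] := pselect ((size (nonedges e) <= 2)%N \/
    exists v, all (incident v) (nonedges e)).
  exists n.-1; split; [by lia|by lia|exact: stress_free_one nE' xne ex|].
  move=> k /andP[k0 kn]; case: small => [le2|[v star]].
    by apply: robust_two => //; lia.
  by apply: robust_star star _ _ => //; lia.
have nostar v : ~~ all (incident v) (nonedges e).
  by apply/negP => star; apply: big; right; exists v.
have c3 : (3 <= size (nonedges e))%N.
  by rewrite ltnNge; apply/negP => le2; apply: big; left.
(* This makes [n - 2] positive: a non-edge avoiding [x.1] gives three distinct vertices. *)
have n3 : (3 <= n)%N.
  have /allPn[z ze] := nostar x.1; rewrite /incident negb_or => /andP[z1 z2].
  apply: (three x.1 z.1 z.2); rewrite /= !inE !negb_or.
  by rewrite ![x.1 == _]eq_sym z1 z2 (nonedges_neq ze).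
exists n.-2; split; [by lia|by lia| |].
  by apply: stress_free_nonstar => //; lia.
by move=> k /andP[k0 kn]; apply: robust_five => //; lia.
Qed.

Theorem theorem1p7 (R : realType) (n : nat) (n_gt0 : (0 < n)%N)
    (e : rel 'I_n) (e_sym : symmetric e) (e_irr : irreflexive e)
    (e_compl : (#|complement_edges e| <= 5)%N) :
  exists r : nat, [/\ is_mlt R e r, is_gcr R e r & (n - 2 <= r)%N].
Proof.
have [r [r0 nr [X0 freeX0] rob]] := threshold_dichotomy R n_gt0 e_sym e_compl.
exists r; split => //.
  split; first by split => //; exact: mle_exists_as_of_stress_free freeX0.
  move=> j [j0 mle]; rewrite leqNgt; apply/negP => jr.
  by apply: (robust_mle_not_exists_as j0) mle; apply: rob; rewrite j0.
(* Frameworks in dimension [d] correspond to matrices with [d.+1] columns, the extra one being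
   constant. *)
case: r => [//|d] in r0 nr X0 freeX0 rob *.
exists d => //; split; first exact: (@stress_free_generically R n e e_irr d X0).
move=> j gen; rewrite leqNgt; apply/negP => jd.
by apply: (@robust_not_generically_stress_free R n e e_irr j) gen; exact: rob.
Qed.
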